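(* The value function $V$ of the infinite-horizon stopping problem satisfies for all $(t,i)\in[0,\infty)\times S$ $$V(t,i)=\sup_{\vartheta\ge0}\bigg\{U\big(g(i)-c(t+\vartheta)\big)e^{-q_i\vartheta}+\int_0^\vartheta e^{-q_is}\sum_{j\ne i}q_{ij}V(t+s,j)\,ds\bigg\}.$$ Moreover, there exists a maximizer $h^*$ of this equation, i.e. $$V(t,i)=U\big(g(i)-c(t+h^*(t,i))\big)e^{-q_ih^*(t,i)}+\int_0^{h^*(t,i)}e^{-q_is}\sum_{j\ne i}q_{ij}V(t+s,j)\,ds .$$
   Context: Markov chain: on a probability space $(\Omega,\mathcal F,\mathbb P)$, $(X_t)_{t\ge0}$ is a right-continuous continuous-time Markov chain with countable state space $S$ and intensity matrix $Q=(q_{ij})$, $0<q_i:=-q_{ii}=\sum_{j\ne i}q_{ij}<\infty$. Its jump times are $0=S_0<S_1<S_2<\dots$, $Z_n:=X_{S_n}$, and $X_t=\sum_{k\ge0}Z_k1_{\{S_k\le t<S_{k+1}\}}$ for all $t\ge0$; $S_{k+1}-S_k\sim\exp(q_{Z_k})$ and $\mathbb P(Z_{k+1}=j\mid Z_k=i)=q_{ij}/q_i$ for $j\ne i$. $(\mathcal F^X_t)$ is the natural filtration of $X$; $\mathbb P_i,\mathbb E_i$ denote probability and expectation given $X_0=i$. Utility, reward, cost: $g:S\to\mathbb R$ is a reward function, $c>0$ a cost rate, and $U$ is strictly increasing and strictly concave on $\mathrm{dom}(U)$, where one of the following holds: $\mathrm{dom}(U)=\mathbb R$; or $\mathrm{dom}(U)=[d,\infty)$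 with $d<\inf_{i}g(i)$ and $U$ continuous on its domain; or $\mathrm{dom}(U)=(d,\infty)$ with $d<\inf_ig(i)$, $U$ continuous on its domain and $\lim_{x\downarrow d}U(x)=-\infty$. $U:=-\infty$ outside $\mathrm{dom}(U)$, and $V(t,i)=-\infty$ for $t$ not in the domain $[0,\frac{g(i)-d}{c}]$, respectively $[0,\frac{g(i)-d}{c})$. $\Sigma$ is the set of $(\mathcal F^X_t)$-stopping times $\tau:\Omega\to[0,\infty)$ with $\mathbb P_i(\tau<\infty)=1$ for all $i\in S$. Standing assumptions: (A1) $\sup_{\tau\in\Sigma}\mathbb E_i[g^+(X_\tau)-c\tau]<\infty$ for all $i\in S$; (A2) $\liminf_{n\to\infty}\mathbb E_i[U(g(X_{\tau\wedge S_n})-c(t+\tau\wedge S_n))]\ge\mathbb E_i[U(g(X_\tau)-c(t+\tau))]$ for all $i\in S$, $t\ge0$, $\tau\in\Sigma$. Markovian stopping times: a Markovian stopping time is identified with a sequence $\tau=(h_0,h_1,\dots)$ of measurable maps $h_k:[0,\infty)\times S\to[0,\infty]$; given elapsed time $t\ge0$ it denotes the random time $\tau=S_k+h_k(t+S_k,Z_k)$ for the smallest $k\ge0$ with $S_k+h_k(t+S_k,Z_k)<S_{k+1}$ (and $\tau=\infty$ if there is none). $\Sigma^M$ is the class of such sequences for which $\tau$ is $\mathbb P_i$-a.s. finite for all $i\in S$, $t\ge0$. Value function: $V(t,i):=\sup_{\tau\in\Sigma^M}\mathbb E_i\big[U\big(g(X_\tau)-c(t+\tau)\big)\big]$, with $\tau$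 formed with elapsed time $t$. Maximizer: a measurable function $h^*$ with values in $[0,\infty]$ for which the second display holds for all $(t,i)$ (with $t$ in the domain), where for $h^*(t,i)=\infty$ the right-hand side is understood as the limit (limsup) as $\vartheta\to\infty$ of the expression with $\vartheta$ in place of $h^*(t,i)$. *)

(* Defs.v *)
From HB Require Import structures.
From mathcomp Require Import all_boot all_order all_algebra.
From mathcomp Require Import all_classical all_reals all_analysis.
From mathcomp Require Import measurable_realfun.
Import Order.TTheory GRing.Theory Num.Theory.
Import numFieldNormedType.Exports.

Set Implicit Arguments.
Unset Strict Implicit.
Unset Printing Implicit Defensive.

Local Open Scope classical_set_scope.
Local Open Scope ring_scope.

Record intensity_matrix (R : realType) (S : countType) (q : S -> S -> R) :
    Prop := IntensityMatrix {
  intensity_ge0 : forall i j, i != j -> 0 <= q i j ;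
  intensity_rate_gt0 : forall i, 0 < - q i i ;
  intensity_conservative : forall i,
    (- q i i)%:E = (\esum_(j in [set j | j != i]) (q i j)%:E)%E
}.

Definition rate (R : realType) (S : countType) (q : S -> S -> R) (i : S) : R :=
  - q i i.

(* S is countable and carries its discrete sigma-algebra, so that measurability
   of X s means that all sets X s @^-1` B are measurable. *)
Definition natural_filtration (R : realType) (S : countType) (T : Type)
    (X : R -> T -> S) (t : R) : set (set T) :=
  <<s [set A | exists s (B : set S), 0 <= s <= t /\ A = X s @^-1` B] >>.

Definition embedded (R : realType) (S : countType) (T : Type)
    (X : R -> T -> S) (J : nat -> T -> R) (n : nat) (w : T) : S := X (J n w) w.

(* The sigma-algebra generated by (J_0, Z_0), ..., (J_k, Z_k). *)
Definition jump_history (R : realType) (S : countType) (T : Type)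
    (X : R -> T -> S) (J : nat -> T -> R) (k : nat) : set (set T) :=
  <<s [set A | exists m : nat, (m <= k)%N /\
        ((exists B : set S, A = embedded X J m @^-1` B) \/
         (exists a : R, A = [set w | J m w <= a]))] >>.

(* The family P collects the laws given the initial state: P i is the
   probability under which X_0 = i.  J n is the n-th jump time (S_n in the usual
   notation; J 0 = 0).  jump_cover and jump_constant say that
   X_t = sum_k Z_k 1_{J_k <= t < J_(k+1)} for all t >= 0; in particular X is
   right-continuous and does not explode. *)
Record markov_chain (R : realType) (S : countType) (d : measure_display)
    (T : measurableType d) (P : S -> probability T R) (X : R -> T -> S)
    (J : nat -> T -> R) (q : S -> S -> R) : Prop := MarkovChain {
  chain_measurable : forall (t : R) (B : set S), 0 <= t -> measurable (X t @^-1` B) ;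
  chain_init : forall i, P i (X 0 @^-1` [set i]) = 1%E ;
  chain_markov : forall i (s r : R) (A : set T) (j l : S), 0 <= s -> 0 <= r ->
    natural_filtration X s A ->
    P i (A `&` X s @^-1` [set j] `&` X (s + r) @^-1` [set l]) =
    (P i (A `&` X s @^-1` [set j]) * P j (X r @^-1` [set l]))%E ;
  chain_intensity : forall i j,
    (fine (P i (X h @^-1` [set j])) - (i == j)%:R) / h @[h --> 0^'+] --> q i j ;
  jump0 : forall w, J 0%N w = 0 ;
  jump_lt : forall n w, J n w < J n.+1 w ;
  jump_cover : forall w (t : R), 0 <= t -> exists k, J k w <= t < J k.+1 w ;
  jump_constant : forall w t k, J k w <= t < J k.+1 w -> X t w = X (J k w) w ;
  jump_neq : forall n w, embedded X J n.+1 w <> embedded X J n w ;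
  (* Given the history up to J k and Z_k = l, the holding time J (k+1) - J k is
     exp(q_l)-distributed and independent of Z_(k+1), which equals j <> l with
     probability q_lj / q_l. *)
  jump_law : forall i k (A : set T) (l j : S) (u : R), j != l -> 0 <= u ->
    jump_history X J k A ->
    P i (A `&` embedded X J k @^-1` [set l]
           `&` [set w | u < J k.+1 w - J k w]
           `&` embedded X J k.+1 @^-1` [set j]) =
    (P i (A `&` embedded X J k @^-1` [set l]) *
     (expR (- (rate q l * u)) * (q l j / rate q l))%:E)%E
}.

(* dom is dom(U); u gives the values of U on dom, its values elsewhere are
   irrelevant. *)
Definition utility_dom (R : realType) (S : countType) (g : S -> R)
    (dom : set R) (u : R -> R) : Prop :=
  dom = setT \/
  (exists d : R, [/\ dom = `[d, +oo[%classic,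
     (d%:E < ereal_inf [set (g i)%:E | i in [set: S]])%E &
     {within dom, continuous u}]) \/
  (exists d : R, [/\ dom = `]d, +oo[%classic,
     (d%:E < ereal_inf [set (g i)%:E | i in [set: S]])%E,
     {within dom, continuous u} &
     u x @[x --> d^'+] --> -oo]).

Record is_utility (R : realType) (S : countType) (g : S -> R)
    (dom : set R) (u : R -> R) : Prop := IsUtility {
  utility_domain : utility_dom g dom u ;
  utility_increasing : forall x y, dom x -> dom y -> x < y -> u x < u y ;
  utility_concave : forall x y a, dom x -> dom y -> x != y -> 0 < a < 1 ->
    a * u x + (1 - a) * u y < u (a * x + (1 - a) * y)
}.

Definition utility (R : realType) (dom : set R) (u : R -> R) (x : R) : \bar R :=
  if `[< dom x >] then (u x)%:E else -oo%E.

(* The class Sigma of almost surely finite stopping times of the natural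
   filtration.  They are allowed to be infinite on a null event, as Markovian
   stopping times are. *)
Record stopping_time (R : realType) (S : countType) (d : measure_display)
    (T : measurableType d) (P : S -> probability T R) (X : R -> T -> S)
    (tau : T -> \bar R) : Prop := StoppingTime {
  stopping_ge0 : forall w, (0 <= tau w)%E ;
  stopping_adapted : forall t : R, 0 <= t ->
    natural_filtration X t [set w | (tau w <= t%:E)%E] ;
  stopping_finite : forall i, P i [set w | (tau w < +oo)%E] = 1%E
}.

(* g^+(X_tau) - c tau; the value on the null event tau = oo is irrelevant (this
   is also the case in payoff below). *)
Definition gain (R : realType) (S : countType) (T : Type) (X : R -> T -> S)
    (g : S -> R) (c : R) (tau : T -> \bar R) (w : T) : \bar R :=
  (Num.max (g (X (fine (tau w)) w)) 0 - c * fine (tau w))%:E.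

Definition payoff (R : realType) (S : countType) (T : Type) (X : R -> T -> S)
    (g : S -> R) (c : R) (dom : set R) (u : R -> R) (t : R)
    (tau : T -> \bar R) (w : T) : \bar R :=
  utility dom u (g (X (fine (tau w)) w) - c * (t + fine (tau w))).

(* The library integral returns -oo when the integrals of the positive and the
   negative parts are both infinite.  The first clause states that the
   expectations in the supremum exist, as values < +oo. *)
Definition assumptionA1 (R : realType) (S : countType) (d : measure_display)
    (T : measurableType d) (P : S -> probability T R) (X : R -> T -> S)
    (g : S -> R) (c : R) : Prop :=
  forall i,
    (forall tau, stopping_time P X tau ->
       (\int[P i]_w ((gain X g c tau)^\+ w) < +oo)%E) /\
    (ereal_sup [set (\int[P i]_w gain X g c tau w)%E |
                tau in [set tau | stopping_time P X tau]] < +oo)%E.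

Definition assumptionA2 (R : realType) (S : countType) (d : measure_display)
    (T : measurableType d) (P : S -> probability T R) (X : R -> T -> S)
    (J : nat -> T -> R) (g : S -> R) (c : R) (dom : set R) (u : R -> R) : Prop :=
  forall i (t : R) tau, 0 <= t -> stopping_time P X tau ->
    (\int[P i]_w payoff X g c dom u t tau w <=
     limn_einf (fun n => \int[P i]_w
       payoff X g c dom u t (fun w' => Order.min (tau w') (J n w')%:E) w))%E.

Definition markov_stops (R : realType) (S : countType) (T : Type)
    (X : R -> T -> S) (J : nat -> T -> R) (h : nat -> R -> S -> \bar R)
    (t : R) (w : T) (k : nat) : bool :=
  ((J k w)%:E + h k (t + J k w)%R (embedded X J k w) < (J k.+1 w)%:E)%E.

Definition markov_time (R : realType) (S : countType) (T : Type)
    (X : R -> T -> S) (J : nat -> T -> R) (h : nat -> R -> S -> \bar R)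
    (t : R) (w : T) : \bar R :=
  match pselect (exists k, markov_stops X J h t w k) with
  | left ex => let k := ex_minn ex in
               ((J k w)%:E + h k (t + J k w)%R (embedded X J k w))%E
  | right _ => +oo%E
  end.

(* Measurable maps [0,oo) x S -> [0,oo]; S being countable with the discrete
   sigma-algebra, measurability is sectionwise. *)
Definition measurable_rule (R : realType) (S : countType)
    (f : R -> S -> \bar R) : Prop :=
  forall i, measurable_fun (`[0, +oo[%classic : set R) (f^~ i) /\
    (forall t : R, 0 <= t -> (0 <= f t i)%E).

Record markovian (R : realType) (S : countType) (d : measure_display)
    (T : measurableType d) (P : S -> probability T R) (X : R -> T -> S)
    (J : nat -> T -> R) (h : nat -> R -> S -> \bar R) : Prop := Markovian {
  markovian_rule : forall k, measurable_rule (h k) ;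
  markovian_finite : forall i (t : R), 0 <= t ->
    P i [set w | (markov_time X J h t w < +oo)%E] = 1%E
}.

(* t is in the domain [0, (g(i) - d) / c], [0, (g(i) - d) / c) or [0, oo) of
   V(., i), according to the form of dom(U). *)
Definition value_dom (R : realType) (S : countType) (g : S -> R) (c : R)
    (dom : set R) (t : R) (i : S) : Prop := 0 <= t /\ dom (g i - c * t).

Definition value (R : realType) (S : countType) (d : measure_display)
    (T : measurableType d) (P : S -> probability T R) (X : R -> T -> S)
    (J : nat -> T -> R) (g : S -> R) (c : R) (dom : set R) (u : R -> R)
    (t : R) (i : S) : \bar R :=
  if `[< value_dom g c dom t i >] then
    ereal_sup [set (\int[P i]_w payoff X g c dom u t (markov_time X J h t) w)%E |
               h in [set h | markovian P X J h]]
  else -oo%E.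

(* Sum of a family of arbitrary sign: esum is a supremum of finite partial sums
   and is only meant for nonnegative families. *)
Definition signed_esum (R : realType) (S : countType) (A : set S)
    (f : S -> \bar R) : \bar R :=
  (\esum_(j in A) (f^\+ j) - \esum_(j in A) (f^\- j))%E.

Definition bellman_rhs (R : realType) (S : countType) (q : S -> S -> R)
    (g : S -> R) (c : R) (dom : set R) (u : R -> R) (V : R -> S -> \bar R)
    (t : R) (i : S) (theta : R) : \bar R :=
  (utility dom u (g i - c * (t + theta))%R * (expR (- (rate q i * theta)))%:E +
   \int[lebesgue_measure]_(s in `[0%R, theta]%classic)
     ((expR (- (rate q i * s)))%:E *
      signed_esum [set j | j != i] (fun j => (q i j)%:E * V (t + s)%R j)))%E.

Definition bellman_rhs_ext (R : realType) (S : countType) (q : S -> S -> R)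
    (g : S -> R) (c : R) (dom : set R) (u : R -> R) (V : R -> S -> \bar R)
    (t : R) (i : S) (theta : \bar R) : \bar R :=
  match theta with
  | r%:E => bellman_rhs q g c dom u V t i r
  | _ => limf_esup (bellman_rhs q g c dom u V t i) (pinfty_nbhs R)
  end.

Definition bellman_maximizer (R : realType) (S : countType) (q : S -> S -> R)
    (g : S -> R) (c : R) (dom : set R) (u : R -> R) (V : R -> S -> \bar R)
    (hstar : R -> S -> \bar R) : Prop :=
  measurable_rule hstar /\
  (forall t i, value_dom g c dom t i ->
     V t i = bellman_rhs_ext q g c dom u V t i (hstar t i)).

(* Main.v *)
Require Import Defs.
From HB Require Import structures.
From mathcomp Require Import all_boot all_order all_algebra.
From mathcomp Require Import all_classical all_reals all_analysis.
From mathcomp Require Import measurable_realfun lra.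
Import Order.TTheory GRing.Theory Num.Theory.
Import numFieldNormedType.Exports.
Set Implicit Arguments.
Unset Strict Implicit.
Unset Printing Implicit Defensive.
Local Open Scope classical_set_scope.
Local Open Scope ring_scope.

(** The equation is solved by value iteration. Let T be the operator that maps
    a function W of the date and the state to the supremum over theta of the
    right-hand side of the equation (bellman_sup), let V_0 (t, i) be the value
    U (g i - c t) of stopping at once, and V_(n+1) = T V_n (iterate). Let V be
    the supremum of the V_n (jump_value). It is shown that V_n is the best
    expected payoff of those who have to stop at the n-th jump at the latest,
    that V = T V, and that V is the value function.

    Monotonicity in the date. Delay costs c per unit of time, so all these
    functions are nonincreasing in t, hence measurable. The right-hand side is
    upper semicontinuous in theta (bellman_usc). Its supremum is therefore
    attained or else equal to the limsup at infinity, and the smallest maximizer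
    h, set to +oo in the second case, satisfies the second display
    (bellman_ext_first_maximizer). The date t + h (t, i) at which one stops is
    nondecreasing in t (stopping_date_nondecreasing), whence h is measurable.

    Bounded rules. Given the history up to a jump, the holding time and the next
    state have the prescribed laws and are independent (one_step_integral). So
    the expected payoff of a rule that stops at the n-th jump at the latest
    obeys a backward recursion (pay_reward, rule_valueS), and by induction no
    such rule beats V_n (rule_value_le_iterate), while the rule made of the
    successive first maximizers attains it (rule_value_optimal). The delicate
    point is the value +oo of a waiting time. The rule then waits for the jump,
    whereas the equation takes a limsup, which could be smaller because of the
    stop term. This is excluded by wait_le_sup: the loss from stopping late is,
    up to constants, at most the loss after a later jump (utility_growth), so it
    is negligible along a sequence of dates whenever the latter is integrable.
    Integrability of positive parts comes from assumptionA1, because the concave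
    utility lies below an affine function (payoff_le_gain).

    The equation for V. One has V_(n+1) = T V_n <= T V by monotonicity. For the
    converse, wait for theta and, if the chain jumps before to j at date s,
    follow from there the optimal rule with the least horizon N (s, j) such that
    V_N (s, j) >= V (s, j) - eps. This rule remembers the choice made at the
    first jump, so it is not Markovian, but it is a stopping time of the natural
    filtration (switch_stopping_time) and is worth at least the right-hand side
    for V and theta, minus eps. By assumptionA2 its expected payoff is at most
    the limit inferior of those of its truncations at the jumps, which are at
    most some V_m, hence at most V (bellman_le_eps).

    The value function. V_n is the expected payoff of a Markovian rule; and by
    assumptionA2 that of any Markovian rule is at most the limit inferior of
    those of its truncations, hence at most V (value_jump_value). *)

(** * Sums and integrals over a countable index *)

Section CountableSums.
Local Open Scope ereal_scope.
Context {R : realType} {S : countType}.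

(** Reading b along the enumeration of S turns sums over S into series. *)
Definition enum_fun (b : S -> \bar R) (n : nat) : \bar R :=
  oapp b 0 (@pickle_inv S n).

Lemma enum_fun_ge0 b n : (forall j, 0 <= b j) -> 0 <= enum_fun b n.
Proof. by move=> b0; rewrite /enum_fun; case: pickle_inv => //=. Qed.

Lemma esum_enum (b : S -> \bar R) : (forall j, 0 <= b j) ->
  \esum_(j in [set: S]) b j = \sum_(n <oo) enum_fun b n.
Proof.
move=> b0.
rewrite nneseries_esumT; last by move=> n; exact: enum_fun_ge0.
transitivity (\esum_(n in pickle @` [set: S]) enum_fun b n).
  rewrite esum_image; last by move=> x y _ _; exact: (pcan_inj pickleK).
  by apply: eq_esum => j _; rewrite /enum_fun pickleK_inv.
rewrite [LHS]esum_mkcond; apply: eq_esum => n _.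
case: ifPn => // /negP nn; rewrite /enum_fun.
case E : (@pickle_inv S n) => [j|//]; exfalso; apply: nn; rewrite inE /=.
by exists j => //; have := @pickle_invK S n; rewrite /ocancel E.
Qed.

Lemma esum_enum_cond (A : set S) (b : S -> \bar R) : (forall j, 0 <= b j) ->
  \esum_(j in A) b j =
  \sum_(n <oo) enum_fun (fun j => if j \in A then b j else 0) n.
Proof.
move=> b0; rewrite esum_mkcond esum_enum // => j.
by case: ifP.
Qed.

Lemma esumZl (A : set S) (b : S -> \bar R) (k : R) :
  (0 <= k)%R -> (forall j, 0 <= b j) ->
  \esum_(j in A) (k%:E * b j) = k%:E * \esum_(j in A) b j.
Proof.
move=> k0 b0; rewrite !esum_enum_cond //; last by move=> j; rewrite mule_ge0.
rewrite -nneseriesZl //; last first.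
  by move=> n _; apply: enum_fun_ge0 => j; case: ifP.
congr (limn _); apply/funext => m; apply: eq_bigr => n _.
rewrite /enum_fun; case: pickle_inv => [j|] /=; last by rewrite mule0.
by case: ifP => //; rewrite mule0.
Qed.

Context {d : measure_display} {T : measurableType d}.

Lemma measurable_esum (D : set T) (A : set S) (f : S -> T -> \bar R) :
  (forall j, measurable_fun D (f j)) ->
  (forall j x, 0 <= f j x) ->
  measurable_fun D (fun x => \esum_(j in A) f j x).
Proof.
move=> mf f0.
rewrite (_ : (fun x => _) =
    (fun x => \sum_(n <oo) enum_fun (fun j => if j \in A then f j x else 0) n)).
  apply: (@ge0_emeasurable_sum _ _ _ D
    (fun n x => enum_fun (fun j => if j \in A then f j x else 0) n) xpredT).
    by move=> n x _ _; apply: enum_fun_ge0 => j; case: ifP.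
  move=> n _; rewrite /enum_fun; case: pickle_inv => [j|] /=; last exact: measurable_cst.
  by case: (j \in A) => //; exact: measurable_cst.
by apply/funext => x; rewrite esum_enum_cond.
Qed.

Lemma integral_esum (mu : {measure set T -> \bar R}) (D : set T) (A : set S)
    (f : S -> T -> \bar R) :
  measurable D ->
  (forall j, measurable_fun D (f j)) ->
  (forall j x, 0 <= f j x) ->
  \int[mu]_(x in D) (\esum_(j in A) f j x) =
  \esum_(j in A) \int[mu]_(x in D) f j x.
Proof.
move=> mD mf f0.
transitivity (\int[mu]_(x in D)
    \sum_(n <oo) enum_fun (fun j => if j \in A then f j x else 0) n).
  by apply: eq_integral => x _; rewrite esum_enum_cond.
rewrite integral_nneseries //.
- rewrite esum_enum_cond; last by move=> j; apply: integral_ge0.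
  congr (limn _); apply/funext => m; apply: eq_bigr => n _.
  rewrite /enum_fun; case: pickle_inv => [j|] /=; last by rewrite integral0.
  by case: ifP => //; rewrite integral0.
- move=> n; rewrite /enum_fun; case: pickle_inv => [j|] /=; last exact: measurable_cst.
  by case: (j \in A) => //; exact: measurable_cst.
- by move=> n x _; apply: enum_fun_ge0 => j; case: ifP.
Qed.

(** The indicators of the fibers of Z add up to 1. *)
Lemma integral_fibers (mu : {measure set T -> \bar R}) (D : set T) (Z : T -> S)
    (f : T -> \bar R) :
  measurable D -> (forall j, measurable (Z @^-1` [set j])) ->
  measurable_fun [set: T] f -> (forall x, 0 <= f x) ->
  \int[mu]_(x in D) f x =
  \esum_(j in [set: S]) \int[mu]_(x in D `&` Z @^-1` [set j]) f x.
Proof.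
move=> mD mZ mf f0.
transitivity (\esum_(j in [set: S])
    \int[mu]_(x in D) (f \_ (Z @^-1` [set j])) x).
  rewrite -integral_esum //; last 2 first.
  - move=> j; apply: measurable_funTS.
    exact: ((measurable_restrictT f (mZ j)).1 (measurable_funTS mf)).
  - by move=> j x; exact: erestrict_ge0.
  apply: eq_integral => x _.
  rewrite (esumID [set Z x]) //; last by move=> j _; exact: erestrict_ge0.
  rewrite setTI esum_set1; last by exact: erestrict_ge0.
  rewrite patchE mem_set //= [X in _ + X]esum1 ?adde0 // => j [_ /= jZ].
  by rewrite patchE memNset //= => Zj; apply: jZ.
by apply: eq_esum => j _; rewrite integral_mkcondr.
Qed.

(** Z partitions the space into countably many measurable fibers, on each of
    which the function is one of the f j. *)
Lemma measurable_select (Z : T -> S) (f : S -> T -> \bar R) :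
  (forall j, measurable (Z @^-1` [set j])) ->
  (forall j, measurable_fun [set: T] (f j)) ->
  measurable_fun [set: T] (fun x => f (Z x) x).
Proof.
move=> mZ mf.
have -> : [set: T] = \bigcup_(n in [set: nat])
    (if unpickle n is Some j then Z @^-1` [set j] else set0).
  apply/seteqP; split => // x _; exists (pickle (Z x)) => //=.
  by rewrite pickleK.
apply/measurable_fun_bigcup => n; first by case: unpickle.
case: unpickle => [j|]; last exact: measurable_fun_set0.
apply: (@eq_measurable_fun _ _ _ _ _ (f j)); first by move=> x /set_mem /= ->.
exact: measurable_funTS.
Qed.

End CountableSums.

(** * Integrals of differences *)

Section SignedIntegral.
Local Open Scope ereal_scope.
Context {R : realType}.

(** For infinite x and y this rests on the convention oo - oo = -oo. *)
Lemma pos_neg_partsD (x y : \bar R) : 0 <= x -> 0 <= y ->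
  maxe (x - y) 0 + y = x + maxe (- (x - y)) 0.
Proof.
case: x => [x| |] // x0; case: y => [y| |] // y0; last first.
- by rewrite /= ?maxye ?maxNye ?add0e ?adde0.
- by rewrite /= ?maxye ?maxNye ?add0e ?adde0.
- by rewrite /= ?maxye ?maxNye ?add0e ?adde0.
rewrite !lee_fin in x0 y0.
rewrite -EFinB -EFinN -!EFin_max -!EFinD; congr EFin.
case: (lerP (x - y) 0) => h; case: (lerP (- (x-y)) 0) => h2 //; lra.
Qed.

(** Additivity of integrals yields identities between sums of nonnegative
    terms; this turns them into identities between differences. *)
Lemma sube_of_addeE (p m x y : \bar R) : 0 <= p -> 0 <= m -> 0 <= x -> 0 <= y ->
  x < +oo -> p <= x -> p + y = x + m -> p - m = x - y.
Proof.
case: x => [x| |] //; case: p => [p| |] //.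
case: y => [y| |]; case: m => [m| |] // *.
have [] : (p%:E + y%:E = x%:E + m%:E)%E by [].
move=> h; rewrite -!EFinB; congr EFin; lra.
Qed.

Lemma maxe_sub_le (x y : \bar R) : 0 <= x -> 0 <= y -> maxe (x - y) 0 <= x.
Proof.
move=> x0 y0; rewrite ge_max x0 andbT.
case: x x0 => [x| |] // x0; last by rewrite leey.
case: y y0 => [y| |] // y0; last by rewrite leNye.
by rewrite -EFinB lee_fin; move: y0; rewrite lee_fin => y0; lra.
Qed.

Context {d : measure_display} {T : measurableType d}.

(** The difference may be -oo on a set of positive measure; that the integral
    of the minuend is finite excludes the form oo - oo. *)
Lemma integralB_ge0 (mu : {measure set T -> \bar R}) (D : set T)
    (a b : T -> \bar R) :
  measurable D -> measurable_fun D a -> measurable_fun D b ->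
  (forall x, 0 <= a x) -> (forall x, 0 <= b x) ->
  \int[mu]_(x in D) a x < +oo ->
  \int[mu]_(x in D) (a x - b x) =
  \int[mu]_(x in D) a x - \int[mu]_(x in D) b x.
Proof.
move=> mD ma mb a0 b0 ia; rewrite integralE.
have mab : measurable_fun D (fun x => a x - b x) by exact: emeasurable_funB.
have mp : measurable_fun D ((fun x => a x - b x)^\+) by exact: measurable_funepos.
have mn : measurable_fun D ((fun x => a x - b x)^\-) by exact: measurable_funeneg.
apply: sube_of_addeE => //; try by apply: integral_ge0.
  by apply: ge0_le_integral => // x _; rewrite funeposE; exact: maxe_sub_le.
rewrite -!ge0_integralD //; apply: eq_integral => x _.
by rewrite funeposE funenegE pos_neg_partsD.
Qed.

Lemma le_integral_parts (mu : {measure set T -> \bar R}) (D : set T)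
    (f g : T -> \bar R) :
  measurable D -> measurable_fun D f -> measurable_fun D g ->
  (forall x, D x -> f x <= g x) ->
  \int[mu]_(x in D) f x <= \int[mu]_(x in D) g x.
Proof.
move=> mD mf mg fg; rewrite integralE [leRHS]integralE; apply: leeB.
  apply: ge0_le_integral => //; try exact: measurable_funepos.
  by move=> x Dx; rewrite !funeposE ge_max !le_max lexx fg ?orbT.
apply: ge0_le_integral => //; try exact: measurable_funeneg.
by move=> x Dx; rewrite !funenegE ge_max !le_max lexx leeN2 fg ?orbT.
Qed.

End SignedIntegral.

(** * Translates and exponentials *)

Section Translation.
Local Open Scope ereal_scope.
Context {R : realType}.
Local Notation mu := (@lebesgue_measure R).

Lemma measurable_translation (a : R) :
  measurable_fun [set: measurableTypeR R]
    ((fun x => x + a)%R : measurableTypeR R -> measurableTypeR R).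
Proof. exact: measurable_funD. Qed.

Lemma lebesgue_measure_translation (a : R) (A : set R) : measurable A ->
  pushforward mu ((fun x => x + a)%R : measurableTypeR R -> measurableTypeR R) A
  = mu A.
Proof.
pose phi : {mfun measurableTypeR R >-> measurableTypeR R} :=
  HB.pack ((fun x => x + a)%R : measurableTypeR R -> measurableTypeR R)
    (isMeasurableFun.Build _ _ _ _ _ (measurable_translation a)).
move=> mA; apply/esym/(@lebesgue_measure_unique _ (pushforward mu phi))
  => //= _ [[x y]] _ <-.
rewrite /pushforward /=.
rewrite (_ : _ @^-1` _ = `](x - a)%R, (y - a)%R]%classic); last first.
  by apply/seteqP; split=> z /=; rewrite !in_itv /= => /andP[h1 h2]; apply/andP; split; lra.
rewrite !lebesgue_measure_itv /= !lte_fin ltrD2r.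
by case: ifP => // _; rewrite -!EFinB; congr EFin; lra.
Qed.

Lemma ge0_integral_translation (a : R) (D : set R) (f : R -> \bar R) :
  measurable D -> measurable_fun [set: R] f -> (forall x, 0 <= f x) ->
  \int[mu]_(x in D) f x =
  \int[mu]_(x in [set x | D (x + a)%R]) f (x + a)%R.
Proof.
move=> mD mf f0.
rewrite -(@ge0_integral_pushforward _ _ _ _ R _ (measurable_translation a)) //.
- apply: eq_measure_integral => [|mt A mA _]; first exact: measurable_translation.
  exact: (esym (lebesgue_measure_translation a _)).
- exact: measurable_funTS.
Qed.

End Translation.

Section ExponentialIntegral.
Context {R : realType}.
Local Notation mu := (@lebesgue_measure R).

Lemma integral_exp_tail (r u : R) : 0 < r -> 0 <= u ->
  (\int[mu]_(s in `[u, +oo[) (r * expR (- (r * s)))%:E = (expR (- (r * u)))%:E)%E.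
Proof.
move=> r0 u0.
have cexp : continuous (fun z : R^o => expR (- (r * z))).
  move=> z; apply: continuous_comp; last exact: continuous_expR.
  by apply: (@continuousN _ R^o); apply: continuousM => //; exact: cst_continuous.
rewrite (@ge0_continuous_FTC2y _ _ (fun x => - expR (- (r * x))) _ 0) //.
- by rewrite EFinN oppeK add0e.
- by move=> x _; rewrite mulr_ge0 ?expR_ge0// ltW.
- apply: continuous_subspaceT => z.
  by apply: cvgM; [exact: cvg_cst|exact: cexp].
- rewrite -oppr0; apply: cvgN.
  rewrite (_ : (fun x => expR (- (r * x))) =
               (fun z => expR (- z)) \o (fun z => r * z)) //.
  apply: (@cvg_comp _ _ _ _ _ _ (pinfty_nbhs R)); last exact: cvgr_expR.
  exact: gt0_cvgMry.
- by apply: cvgN; apply/cvg_at_right_filter; exact: cexp.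
- move=> z; rewrite in_itv/= andbT => z0.
  rewrite derive1_comp// derive1N// derive1_id mulN1r derive1_comp// derive1E.
  have /funeqP -> := @derive_expR R.
  by rewrite derive1N // derive1Ml// derive1_id mulr1 mulrN opprK mulrC.
Qed.

Lemma measurable_exponential_density (r : R) (D : set R) :
  measurable_fun D (fun s : R => (r * expR (- (r * s)))%:E).
Proof.
apply: measurable_funTS; apply/measurable_EFinP; apply: measurable_funM => //.
by apply: measurableT_comp => //; apply: measurable_funN; exact: mulrl_measurable.
Qed.

End ExponentialIntegral.

(** * Positive and negative parts *)

Section PosNegParts.
Local Open Scope ereal_scope.
Context {R : realType}.

Definition epos (x : \bar R) : \bar R := maxe x 0.
Definition eneg (x : \bar R) : \bar R := maxe (- x) 0.

Lemma epos_ge0 x : 0 <= epos x. Proof. by rewrite /epos le_max lexx orbT. Qed.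
Lemma eneg_ge0 x : 0 <= eneg x. Proof. by rewrite /eneg le_max lexx orbT. Qed.
Lemma le_epos x y : x <= y -> epos x <= epos y.
Proof. by move=> xy; rewrite /epos ge_max !le_max xy lexx orbT. Qed.
Lemma le_eneg x y : x <= y -> eneg y <= eneg x.
Proof. by move=> xy; rewrite /eneg ge_max !le_max leeN2 xy lexx orbT. Qed.
Lemma ge_epos x : x <= epos x. Proof. by rewrite /epos le_max lexx. Qed.
Lemma eposBeneg x : epos x - eneg x = x.
Proof.
case: x => [r| |]; rewrite /epos /eneg.
- rewrite -EFinN -!EFin_max -EFinB; congr EFin.
  by case: (lerP r 0) => h; case: (lerP (- r) 0) => h2; lra.
- by rewrite maxye max_r ?sube0 // leNye.
- by rewrite max_r ?leNye // add0e maxye.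
Qed.

Lemma eposM (k : R) x : (0 <= k)%R -> epos (k%:E * x) = k%:E * epos x.
Proof.
move=> k0; rewrite /epos; have [x0|x0] := leP x 0.
  by rewrite mule0 max_r // mule_ge0_le0.
by rewrite max_l // mule_ge0 // ltW.
Qed.
Lemma enegM (k : R) x : (0 <= k)%R -> eneg (k%:E * x) = k%:E * eneg x.
Proof. by move=> k0; rewrite /eneg -muleN; exact: eposM. Qed.

Lemma measurable_epos d (T : measurableType d) D (f : T -> \bar R) :
  measurable_fun D f -> measurable_fun D (fun x => epos (f x)).
Proof. by move=> mf; apply: measurable_maxe. Qed.
Lemma measurable_eneg d (T : measurableType d) D (f : T -> \bar R) :
  measurable_fun D f -> measurable_fun D (fun x => eneg (f x)).
Proof. by move=> mf; apply: measurable_maxe => //; exact: measurableT_comp. Qed.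

Lemma measurable_lee_fun d (T : measurableType d) (f g : T -> \bar R) :
  measurable_fun [set: T] f -> measurable_fun [set: T] g ->
  measurable [set x | f x <= g x].
Proof.
move=> mf mg.
(* g - f is -oo where f and g are the same infinity, although f <= g there *)
have -> : [set x | f x <= g x] =
    f @^-1` [set -oo] `|` g @^-1` [set +oo] `|` [set x | 0 <= (fun x => g x - f x) x].
  apply/seteqP; split=> x /=.
    case: (f x) => [a| |]; case: (g x) => [b| |] //;
      try (by move=> _; left; left); try (by move=> _; left; right).
    by rewrite lee_fin -EFinB lee_fin => ab; right; rewrite subr_ge0.
  move=> [[fN|gy]|].
  - by rewrite (fN : f x = -oo) leNye.
  - by rewrite (gy : g x = +oo) leey.
  - case: (f x) => [a| |]; case: (g x) => [b| |]; rewrite ?leey ?leNye //.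
    by rewrite -EFinB !lee_fin subr_ge0.
apply: measurableU; first apply: measurableU.
- by rewrite -[X in measurable X]setTI; apply: mf => //; exact: emeasurable_set1.
- by rewrite -[X in measurable X]setTI; apply: mg => //; exact: emeasurable_set1.
- rewrite -[X in measurable X]setTI; apply: emeasurable_fun_c_infty => //.
  exact: emeasurable_funB.
Qed.

End PosNegParts.

(** * Discounted integrals over the next jump *)

Section JumpOperator.
Local Open Scope ereal_scope.
Context {R : realType} {S : countType} (q : S -> S -> R).
Hypothesis hq : intensity_matrix q.
Local Notation mu := (@lebesgue_measure R).

(** The intensities off the diagonal, extended by 0 so that sums run over all
    of S. *)
Definition jump_weight (i j : S) : R := if j != i then q i j else 0%R.

Lemma jump_weight_ge0 i j : (0 <= jump_weight i j)%R.
Proof.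
by rewrite /jump_weight; case: ifPn => // ji; apply: (intensity_ge0 hq); rewrite eq_sym.
Qed.

Lemma rate_gt0 i : (0 < rate q i)%R. Proof. exact: (intensity_rate_gt0 hq). Qed.
Hint Resolve rate_gt0 : core.

Lemma mem_other (i j : S) : (j \in [set j | j != i]) = (j != i).
Proof. by apply/idP/idP; rewrite inE. Qed.

Definition jump_sum (i : S) (a : S -> \bar R) : \bar R :=
  \esum_(j in [set: S]) ((jump_weight i j)%:E * a j).

Lemma jump_sum_ge0 i a : (forall j, 0 <= a j) -> 0 <= jump_sum i a.
Proof.
by move=> a0; apply: esum_ge0 => j _; rewrite mule_ge0 // lee_fin jump_weight_ge0.
Qed.

Lemma le_jump_sum i a b : (forall j, a j <= b j) -> jump_sum i a <= jump_sum i b.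
Proof.
by move=> ab; apply: le_esum => j _; rewrite lee_wpmul2l // lee_fin jump_weight_ge0.
Qed.

Lemma jump_sumD i a b : (forall j, 0 <= a j) -> (forall j, 0 <= b j) ->
  jump_sum i (fun j => a j + b j) = jump_sum i a + jump_sum i b.
Proof.
move=> a0 b0; rewrite -esumD; last 2 first.
- by move=> j _; rewrite mule_ge0 // lee_fin jump_weight_ge0.
- by move=> j _; rewrite mule_ge0 // lee_fin jump_weight_ge0.
by apply: eq_esum => j _; rewrite ge0_muleDr.
Qed.

Lemma jump_sum_cst i (k : R) : (0 <= k)%R -> jump_sum i (fun=> k%:E) = (k * rate q i)%:E.
Proof.
move=> k0; rewrite /jump_sum; under eq_esum do rewrite muleC.
rewrite esumZl //; last by move=> j; rewrite lee_fin jump_weight_ge0.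
rewrite EFinM (intensity_conservative hq) [in RHS]esum_mkcond; congr (_ * _).
by apply: eq_esum => j _; rewrite /jump_weight mem_other; case: ifP.
Qed.

Lemma signed_esumE i (W : S -> \bar R) :
  signed_esum [set j | j != i] (fun j => (q i j)%:E * W j) =
  jump_sum i (fun j => epos (W j)) - jump_sum i (fun j => eneg (W j)).
Proof.
rewrite /signed_esum /jump_sum; congr (_ - _); rewrite esum_mkcond; apply: eq_esum => j _;
  rewrite /jump_weight mem_other; case: ifPn => ji; rewrite ?mul0e //;
  have q0 : (0 <= q i j)%R by apply: (intensity_ge0 hq); rewrite eq_sym.
- by rewrite funeposE -/(epos _) eposM.
- by rewrite funenegE -/(eneg _) enegM.
Qed.

(** The discounted value of collecting f at the next jump, for holding times
    in D: the holding time has density q_i e^(-q_i s) and the jump leads to j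
    with probability q_ij / q_i. *)
Definition jump_int (i : S) (f : R -> S -> \bar R) (t : R) (D : set R) : \bar R :=
  \int[mu]_(s in D) ((expR (- (rate q i * s)))%:E * jump_sum i (f (t + s)%R)).

Lemma measurable_jump_sum d (T : measurableType d) (f : T -> S -> \bar R) i :
  (forall j, measurable_fun [set: T] (f^~ j)) -> (forall x j, 0 <= f x j) ->
  measurable_fun [set: T] (fun x => jump_sum i (f x)).
Proof.
move=> mf f0; apply: (@measurable_esum _ _ _ _ _ _
  (fun j x => (jump_weight i j)%:E * f x j)).
  by move=> j; apply: measurable_funeM.
by move=> j x; rewrite mule_ge0 // lee_fin jump_weight_ge0.
Qed.

Lemma measurable_expR_rate i :
  measurable_fun [set: R] (fun s : R => (expR (- (rate q i * s)))%:E).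
Proof.
apply/measurable_EFinP; apply: measurableT_comp => //.
by apply: measurable_funN; exact: mulrl_measurable.
Qed.

Lemma measurable_addr (t : R) : measurable_fun [set: R] (fun s : R => t + s)%R.
Proof. exact: measurable_funD. Qed.

Section OneFunction.
Variables (i : S) (f : R -> S -> \bar R).
Hypotheses (mf : forall j, measurable_fun [set: R] (f^~ j)) (f0 : forall t j, 0 <= f t j).

Lemma jump_integrand_ge0 t s :
  0 <= (expR (- (rate q i * s)))%:E * jump_sum i (f (t + s)%R).
Proof. by rewrite mule_ge0 // ?lee_fin ?expR_ge0 // jump_sum_ge0. Qed.

Lemma measurable_jump_integrand t : measurable_fun [set: R]
  (fun s => (expR (- (rate q i * s)))%:E * jump_sum i (f (t + s)%R)).
Proof.
apply: emeasurable_funM; first exact: measurable_expR_rate.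
apply: (@measurable_jump_sum _ _ (fun s j => f (t + s)%R j)) => // j.
by apply: (measurableT_comp (mf j)); exact: measurable_addr.
Qed.

Lemma jump_int_ge0 t D : 0 <= jump_int i f t D.
Proof. by apply: integral_ge0 => s _; exact: jump_integrand_ge0. Qed.

Lemma subset_jump_int t (A B : set R) : measurable A -> measurable B ->
  A `<=` B -> jump_int i f t A <= jump_int i f t B.
Proof.
move=> mA mB AB; apply: ge0_subset_integral => //.
  by apply: measurable_funTS; exact: measurable_jump_integrand.
by move=> s _; exact: jump_integrand_ge0.
Qed.

Lemma jump_int_setU t (A B : set R) : measurable A -> measurable B ->
  [disjoint A & B] -> jump_int i f t (A `|` B) = jump_int i f t A + jump_int i f t B.
Proof.
move=> mA mB AB; apply: ge0_integral_setU => //.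
  by apply: measurable_funTS; exact: measurable_jump_integrand.
by move=> s _; exact: jump_integrand_ge0.
Qed.

(** Memorylessness of the holding time. *)
Lemma jump_int_translate t (a : R) (D : set R) : measurable D ->
  jump_int i f t D =
  (expR (- (rate q i * a)))%:E * jump_int i f (t + a)%R [set s | D (s + a)%R].
Proof.
move=> mD; rewrite /jump_int (@ge0_integral_translation _ a) //; last 2 first.
- exact: measurable_jump_integrand.
- by move=> s; exact: jump_integrand_ge0.
have mDa : measurable [set s : R | D (s + a)%R].
  by rewrite -[X in measurable X]setTI; exact: (@measurable_translation _ a).
rewrite -ge0_integralZl //; last 2 first.
- by apply: measurable_funTS; exact: measurable_jump_integrand.
- by move=> s _; exact: jump_integrand_ge0.
apply: eq_integral => s _; rewrite muleA -EFinM -expRD.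
by congr ((expR _)%:E * jump_sum _ (f _)); lra.
Qed.

(** The holding times during which a waiting time x, possibly infinite, is not
    yet over. *)
Definition upto (x : \bar R) : set R := [set s | (0 <= s)%R /\ s%:E <= x].

Lemma upto_fin (r : R) : upto r%:E = `[0%R, r]%classic.
Proof.
by apply/seteqP; split=> s /=; rewrite /upto /= in_itv /= lee_fin; [move=> [-> ->]|move=> /andP].
Qed.

Lemma upto_oo : upto +oo = `[0%R, +oo[%classic.
Proof.
apply/seteqP; split=> s /=; rewrite /upto /= in_itv /= andbT; first by case.
by move=> s0; rewrite leey.
Qed.

Lemma measurable_upto x : measurable (upto x).
Proof.
case: x => [r| |]; rewrite ?upto_fin ?upto_oo //.
by rewrite (_ : upto -oo = set0) //; apply/seteqP; split=> s //= [].
Qed.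

(** Tonelli, applied to the indicator of the pairs (t, s) with 0 <= s <= h
    t. *)
Lemma measurable_jump_int (h : R -> \bar R) : measurable_fun [set: R] h ->
  measurable_fun [set: R] (fun t => jump_int i f t (upto (h t))).
Proof.
move=> mh.
pose A := [set p : R * R | upto (h p.1) p.2].
have mA : measurable A.
  have -> : A = ([set p | (0 <= p.2)%R] `&` [set p : R * R | p.2%:E <= h p.1]).
    by apply/seteqP; split=> p.
  apply: measurableI.
    rewrite (_ : [set _ | _] = snd @^-1` `[0%R, +oo[%classic); last first.
      by apply/seteqP; split=> p /=; rewrite in_itv /= andbT.
    by rewrite -[X in measurable X]setTI; exact: measurable_snd.
  apply: measurable_lee_fun.
    by apply/measurable_EFinP; exact: measurable_snd.
  by apply: measurableT_comp => //; exact: measurable_fst.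
pose F (p : R * R) : \bar R :=
  (\1_A p)%:E * ((expR (- (rate q i * p.2)))%:E * jump_sum i (f (p.1 + p.2)%R)).
have F0 p : 0 <= F p.
  by rewrite mule_ge0 ?lee_fin // jump_integrand_ge0.
have mF : measurable_fun [set: R * R] F.
  apply: emeasurable_funM.
    by apply/measurable_EFinP; exact: measurable_indic.
  apply: emeasurable_funM.
    exact: (measurableT_comp (measurable_expR_rate i) measurable_snd).
  apply: (@measurable_jump_sum _ _ (fun (p : R * R) j => f (p.1 + p.2)%R j)) => // j.
  apply: (measurableT_comp (mf j)).
  by apply: measurable_funD; [exact: measurable_fst|exact: measurable_snd].
have := @measurable_fun_fubini_tonelli_F _ _ _ _ R mu F mF F0.
apply: eq_measurable_fun => t _; rewrite /fubini_F /jump_int.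
rewrite [RHS]integral_mkcond; apply: eq_integral => s _.
rewrite /F indicE patchE.
case: ifPn => h1; last by rewrite (_ : (t, s) \in A = false) ?mul0e //; apply/negbTE.
by rewrite (_ : (t, s) \in A) ?mul1e.
Qed.

End OneFunction.

Lemma le_jump_int i (f g : R -> S -> \bar R) (t : R) (D : set R) : measurable D ->
  (forall j, measurable_fun [set: R] (f^~ j)) ->
  (forall j, measurable_fun [set: R] (g^~ j)) ->
  (forall t j, 0 <= f t j) ->
  (forall s j, D s -> f (t + s)%R j <= g (t + s)%R j) ->
  (forall t j, 0 <= g t j) ->
  jump_int i f t D <= jump_int i g t D.
Proof.
move=> mD mf mg f0 fg g0; apply: ge0_le_integral => //.
- by move=> s _; exact: jump_integrand_ge0.
- by apply: measurable_funTS; exact: measurable_jump_integrand.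
- by apply: measurable_funTS; exact: measurable_jump_integrand.
- move=> s Ds; apply: lee_wpmul2l; first by rewrite lee_fin expR_ge0.
  by apply: le_jump_sum => j; exact: fg.
Qed.

Lemma jump_intD i (f g : R -> S -> \bar R) (t : R) (D : set R) : measurable D ->
  (forall j, measurable_fun [set: R] (f^~ j)) ->
  (forall j, measurable_fun [set: R] (g^~ j)) ->
  (forall t j, 0 <= f t j) -> (forall t j, 0 <= g t j) ->
  jump_int i (fun t j => f t j + g t j) t D = jump_int i f t D + jump_int i g t D.
Proof.
move=> mD mf mg f0 g0; rewrite /jump_int -ge0_integralD //; last 4 first.
- by move=> s _; exact: jump_integrand_ge0.
- by apply: measurable_funTS; exact: measurable_jump_integrand.
- by move=> s _; exact: jump_integrand_ge0.
- by apply: measurable_funTS; exact: measurable_jump_integrand.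
by apply: eq_integral => s _; rewrite jump_sumD // ge0_muleDr ?jump_sum_ge0.
Qed.

Lemma jump_int_cst i (k : R) t : (0 <= k)%R ->
  jump_int i (fun _ _ => k%:E) t `[0%R, +oo[%classic = k%:E.
Proof.
move=> k0; rewrite /jump_int.
under eq_integral do rewrite jump_sum_cst // -EFinM mulrC -mulrA EFinM.
rewrite ge0_integralZl //; last 2 first.
- apply: measurable_funTS; apply/measurable_EFinP; apply: measurable_funM => //.
  by apply/measurable_EFinP; exact: measurable_expR_rate.
- by move=> s _; rewrite lee_fin mulr_ge0 ?expR_ge0 // ltW.
by rewrite integral_exp_tail // mulr0 oppr0 expR0 mule1.
Qed.

End JumpOperator.

(** * Utility functions *)

Section MonotoneMeasurable.
Local Open Scope ereal_scope.
Context {R : realType}.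

Lemma nondecreasing_emeasurable (f : R -> \bar R) :
  (forall x y, (x <= y)%R -> f x <= f y) -> measurable_fun [set: R] f.
Proof.
move=> fnd.
apply: (measurability (@ErealGenCInfty.G R)) => [|/= _ [_] [r] -> <-].
  exact: ErealGenCInfty.measurableE.
apply: measurableI => //; apply: is_interval_measurable => s t /=.
rewrite !in_itv /= !andbT => fs ft v /andP[sv vt].
by rewrite in_itv /= andbT (le_trans fs) // fnd.
Qed.

Lemma nonincreasing_emeasurable (f : R -> \bar R) :
  (forall x y, (x <= y)%R -> f y <= f x) -> measurable_fun [set: R] f.
Proof.
move=> fni; rewrite (_ : f = (fun x => - (- f x))); last first.
  by apply/funext => x; rewrite oppeK.
apply: measurableT_comp => //; apply: nondecreasing_emeasurable => x y xy.
by rewrite leeN2 fni.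
Qed.

End MonotoneMeasurable.

Section Utility.
Context {R : realType} {S : countType} (g : S -> R) (dom : set R) (u : R -> R).
Hypothesis hu : is_utility g dom u.
Local Notation U := (utility dom u).

Lemma dom_up x y : dom x -> x <= y -> dom y.
Proof.
case: (utility_domain hu) => [->//|[[d [-> _ _]]|[d [-> _ _ _]]]].
  by rewrite /= !in_itv /= !andbT; exact: le_trans.
by rewrite /= !in_itv /= !andbT; exact: lt_le_trans.
Qed.

Lemma dom_pair : exists x y, [/\ dom x, dom y & x < y].
Proof.
case: (utility_domain hu) => [->//|[[d [-> _ _]]|[d [-> _ _ _]]]].
- by exists 0, 1.
- by exists d, (d + 1); split; rewrite /= ?in_itv /= ?andbT; lra.
- by exists (d + 1), (d + 2); split; rewrite /= ?in_itv /= ?andbT; lra.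
Qed.

Lemma utility_in x : dom x -> U x = (u x)%:E.
Proof. by move=> dx; rewrite /utility asboolT. Qed.

Lemma utility_out x : ~ dom x -> U x = -oo%E.
Proof. by move=> dx; rewrite /utility asboolF. Qed.

Lemma utility_lty x : (U x < +oo)%E.
Proof. by rewrite /utility; case: ifP => _; rewrite ?ltry // ltNye. Qed.

Lemma u_nondecreasing x y : dom x -> dom y -> x <= y -> u x <= u y.
Proof.
move=> dx dy; rewrite le_eqVlt => /orP[/eqP-> //|xy].
by apply: ltW; exact: (utility_increasing hu).
Qed.

Lemma utility_nondecreasing x y : x <= y -> (U x <= U y)%E.
Proof.
move=> xy; have [dx|dx] := pselect (dom x); last by rewrite utility_out // leNye.
have dy := dom_up dx xy.
by rewrite !utility_in // lee_fin u_nondecreasing.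
Qed.

(** Concavity in the form of decreasing slopes, multiplied out so as to
    contain no quotient. *)
Lemma chord_slopes x y z : dom x -> x < y -> y < z ->
  (u z - u y) * (y - x) <= (z - y) * (u y - u x).
Proof.
move=> dx xy yz.
have dy := dom_up dx (ltW xy); have dz := dom_up dy (ltW yz).
pose a := (z - y) / (z - x).
have zx : 0 < z - x by lra.
have aE : a * (z - x) = z - y by rewrite /a divfK // gt_eqF.
have a01 : 0 < a < 1.
  by rewrite /a divr_gt0 ?subr_gt0 //= ?(lt_trans xy) // ltr_pdivrMr //; lra.
have yE : a * x + (1 - a) * z = y by move: aE; lra.
have xz : x != z by rewrite lt_eqF // (lt_trans xy).
have := utility_concave hu dx dz xz a01; rewrite yE => h.
have : (a * u x + (1 - a) * u z) * (z - x) <= u y * (z - x).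
  by rewrite ler_pM2r // ltW.
have -> : (a * u x + (1 - a) * u z) * (z - x) =
  (a * (z - x)) * u x + ((z - x) - a * (z - x)) * u z by lra.
by rewrite aE; lra.
Qed.

(** The line through two points of the graph bounds a concave function outside
    of the interval between them; raised by the height of the chord, it also
    bounds u in between, and its slope b is positive, because u increases. *)
Lemma utility_affine : exists A b : R, 0 < b /\ forall x, (U x <= (A + b * x)%:E)%E.
Proof.
have [x0 [x1 [d0 d1 x01]]] := dom_pair.
have h : 0 < x1 - x0 by rewrite subr_gt0.
pose b := (u x1 - u x0) / (x1 - x0).
have bE : b * (x1 - x0) = u x1 - u x0 by rewrite /b divfK // gt_eqF.
have b0 : 0 < b by rewrite divr_gt0 // subr_gt0 (utility_increasing hu).
exists (u x1 - b * x0), b; split => // x.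
have [dx|dx] := pselect (dom x); last by rewrite utility_out // leNye.
rewrite utility_in // lee_fin.
have [xx0|x0x] := ltP x x0.
  have := chord_slopes dx xx0 x01; rewrite -bE.
  rewrite (_ : b * (x1 - x0) * (x0 - x) = (x1 - x0) * (b * (x0 - x))); last by lra.
  rewrite ler_pM2l // => h2.
  have := utility_increasing hu d0 d1 x01; lra.
have [xx1|x1x] := leP x x1.
  have h2 := u_nondecreasing dx d1 xx1.
  have : 0 <= b * (x - x0) by rewrite mulr_ge0 ?subr_ge0 // ltW.
  lra.
have := chord_slopes d0 x01 x1x; rewrite -bE mulrA ler_pM2r // => h2.
have : 0 <= b * (x1 - x0) by rewrite mulr_ge0 // ltW.
lra.
Qed.

(** Below the domain U is -oo. Where the domain extends to the left of x, the
    chord from there bounds the growth to the right of x. What remains is the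
    left end of the domain, where u is continuous or tends to -oo. *)
Lemma utility_right_usc (x : R) (y : \bar R) : (U x < y)%E ->
  exists2 e, 0 < e & forall z, z < x + e -> (U z < y)%E.
Proof.
move=> Uxy.
suff [e e0 he] : exists2 e, 0 < e & forall z, x < z -> z < x + e -> (U z < y)%E.
  exists e => // z ze; have [zx|xz] := leP z x; last exact: he.
  by apply: le_lt_trans Uxy; exact: utility_nondecreasing.
case: y Uxy => [y| |] Uxy; last 2 first.
- by exists 1 => // z _ _; exact: utility_lty.
- by move: Uxy; rewrite ltNge leNye.
have [dx|ndx] := pselect (dom x); last first.
  have Uout e : (forall z, x < z -> z < x + e -> ~ dom z) ->
      forall z, x < z -> z < x + e -> (U z < y%:E)%E.
    by move=> h z xz ze; rewrite utility_out ?ltNyr //; exact: h.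
  case: (utility_domain hu) => [dE|[[d [dE _ _]]|[d [dE _ _ dlim]]]].
  - by exfalso; apply: ndx; rewrite dE.
  - rewrite dE /= in_itv /= andbT in ndx; move/negP: ndx; rewrite -ltNge => xd.
    exists (d - x); first lra.
    by apply: (Uout (d - x)) => z _ zd; rewrite dE /= in_itv /= andbT leNgt => /negP; apply; lra.
  - rewrite dE /= in_itv /= andbT in ndx; move/negP: ndx; rewrite -leNgt => xd.
    have [xd'|dx'] := ltP x d.
      exists (d - x); first lra.
      by apply: (Uout (d - x)) => z _ zd; rewrite dE /= in_itv /= andbT ltNge => /negP; apply; lra.
    have {dx'}{}xd : x = d by apply/eqP; rewrite eq_le xd.
    move/cvgrNyPltr : dlim => /(_ y (num_real _)).
    rewrite /at_right => -[e /= e0 he]; exists e => // z xz ze.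
    have dz : dom z by rewrite dE /= in_itv /= andbT -xd.
    rewrite utility_in // lte_fin; apply: he; last by rewrite -xd.
    by rewrite /ball_ /= -xd ltr_norml; lra.
rewrite utility_in // lte_fin in Uxy.
have [[x' dx' xx']|nx'] := pselect (exists2 x', dom x' & x' < x).
  pose K := (u x - u x') / (x - x').
  have h : 0 < x - x' by rewrite subr_gt0.
  have KE : K * (x - x') = u x - u x' by rewrite /K divfK // gt_eqF.
  have K0 : 0 < K by rewrite divr_gt0 // subr_gt0 (utility_increasing hu).
  exists ((y - u x) / K); first by rewrite divr_gt0 // subr_gt0.
  move=> z xz ze; rewrite utility_in; last exact: dom_up dx (ltW xz).
  rewrite lte_fin.
  have := chord_slopes dx' xx' xz; rewrite -KE mulrA ler_pM2r // => h2.
  have : (z - x) * K < y - u x by rewrite -ltr_pdivlMr //; lra.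
  lra.
case: (utility_domain hu) => [dE|[[d [dE _ uc]]|[d [dE _ _ dlim]]]].
- by exfalso; apply: nx'; exists (x - 1); rewrite ?dE //; lra.
- have xd : x = d.
    move: dx; rewrite dE /= in_itv /= andbT => dx; apply/eqP; rewrite eq_le dx andbT.
    rewrite leNgt; apply/negP => dx'; apply: nx'; exists d => //.
    by rewrite dE /= in_itv /= lexx.
  rewrite dE in uc; move: uc => /continuous_within_itvcyP [_ ud].
  rewrite xd in Uxy *.
  have /cvgrPdist_lt /(_ (y - u d)) := ud; rewrite subr_gt0 => /(_ Uxy).
  rewrite near_withinE => -[e /= e0 he]; exists e => // z xz ze.
  have dz : dom z by rewrite dE /= in_itv /= andbT ltW.
  rewrite utility_in // lte_fin.
  have : `|u d - u z| < y - u d.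
    by apply: he => //; rewrite /ball_ /= ltr_norml; lra.
  by rewrite ltr_norml => /andP[]; lra.
- exfalso; apply: nx'; move: dx; rewrite dE /= in_itv /= andbT => dx.
  by exists ((x + d) / 2); rewrite /= ?in_itv /= ?andbT; lra.
Qed.

End Utility.

(** * Upper semicontinuity *)

Section UscAttained.
Local Open Scope ereal_scope.
Context {R : realType}.

Lemma lte_between (x y : \bar R) : x < y -> exists z : R, x < z%:E /\ z%:E < y.
Proof.
case: x => [x| |]; case: y => [y| |] // xy.
- by exists ((x + y) / 2)%R; rewrite !lte_fin in xy *; split; lra.
- by exists (x + 1)%R; rewrite lte_fin ltry; split => //; lra.
- by exists (y - 1)%R; rewrite lte_fin ltNyr; split => //; lra.
- by exists 0%R; rewrite ltry ltNyr.
Qed.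

Definition usc_at (A : set R) (f : R -> \bar R) (x : R) : Prop :=
  forall y, f x < y ->
  exists2 e : R, (0 < e)%R & forall z, A z -> (`|x - z| < e)%R -> f z < y.

(** The sets of points where f > y, for y below the supremum, generate a
    filter on the compact interval; at a cluster point of it f cannot be
    smaller than the supremum. *)
Lemma usc_max (a b : R) (f : R -> \bar R) : (a <= b)%R ->
  (forall x, (a <= x <= b)%R -> usc_at [set z | (a <= z <= b)%R] f x) ->
  exists2 p, (a <= p <= b)%R & forall z, (a <= z <= b)%R -> f z <= f p.
Proof.
move=> ab usc.
pose M := ereal_sup [set f z | z in [set z | (a <= z <= b)%R]].
have fM z : (a <= z <= b)%R -> f z <= M.
  by move=> zab; apply: ereal_sup_ubound; exists z.
have aab : (a <= a <= b)%R by rewrite lexx.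
suff [p pab Mp] : exists2 p, (a <= p <= b)%R & M <= f p.
  by exists p => // z zab; apply: le_trans Mp; exact: fM.
have [MN|MN] := eqVneq M -oo; first by exists a => //; rewrite MN leNye.
pose F : set (set R) := [set A | exists2 y, y < M &
  [set z | (a <= z <= b)%R /\ y < f z] `<=` A].
have FF : ProperFilter F.
  split; last first.
    split.
    - by exists -oo; rewrite ?ltNye.
    - move=> A B [y yM yA] [z zM zB]; exists (maxe y z); first by rewrite gt_max yM.
      by move=> x [xab]; rewrite gt_max => /andP[yf zf]; split; [apply: yA|apply: zB].
    - by move=> A B AB [y yM yA]; exists y => //; exact: subset_trans AB.
  move=> [y yM ysub]; have [_ [z /= zab <-] yz] := ereal_sup_gt yM.
  by apply: (ysub z).
have Fab : F `[a, b]%classic.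
  exists -oo; first by rewrite ltNye.
  by move=> z [zab _]; rewrite /= in_itv.
have [p [/= pab pcl]] := @segment_compact R a b F FF Fab.
rewrite in_itv /= in pab.
exists p => //; rewrite leNgt; apply/negP => fpM.
have [y [fy yM]] := lte_between fpM.
have [e e0 he] := usc _ pab _ fy.
have [z [[zab yz] zp]] : [set z | (a <= z <= b)%R /\ y%:E < f z] `&` ball p e !=set0.
  by apply: pcl; [exists y%:E|exact: nbhsx_ballx].
by have := he z zab zp; rewrite ltNge (ltW yz).
Qed.

End UscAttained.

Section UscIntegral.
Local Open Scope ereal_scope.
Context {R : realType}.
Local Notation mu := (@lebesgue_measure R).
Variable phi : R -> \bar R.
Hypothesis mphi : measurable_fun [set: R] phi.
Hypothesis phi0 : forall s, 0 <= phi s.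

Lemma integral_bigcup_lt (F : (set R)^nat) (y : \bar R) :
  (forall n, measurable (F n)) -> nondecreasing_seq F ->
  y < \int[mu]_(s in \bigcup_n F n) phi s -> exists n, y < \int[mu]_(s in F n) phi s.
Proof.
move=> mF ndF yF; apply: contrapT => nex.
have cv : \int[mu]_(s in F i) phi s @[i --> \oo] --> \int[mu]_(s in \bigcup_i F i) phi s.
  by apply: ge0_nondecreasing_set_cvg_integral => // n; exact: measurable_funTS.
have : \int[mu]_(s in \bigcup_n F n) phi s <= y.
  rewrite -(cvg_lim _ cv) //; apply: lime_le; first by apply/cvg_ex; eexists; exact: cv.
  apply: nearW => n; rewrite leNgt; apply/negP => yn.
  by apply: nex; exists n.
by rewrite leNgt yF.
Qed.

Lemma integral_0y_lt (y : \bar R) :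
  y < \int[mu]_(s in `[0%R, +oo[%classic) phi s ->
  exists2 b : R, (0 <= b)%R &
    forall c, (b <= c)%R -> y < \int[mu]_(s in `[0%R, c]%classic) phi s.
Proof.
rewrite itv0y_bigcup0S => /integral_bigcup_lt [].
- by [].
- move=> m n mn; apply/subsetPset; apply: subset_itvl.
  by rewrite bnd_simp ler_nat.
- move=> n yn; exists n.+1%:R => // c nc.
  apply: (lt_le_trans yn); apply: ge0_subset_integral => //.
  + exact: measurable_funTS.
  + by apply: subset_itvl; rewrite bnd_simp.
Qed.

(** Exhaustion of [0, b[ from the left by compact intervals; the integral may
    be infinite at b. *)
Lemma integral_left_lt (b : R) (y : \bar R) :
  y < \int[mu]_(s in `[0%R, b]%classic) phi s ->
  exists2 e : R, (0 < e)%R &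
    forall c, (b - e < c)%R -> y < \int[mu]_(s in `[0%R, c]%classic) phi s.
Proof.
rewrite -integral_itv_bndo_bndc; last exact: measurable_funTS.
rewrite (_ : `[0%R, b[%classic = \bigcup_n `[0%R, (b - n.+1%:R^-1)%R]%classic); last first.
  apply/seteqP; split=> s /=.
    rewrite in_itv /= => /andP[s0 sb].
    have bs : (0 < b - s)%R by rewrite subr_gt0.
    exists (Num.truncn (b - s)^-1) => //=; rewrite in_itv /= s0 /=.
    rewrite lerBrDr -lerBrDl -[leRHS]invrK lef_pV2 ?posrE ?invr_gt0 //.
    by rewrite ltW // truncnS_gt.
  move=> [n _] /=; rewrite !in_itv /= => /andP[-> h] /=; apply: (le_lt_trans h).
  by rewrite ltrBlDr ltrDl invr_gt0.
move=> /integral_bigcup_lt [].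
- by [].
- move=> m n mn; apply/subsetPset; apply: subset_itvl.
  by rewrite bnd_simp lerB // lef_pV2 ?posrE // ler_nat.
- move=> n yn; exists (n.+1%:R^-1 : R)%R; first by rewrite invr_gt0.
  move=> c nc; apply: (lt_le_trans yn); apply: ge0_subset_integral => //.
  + exact: measurable_funTS.
  + by apply: subset_itvl; rewrite bnd_simp ltW.
Qed.

(** Exhaustion of ]b, b + 1] from the right; finiteness up to b + 1 excludes a
    jump of the integral to infinity just after b. *)
Lemma integral_right_lt (b : R) (y : \bar R) : (0 <= b)%R ->
  \int[mu]_(s in `[0%R, (b + 1)%R]%classic) phi s < +oo ->
  \int[mu]_(s in `[0%R, b]%classic) phi s < y ->
  exists2 e : R, (0 < e)%R &
    forall c, (c < b + e)%R -> \int[mu]_(s in `[0%R, c]%classic) phi s < y.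
Proof.
move=> b0 fin yb.
pose I (c : R) := \int[mu]_(s in `[0%R, c]%classic) phi s.
pose K (c : R) := \int[mu]_(s in `]c, (b + 1)%R]%classic) phi s.
have I0 c : 0 <= I c by apply: integral_ge0.
have K0 c : 0 <= K c by apply: integral_ge0.
have IK c : (b <= c <= b + 1)%R -> I (b + 1)%R = I c + K c.
  move=> /andP[bc cb]; rewrite /I /K.
  rewrite (_ : `[0%R, (b + 1)%R]%classic = `[0%R, c]%classic `|` `]c, (b + 1)%R]%classic);
    last first.
    apply/seteqP; split=> s /=; rewrite !in_itv /=.
      by move=> /andP[s0 sb]; case: (leP s c) => sc; [left|right]; rewrite ?s0 ?sb.
    move=> [/andP[s0 sc]|/andP[cs sb]]; apply/andP; split => //; lra.
  rewrite ge0_integral_setU //.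
  - exact: measurable_funTS.
  - by apply/disj_setPS => s [] /=; rewrite !in_itv /= => /andP[_ h] /andP[h2 _]; lra.
have [yy|yy] := eqVneq y +oo.
  exists 1%R => // c c1; rewrite yy; apply: le_lt_trans fin.
  apply: ge0_subset_integral => //; first exact: measurable_funTS.
  by apply: subset_itvl; rewrite bnd_simp ltW.
have yfin : y \is a fin_num.
  rewrite fin_numE yy andbT; apply/eqP => yN.
  by move: yb; rewrite yN ltNge leNye.
have Ifin c : (c <= b + 1)%R -> I c \is a fin_num.
  move=> cb; rewrite ge0_fin_numE //; apply: le_lt_trans fin.
  apply: ge0_subset_integral => //; first exact: measurable_funTS.
  by apply: subset_itvl; rewrite bnd_simp.
have bb : (b <= b + 1)%R by lra.
have Kfin c : (b <= c <= b + 1)%R -> K c \is a fin_num.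
  move=> h; rewrite ge0_fin_numE //; apply: le_lt_trans fin.
  rewrite -/(I (b + 1)%R) (IK _ h); exact: leeDr.
have : I (b + 1)%R - y < K b.
  rewrite (IK b) ?lexx //= lteBlDr // addeC lteD2lE //.
  by apply: Kfin; rewrite lexx.
rewrite /K (_ : `]b, (b + 1)%R]%classic =
    \bigcup_n `](b + n.+1%:R^-1)%R, (b + 1)%R]%classic); last first.
  apply/seteqP; split=> s /=.
    rewrite in_itv /= => /andP[s0 sb].
    have bs : (0 < s - b)%R by rewrite subr_gt0.
    exists (Num.truncn (s - b)^-1) => //=; rewrite in_itv /= sb andbT.
    rewrite -ltrBrDl -[ltRHS]invrK ltf_pV2 ?posrE ?invr_gt0 //.
    by rewrite truncnS_gt.
  move=> [n _] /=; rewrite !in_itv /= => /andP[h ->]; rewrite andbT.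
  by apply: le_lt_trans h; rewrite lerDl invr_ge0.
move=> /integral_bigcup_lt [].
- by [].
- move=> m n mn; apply/subsetPset; apply: subset_itvr.
  by rewrite bnd_simp lerD2l lef_pV2 ?posrE // ler_nat.
- move=> n yn; exists (n.+1%:R^-1 : R)%R; first by rewrite invr_gt0.
  move=> c nc.
  have hn : (b <= b + n.+1%:R^-1 <= b + 1)%R.
    by rewrite lerDl invr_ge0 ler0n lerD2l /= invf_le1 ?ltr0n // ler1n.
  apply: (@le_lt_trans _ _ (I (b + n.+1%:R^-1)%R)).
    apply: ge0_subset_integral => //; first exact: measurable_funTS.
    by apply: subset_itvl; rewrite bnd_simp ltW.
  move: yn; rewrite -/(K _) (IK _ hn) lteBlDr // addeC lteD2lE //.
  exact: Kfin.
Qed.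

End UscIntegral.

(** * The Bellman operator and its first maximizer *)

Section Bellman.
Local Open Scope ereal_scope.
Context {R : realType} {S : countType} (q : S -> S -> R) (g : S -> R) (c : R)
  (dom : set R) (u : R -> R).
Hypotheses (hq : intensity_matrix q) (hc : (0 < c)%R) (hu : is_utility g dom u).
Local Notation mu := (@lebesgue_measure R).

Definition stop_value (t : R) (i : S) : \bar R := utility dom u (g i - c * t)%R.

Lemma stop_value_lty t i : stop_value t i < +oo.
Proof. exact: utility_lty. Qed.

Lemma stop_value_nonincreasing i x y : (x <= y)%R -> stop_value y i <= stop_value x i.
Proof.
by move=> xy; apply: (utility_nondecreasing hu); rewrite lerB // ler_wpM2l // ltW.
Qed.

Lemma measurable_stop_value i : measurable_fun [set: R] (stop_value ^~ i).
Proof. by apply: nonincreasing_emeasurable => x y; exact: stop_value_nonincreasing. Qed.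

Definition pos_part (W : R -> S -> \bar R) (t : R) (j : S) := epos (W t j).
Definition neg_part (W : R -> S -> \bar R) (t : R) (j : S) := eneg (W t j).

Lemma discount_gt0 i (s : R) : 0 < (expR (- (rate q i * s)))%:E.
Proof. by rewrite lte_fin expR_gt0. Qed.

(** When the positive parts are integrable, the signed sum and the signed
    integral both split. All later estimates are made on the two nonnegative
    integrals. *)
Lemma bellmanE W t i theta : (forall j, measurable_fun [set: R] (W^~ j)) ->
  jump_int q i (pos_part W) t `[0%R, theta]%classic < +oo ->
  bellman_rhs q g c dom u W t i theta =
  stop_value (t + theta)%R i * (expR (- (rate q i * theta)))%:E +
  (jump_int q i (pos_part W) t `[0%R, theta]%classic -
   jump_int q i (neg_part W) t `[0%R, theta]%classic).
Proof.
move=> mW fin; rewrite /bellman_rhs; congr (_ + _).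
have mp j : measurable_fun [set: R] (fun t => pos_part W t j) by exact: measurable_epos.
have mn j : measurable_fun [set: R] (fun t => neg_part W t j) by exact: measurable_eneg.
have p0 s j : 0 <= pos_part W s j by exact: epos_ge0.
have n0 s j : 0 <= neg_part W s j by exact: eneg_ge0.
rewrite /jump_int -integralB_ge0 //.
- apply: eq_integral => s _; rewrite (signed_esumE hq).
  set a := jump_sum _ _ _; set b := jump_sum _ _ _.
  have a0 : 0 <= a by apply: (jump_sum_ge0 hq) => j; exact: epos_ge0.
  have b0 : 0 <= b by apply: (jump_sum_ge0 hq) => j; exact: eneg_ge0.
  rewrite -/(jump_sum _ _ _) -/a -/b.
  have := discount_gt0 i s; move: a0 b0; rewrite lte_fin.
  case: a => [a| |] // a0; case: b => [b| |] // b0 e0.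
  + by rewrite muleBr.
  + by rewrite gt0_muley ?lte_fin //= mulrNy gtr0_sg // mul1e.
  + by rewrite /= gt0_muley ?lte_fin //= -EFinM addye.
  + by rewrite /= gt0_muley ?lte_fin //= mulrNy gtr0_sg // mul1e.
- by apply: measurable_funTS; exact: measurable_jump_integrand.
- by apply: measurable_funTS; exact: measurable_jump_integrand.
- by move=> s; exact: jump_integrand_ge0.
- by move=> s; exact: jump_integrand_ge0.
Qed.

Lemma mulNy_discount i s : -oo * (expR (- (rate q i * s)))%:E = -oo :> \bar R.
Proof. by rewrite gt0_mulNye // discount_gt0. Qed.

Lemma stop_term_lty t i x : stop_value (t + x)%R i * (expR (- (rate q i * x)))%:E < +oo.
Proof.
have := stop_value_lty (t + x)%R i; case: (stop_value _ _) => [r| |] // _.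
  by rewrite -EFinM ltry.
by rewrite mulNy_discount.
Qed.

(** After division by the discount factor only U (g i - c (t + z)) is left. It
    exceeds its value at x only for z < x, where the one-sided semicontinuity
    of U applies. *)
Lemma stop_term_usc t i (x : R) (y : \bar R) :
  stop_value (t + x)%R i * (expR (- (rate q i * x)))%:E < y ->
  exists2 e : R, (0 < e)%R & forall z, (`|x - z| < e)%R ->
    stop_value (t + z)%R i * (expR (- (rate q i * z)))%:E < y.
Proof.
have [->|yy] := eqVneq y +oo.
  by move=> _; exists 1%R => // z _; exact: stop_term_lty.
case: y yy => [y| |] // _; last by rewrite ltNge leNye.
have E z : (stop_value (t + z)%R i * (expR (- (rate q i * z)))%:E < y%:E) =
           (stop_value (t + z)%R i < (y * expR (rate q i * z))%:E).
  rewrite expRN -lte_pdivlMr ?invr_gt0 ?expR_gt0 // invrK.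
  by rewrite EFinM.
rewrite E => h; have [w [hw wy]] := lte_between h.
have [e1 e10 he1] := utility_right_usc hu hw.
have cexp : {for x, continuous (fun z : R => y * expR (rate q i * z))%R}.
  apply: cvgM; first exact: cvg_cst.
  apply: (@continuous_comp _ _ _ (fun z : R => rate q i * z)%R expR).
    exact: mulrl_continuous.
  exact: continuous_expR.
rewrite lte_fin in wy.
have /cvgrPdist_lt /(_ (y * expR (rate q i * x) - w)%R) := cexp.
rewrite subr_gt0 => /(_ wy) [e2 /= e20 he2].
exists (Num.min (e1 / c) e2)%R; first by rewrite lt_min divr_gt0.
move=> z; rewrite lt_min => /andP[xz1 xz2].
rewrite E; apply: (@lt_trans _ _ w%:E).
  apply: he1; rewrite ltr_pdivlMr // in xz1.
  have : ((x - z) * c <= `|x - z| * c)%R by rewrite ler_wpM2r ?ler_norm // ltW.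
  lra.
rewrite lte_fin; have := he2 z xz2; rewrite ltr_norml => /andP[_]; lra.
Qed.

Section Maximizer.
Variable W : R -> S -> \bar R.
Hypothesis Wni : forall j x y, (x <= y)%R -> W y j <= W x j.
Hypothesis Wfin : forall i (t theta : R), (0 <= theta)%R ->
  jump_int q i (pos_part W) t `[0%R, theta]%classic < +oo.

Local Notation B := (bellman_rhs q g c dom u W).
Local Notation Jp t i theta := (jump_int q i (pos_part W) t `[0%R, theta]%classic).
Local Notation Jn t i theta := (jump_int q i (neg_part W) t `[0%R, theta]%classic).

Let mW j : measurable_fun [set: R] (W^~ j).
Proof. by apply: nonincreasing_emeasurable => x y; exact: Wni. Qed.
Let mp j : measurable_fun [set: R] (fun t => pos_part W t j).
Proof. exact: measurable_epos. Qed.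
Let mn j : measurable_fun [set: R] (fun t => neg_part W t j).
Proof. exact: measurable_eneg. Qed.
Let p0 s j : 0 <= pos_part W s j. Proof. exact: epos_ge0. Qed.
Let n0 s j : 0 <= neg_part W s j. Proof. exact: eneg_ge0. Qed.

(** Shares out the strict room below y between three terms, each of which may
    be infinite on the side where this is harmless. *)
Lemma slack_split (a p n : \bar R) (y : R) : a < +oo -> 0 <= p -> p < +oo -> 0 <= n ->
  a + (p - n) < y%:E ->
  exists a' p' n' : R, [/\ a < a'%:E, p < p'%:E, n'%:E < n & (a' + (p' - n') <= y)%R].
Proof.
case: a => [a| |] //; case: p => [p| |] //; case: n => [n| |] // _ _ _ _.
- rewrite -EFinB -EFinD lte_fin => h; pose e := ((y - (a + (p - n))) / 3)%R.
  have e0 : (0 < e)%R by rewrite /e; lra.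
  exists (a + e)%R, (p + e)%R, (n - e)%R; rewrite !lte_fin; split; rewrite /e in e0 *; lra.
- move=> _; exists (a + 1)%R, (p + 1)%R, (a + 1 + (p + 1) - y)%R.
  by rewrite !lte_fin ltry; split => //; lra.
- move=> _; exists (y - (p + 1) + (n - 1))%R, (p + 1)%R, (n - 1)%R.
  by rewrite !lte_fin ltNyr; split => //; lra.
- move=> _; exists (y - (p + 1))%R, (p + 1)%R, 0%R.
  by rewrite !lte_fin ltNyr ltry; split => //; lra.
Qed.

Lemma bellman_lty t i theta : (0 <= theta)%R -> B t i theta < +oo.
Proof.
move=> th0; rewrite bellmanE //; last exact: Wfin.
have := stop_term_lty t i theta; have := Wfin i t th0.
have := jump_int_ge0 hq i p0 t `[0%R, theta]%classic.
have := jump_int_ge0 hq i n0 t `[0%R, theta]%classic.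
case: (Jp t i theta) => [a| |] //; case: (Jn t i theta) => [b| |] // _ _ _;
  by case: (_ * _) => [r _| |] //; rewrite -?EFinM -?EFinB -?EFinD ?ltry.
Qed.

(** The stop term and the integral of the positive part are controlled from
    above, the integral of the negative part from below. *)
Lemma bellman_usc t i theta : (0 <= theta)%R ->
  usc_at [set z | 0 <= z]%R (B t i) theta.
Proof.
move=> th0 y By.
have [->|yy] := eqVneq y +oo.
  by exists 1%R => // z z0 _; exact: bellman_lty.
case: y yy By => [y| |] // _; last by rewrite ltNge leNye.
have JpE z : (0 <= z)%R -> B t i z = stop_value (t + z)%R i * (expR (- (rate q i * z)))%:E +
  (Jp t i z - Jn t i z) by move=> z0; rewrite bellmanE //; exact: Wfin.
rewrite JpE // => /slack_split [].
- exact: stop_term_lty.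
- exact: jump_int_ge0.
- exact: Wfin.
- exact: jump_int_ge0.
move=> a [p [n [ha hp hn hy]]].
have [e1 e10 he1] := stop_term_usc ha.
have [e2 e20 he2] := integral_right_lt (measurable_jump_integrand hq i mp p0 t)
   (jump_integrand_ge0 hq i p0 t) th0 (Wfin i t (addr_ge0 th0 ler01)) hp.
have [e3 e30 he3] := integral_left_lt (measurable_jump_integrand hq i mn n0 t)
   (jump_integrand_ge0 hq i n0 t) hn.
exists (Num.min e1 (Num.min e2 e3))%R; first by rewrite !lt_min e10 e20.
move=> z /= z0; rewrite !lt_min => /and3P[z1 z2 z3].
rewrite JpE //; apply: (@lt_le_trans _ _ (a + (p - n))%:E); last by rewrite lee_fin.
have h1 := he1 z z1.
have h2 : Jp t i z < p%:E by apply: he2; move: z2; rewrite ltr_norml => /andP[]; lra.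
have h3 : n%:E < Jn t i z by apply: he3; move: z3; rewrite ltr_norml => /andP[]; lra.
rewrite EFinD; apply: lteD => //.
move: h2 h3; have := jump_int_ge0 hq i p0 t `[0%R, z]%classic.
case: (Jp t i z) => [x| |] // _; case: (Jn t i z) => [w| |] //; rewrite ?ltNyr //.
by rewrite -EFinB !lte_fin => h2 h3; lra.
Qed.

Definition bellman_sup (t : R) (i : S) : \bar R :=
  ereal_sup [set B t i theta | theta in [set theta : R | 0 <= theta]%R].

Lemma bellman_le_sup t i theta : (0 <= theta)%R -> B t i theta <= bellman_sup t i.
Proof. by move=> th0; apply: ereal_sup_ubound; exists theta. Qed.

Lemma bellman_max t i b : (0 <= b)%R ->
  exists2 p, (0 <= p <= b)%R & forall z, (0 <= z <= b)%R -> B t i z <= B t i p.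
Proof.
move=> b0; apply: usc_max => // x /andP[x0 xb] y /(bellman_usc x0) [e e0 he].
by exists e => // z /= /andP[z0 _]; exact: he.
Qed.

Definition maximizers (t : R) (i : S) : set R :=
  [set theta | (0 <= theta)%R /\ bellman_sup t i <= B t i theta].

(** Equal to +oo if the supremum is not attained. *)
Definition first_maximizer (t : R) (i : S) : \bar R :=
  ereal_inf [set theta%:E | theta in maximizers t i].

Lemma first_maximizer_ge0 t i : 0 <= first_maximizer t i.
Proof. by apply: le_ereal_inf_tmp => _ [th [th0 _] <-]; rewrite lee_fin. Qed.

(** Upper semicontinuity makes the set of maximizers closed. *)
Lemma first_maximizer_attained t i th : maximizers t i th ->
  exists2 r, first_maximizer t i = r%:E & maximizers t i r.
Proof.
move=> thm.
have : first_maximizer t i <= th%:E by apply: ereal_inf_lbound; exists th.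
have := first_maximizer_ge0 t i.
case E : (first_maximizer t i) => [r| |] //; rewrite !lee_fin => r0 rth.
exists r => //; split => //; rewrite leNgt; apply/negP => Br.
have [e e0 he] := bellman_usc r0 Br.
have : r%:E < (r + e)%:E by rewrite lte_fin; lra.
rewrite -E => /ereal_inf_lt [_ [z [z0 zm] <-]]; rewrite lte_fin => zre.
have : first_maximizer t i <= z%:E by apply: ereal_inf_lbound; exists z.
rewrite E lee_fin => rz.
have rz' : (`|r - z| < e)%R by rewrite ltr_norml; apply/andP; split; lra.
by have := he z z0 rz'; rewrite ltNge zm.
Qed.

(** On each bounded interval the maximum is attained, hence is smaller than
    the supremum; the supremum is therefore approached at infinity only. *)
Lemma bellman_limsup t i : maximizers t i = set0 ->
  bellman_sup t i = limf_esup (B t i) (pinfty_nbhs R).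
Proof.
move=> m0; apply/eqP; rewrite eq_le; apply/andP; split.
  apply: le_ereal_inf_tmp => _ [V [N [_ NV]] <-].
  have N0 : (0 <= Num.max N 0)%R by rewrite le_max lexx orbT.
  have [p /andP[pge0 _] pmax] := bellman_max t i N0.
  have Bp : B t i p < bellman_sup t i.
    rewrite ltNge; apply/negP => Bp.
    by have : maximizers t i p by []; rewrite m0.
  rewrite leNgt; apply/negP => hV.
  have : bellman_sup t i <= maxe (B t i p) (ereal_sup (B t i @` V)).
    apply: ge_ereal_sup => _ [z /= z0 <-]; rewrite le_max.
    case: (leP z (Num.max N 0)%R) => zN.
      by rewrite pmax ?z0.
    rewrite (_ : _ <= ereal_sup _) ?orbT //; apply: ereal_sup_ubound; exists z => //.
    by apply: NV; apply: le_lt_trans zN; rewrite le_max lexx.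
  by rewrite leNgt gt_max Bp hV.
apply: (@le_trans _ _ (ereal_sup (B t i @` [set z | 0 < z]%R))).
  apply: ereal_inf_lbound; exists [set z | 0 < z]%R => //.
  by exists 0%R; split.
by apply: ge_ereal_sup => _ [z /= z0 <-]; apply: bellman_le_sup; exact: ltW.
Qed.

Lemma bellman_ext_first_maximizer t i :
  bellman_sup t i = bellman_rhs_ext q g c dom u W t i (first_maximizer t i).
Proof.
have [[th thm]|nth] := pselect (exists th, maximizers t i th).
  have [r -> [r0 rm]] := first_maximizer_attained thm.
  by apply/eqP; rewrite eq_le rm bellman_le_sup.
have m0 : maximizers t i = set0.
  by apply/seteqP; split => // th thm; apply: nth; exists th.
rewrite /first_maximizer m0 image_set0 ereal_inf0 /=.
exact: bellman_limsup.
Qed.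

(** Dynamic programming over a deterministic time a: the chain jumps before a,
    or else, with probability e^(-q_i a), the problem starts again at date t +
    a. *)
Lemma bellman_shift t i a th : (0 <= a)%R -> (0 <= th)%R ->
  B t i (a + th)%R =
  (jump_int q i (pos_part W) t `[0%R, a[%classic -
   jump_int q i (neg_part W) t `[0%R, a[%classic) +
  (expR (- (rate q i * a)))%:E * B (t + a)%R i th.
Proof.
move=> a0 th0.
have split_int (f : R -> S -> \bar R) : (forall j, measurable_fun [set: R] (f^~ j)) ->
    (forall s j, 0 <= f s j) ->
    jump_int q i f t `[0%R, (a + th)%R]%classic = jump_int q i f t `[0%R, a[%classic +
    (expR (- (rate q i * a)))%:E * jump_int q i f (t + a)%R `[0%R, th]%classic.
  move=> mf f0.
  rewrite (_ : `[0%R, (a + th)%R]%classic = `[0%R, a[%classic `|` `[a, (a + th)%R]%classic);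
    last first.
    apply/seteqP; split=> s /=; rewrite !in_itv /=.
      by move=> /andP[s0 sb]; case: (ltP s a) => sc; [left|right]; rewrite ?s0 ?sb.
    move=> [/andP[s0 sc]|/andP[cs sb]]; apply/andP; split => //; lra.
  rewrite jump_int_setU //; last first.
    by apply/disj_setPS => s [] /=; rewrite !in_itv /= => /andP[_ h] /andP[h2 _]; lra.
  congr (_ + _); rewrite (jump_int_translate hq i mf f0 t a) //; congr (_ * jump_int _ _ _ _ _).
  by apply/seteqP; split=> s /=; rewrite !in_itv /= => /andP[h1 h2]; apply/andP; split; lra.
rewrite !bellmanE //; try exact: Wfin; last by apply: Wfin; rewrite addr_ge0.
rewrite !split_int // (_ : (t + (a + th) = t + a + th)%R); last lra.
have -> : (expR (- (rate q i * (a + th))) =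
   expR (- (rate q i * a)) * expR (- (rate q i * th)))%R by rewrite -expRD; congr expR; lra.
have e0 := expR_gt0 (- (rate q i * a)); have e1 := expR_gt0 (- (rate q i * th)).
move: (expR (- (rate q i * a))) (expR (- (rate q i * th))) e0 e1 => e e' e0 e'0.
have P1f : jump_int q i (pos_part W) t `[0%R, a[%classic < +oo.
  apply: le_lt_trans (Wfin i t a0); apply: subset_jump_int => //.
  by apply: subset_itvl; rewrite bnd_simp.
have P2f := Wfin i (t + a)%R th0.
have P10 := jump_int_ge0 hq i p0 t `[0%R, a[%classic.
have P20 := jump_int_ge0 hq i p0 (t + a)%R `[0%R, th]%classic.
have N10 := jump_int_ge0 hq i n0 t `[0%R, a[%classic.
have N20 := jump_int_ge0 hq i n0 (t + a)%R `[0%R, th]%classic.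
have U0 := stop_value_lty (t + a + th)%R i.
move: P1f P2f P10 P20 N10 N20 U0.
case: (jump_int q i (pos_part W) t _) => [P1| |] // _.
case: (jump_int q i (pos_part W) (t + a)%R _) => [P2| |] // _.
move=> _ _.
case: (jump_int q i (neg_part W) t _) => [N1| |] // _;
case: (jump_int q i (neg_part W) (t + a)%R _) => [N2| |] // _;
case: (stop_value (t + a + th)%R i) => [U0| |] // _;
rewrite ?(gt0_mulNye, gt0_muley, gt0_muleNy, addNye, addeNy, lte_fin, mulr_gt0) //=
  ?(gt0_mulNye, gt0_muley, gt0_muleNy, addNye, addeNy, lte_fin) //=.
rewrite -!EFinM -!EFinB -!EFinD; congr EFin; lra.
Qed.

(** If r is a maximizer at the later date t', waiting for t' - t + r from date
    t on is at least as good as waiting longer, by bellman_shift. So the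
    supremum at date t is attained, and by a stop that is not later. *)
Lemma stopping_date_nondecreasing i t t' : (t <= t')%R ->
  t%:E + first_maximizer t i <= t'%:E + first_maximizer t' i.
Proof.
move=> tt'.
have [[th thm]|nth] := pselect (exists th, maximizers t' i th); last first.
  rewrite (_ : first_maximizer t' i = +oo) ?addey ?leey // /first_maximizer.
  rewrite (_ : maximizers _ _ = set0) ?image_set0 ?ereal_inf0 //.
  by apply/seteqP; split => // th thm; apply: nth; exists th.
have [r -> [r0 rm]] := first_maximizer_attained thm.
pose a := (t' - t)%R; have a0 : (0 <= a)%R by rewrite subr_ge0.
have t'E : t' = (t + a)%R by rewrite /a; lra.
have [p /andP[p0' pr] pmax] := @bellman_max t i (a + r)%R (addr_ge0 a0 r0).
have pm : maximizers t i p.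
  split => //; apply: ge_ereal_sup => _ [z /= z0 <-].
  have [zr|rz] := leP z (a + r)%R; first by apply: pmax; rewrite z0.
  apply: (@le_trans _ _ (B t i (a + r)%R)); last by apply: pmax; rewrite lexx addr_ge0.
  have [w rw ->] : exists2 w : R, (r <= w)%R & z = (a + w)%R.
    by exists (z - a)%R; lra.
  have w0 : (0 <= w)%R by apply: le_trans rw.
  rewrite (bellman_shift t i a0 w0) (bellman_shift t i a0 r0).
  apply: leeD => //; apply: lee_wpmul2l; first by rewrite lee_fin expR_ge0.
  by rewrite -t'E; apply: le_trans rm; exact: bellman_le_sup.
apply: (@le_trans _ _ (t%:E + p%:E)).
  by apply: leeD => //; apply: ereal_inf_lbound; exists p.
by rewrite -!EFinD lee_fin t'E; lra.
Qed.

(** The waiting time need not be monotone in t, but the date at which it ends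
    is. *)
Lemma measurable_first_maximizer i : measurable_fun [set: R] (first_maximizer ^~ i).
Proof.
rewrite (_ : first_maximizer ^~ i =
    (fun t => (t%:E + first_maximizer t i) - t%:E)); last first.
  by apply/funext => t; rewrite [t%:E + _]addeC addeK.
apply: emeasurable_funB; last exact: EFin_measurable.
by apply: nondecreasing_emeasurable => x y; exact: stopping_date_nondecreasing.
Qed.

End Maximizer.
End Bellman.

(** * Value iteration and the option of never stopping *)

Section Iterates.
Local Open Scope ereal_scope.
Context {R : realType} {S : countType} (q : S -> S -> R) (g : S -> R) (c : R)
  (dom : set R) (u : R -> R).
Hypotheses (hq : intensity_matrix q) (hc : (0 < c)%R) (hu : is_utility g dom u).
Local Notation mu := (@lebesgue_measure R).
Local Notation U := (utility dom u).
Local Notation stop_value := (stop_value g c dom u).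
Local Notation bellman_rhs := (bellman_rhs q g c dom u).
Local Notation bellman_sup := (bellman_sup q g c dom u).
Local Notation jump_int := (jump_int q).

Lemma le_bellman_rhs (W W' : R -> S -> \bar R) t t' i theta :
  (forall j, measurable_fun [set: R] (W^~ j)) ->
  (forall j, measurable_fun [set: R] (W'^~ j)) ->
  (t <= t')%R ->
  (forall s j, (0 <= s)%R -> W' (t' + s)%R j <= W (t + s)%R j) ->
  bellman_rhs W' t' i theta <= bellman_rhs W t i theta.
Proof.
move=> mW mW' tt' le; rewrite /bellman_rhs; apply: leeD.
  rewrite lee_wpmul2r ?lee_fin ?expR_ge0 //.
  by apply: (stop_value_nonincreasing hc hu); rewrite lerD2r.
have meas (f : R -> S -> \bar R) r : (forall j, measurable_fun [set: R] (f^~ j)) ->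
  measurable_fun `[0%R, theta]%classic (fun s => (expR (- (rate q i * s)))%:E *
    signed_esum [set j | j != i] (fun j => (q i j)%:E * f (r + s)%R j)).
  move=> mf; apply: measurable_funTS; apply: emeasurable_funM.
    exact: measurable_expR_rate.
  under eq_fun do rewrite (signed_esumE hq).
  have mr j : measurable_fun [set: R] (fun s => f (r + s)%R j).
    exact: (measurableT_comp (mf j) (measurable_addr r)).
  apply: emeasurable_funB.
  - apply: (measurable_jump_sum hq (f := fun s j => epos (f (r + s)%R j))).
      by move=> j; exact: measurable_epos.
    by move=> *; exact: epos_ge0.
  - apply: (measurable_jump_sum hq (f := fun s j => eneg (f (r + s)%R j))).
      by move=> j; exact: measurable_eneg.
    by move=> *; exact: eneg_ge0.
apply: le_integral_parts => //; [exact: meas|exact: meas|] => s /=.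
rewrite in_itv /= => /andP[s0 _].
apply: lee_wpmul2l; first by rewrite lee_fin expR_ge0.
rewrite !(signed_esumE hq); apply: leeB; apply: (le_jump_sum hq) => j.
  by apply: le_epos; exact: le.
by apply: le_eneg; exact: le.
Qed.

(** Value iteration; n bounds the number of jumps before one has to stop. *)
Fixpoint iterate (n : nat) : R -> S -> \bar R :=
  if n is m.+1 then bellman_sup (iterate m) else stop_value.

Lemma bellman_sup_nonincreasing (W : R -> S -> \bar R) :
  (forall j x y, (x <= y)%R -> W y j <= W x j) ->
  forall j x y, (x <= y)%R -> bellman_sup W y j <= bellman_sup W x j.
Proof.
move=> Wni j x y xy; apply: ge_ereal_sup => _ [th th0 <-].
apply: (@le_trans _ _ (bellman_rhs W x j th)); last exact: bellman_le_sup.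
have mW k : measurable_fun [set: R] (W^~ k).
  by apply: nonincreasing_emeasurable => a b; exact: Wni.
by apply: le_bellman_rhs => // s k s0; apply: Wni; rewrite lerD2r.
Qed.

Lemma iterate_nonincreasing n j x y : (x <= y)%R -> iterate n y j <= iterate n x j.
Proof.
elim: n j x y => [|n IH] j x y xy; first exact: (stop_value_nonincreasing hc hu).
exact: bellman_sup_nonincreasing.
Qed.

Lemma measurable_iterate n j : measurable_fun [set: R] (iterate n ^~ j).
Proof. by apply: nonincreasing_emeasurable => x y; exact: iterate_nonincreasing. Qed.

Lemma bellman_rhs0 W t i : bellman_rhs W t i 0%R = stop_value t i.
Proof.
rewrite /bellman_rhs addr0 mulr0 oppr0 expR0 mule1 set_itv1 integral_set1 adde0.
by [].
Qed.

Lemma stop_le_bellman_sup W t i : stop_value t i <= bellman_sup W t i.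
Proof.
by rewrite -(bellman_rhs0 W); exact: bellman_le_sup.
Qed.

Lemma le_bellman_sup (W W' : R -> S -> \bar R) t i :
  (forall j, measurable_fun [set: R] (W^~ j)) ->
  (forall j, measurable_fun [set: R] (W'^~ j)) ->
  (forall s j, (0 <= s)%R -> W (t + s)%R j <= W' (t + s)%R j) ->
  bellman_sup W t i <= bellman_sup W' t i.
Proof.
move=> mW mW' le; apply: ge_ereal_sup => _ [th th0 <-].
apply: (@le_trans _ _ (bellman_rhs W' t i th)); last exact: bellman_le_sup.
exact: le_bellman_rhs.
Qed.

Lemma iterate_leS n t i : iterate n t i <= iterate n.+1 t i.
Proof.
elim: n t i => [|n IH] t i; first exact: stop_le_bellman_sup.
by apply: (@le_bellman_sup (iterate n) (iterate n.+1)) => [j|j|s j _];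
  [exact: measurable_iterate|exact: (measurable_iterate n.+1)|exact: IH].
Qed.

Lemma iterate_le m n t i : (m <= n)%N -> iterate m t i <= iterate n t i.
Proof.
move=> mn; rewrite -(subnKC mn); elim: (n - m)%N => [|k IH]; first by rewrite addn0.
by rewrite addnS; apply: le_trans IH _; exact: iterate_leS.
Qed.

(** The value of never stopping before the next jump. *)
Definition wait_value (W : R -> S -> \bar R) (t : R) (i : S) : \bar R :=
  jump_int i (pos_part W) t `[0%R, +oo[%classic -
  jump_int i (neg_part W) t `[0%R, +oo[%classic.

Section Waiting.
Variables (W : R -> S -> \bar R) (i : S).
Hypothesis Wni : forall j x y, (x <= y)%R -> W y j <= W x j.
Hypothesis Wfin : forall t, jump_int i (pos_part W) t `[0%R, +oo[%classic < +oo.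

Let mW j : measurable_fun [set: R] (W^~ j).
Proof. by apply: nonincreasing_emeasurable => x y; exact: Wni. Qed.
Let mp j : measurable_fun [set: R] (fun t => pos_part W t j).
Proof. exact: measurable_epos. Qed.
Let mn j : measurable_fun [set: R] (fun t => neg_part W t j).
Proof. exact: measurable_eneg. Qed.
Let p0 s j : 0 <= pos_part W s j. Proof. exact: epos_ge0. Qed.
Let n0 s j : 0 <= neg_part W s j. Proof. exact: eneg_ge0. Qed.

Lemma jump_int_le_horizon f t (b : R) : (forall j, measurable_fun [set: R] (f^~ j)) ->
  (forall s j, 0 <= f s j) ->
  jump_int i f t `[0%R, b]%classic <= jump_int i f t `[0%R, +oo[%classic.
Proof.
by move=> mf f0; apply: subset_jump_int => //; apply: subset_itvl; rewrite bnd_simp.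
Qed.

Lemma jump_int_pos_horizon t (b : R) : jump_int i (pos_part W) t `[0%R, b]%classic < +oo.
Proof. by apply: le_lt_trans (Wfin t); exact: jump_int_le_horizon. Qed.

(** The positive part of the stop term is at most a constant times e^(-q_i
    theta), which vanishes at infinity. *)
Lemma limsup_le_wait t :
  limf_esup (bellman_rhs W t i) (pinfty_nbhs R) <= wait_value W t i.
Proof.
rewrite leNgt; apply/negP => /lte_between [y [Ly yL]].
have {Ly} : 0 + wait_value W t i < y%:E by rewrite add0e.
move=> /slack_split [] //; [exact: jump_int_ge0|exact: jump_int_ge0|].
move=> a [p [n [a0 hp hn hy]]]; rewrite lte_fin in a0.
have [b b0 hb] := integral_0y_lt (measurable_jump_integrand hq i mn n0 t)
   (jump_integrand_ge0 hq i n0 t) hn.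
pose C := fine (epos (stop_value t i)).
have CE : epos (stop_value t i) = C%:E.
  rewrite /C fineK // ge0_fin_numE ?epos_ge0 // /epos gt_max ltry andbT.
  exact: stop_value_lty.
have C0 : (0 <= C)%R by rewrite -lee_fin -CE epos_ge0.
have q0 := rate_gt0 hq i.
pose N := Num.max b (C / (a * rate q i))%R.
move: yL; rewrite ltNge => /negP; apply.
apply: (@le_trans _ _ (ereal_sup (bellman_rhs W t i @` [set z | N < z]%R))).
  apply: ereal_inf_lbound; exists [set z | N < z]%R => //.
  by exists N; split => //; exact: num_real.
apply: ge_ereal_sup => _ [z /= Nz <-].
have [bz Cz] : (b < z)%R /\ (C / (a * rate q i) < z)%R.
  by move: Nz; rewrite /N gt_max => /andP[].
have z0 : (0 <= z)%R by apply: (le_trans b0); exact: ltW.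
rewrite bellmanE //; last exact: jump_int_pos_horizon.
apply: (@le_trans _ _ (a + (p - n))%:E); last by rewrite lee_fin.
have h1 : stop_value (t + z)%R i * (expR (- (rate q i * z)))%:E <= a%:E.
  apply: (@le_trans _ _ (C%:E * (expR (- (rate q i * z)))%:E)).
    apply: lee_wpmul2r; first by rewrite lee_fin expR_ge0.
    rewrite -CE; apply: le_trans (ge_epos _).
    by apply: stop_value_nonincreasing => //; rewrite lerDl.
  rewrite -EFinM lee_fin expRN ler_pdivrMr ?expR_gt0 //.
  rewrite ltr_pdivrMr ?mulr_gt0 // in Cz.
  have := expR_ge1Dx (rate q i * z).
  move=> h; apply: (@le_trans _ _ (a * (rate q i * z))%R); first by lra.
  by rewrite ler_pM2l //; lra.
have h2 : jump_int i (pos_part W) t `[0%R, z]%classic <= p%:E.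
  by apply: ltW; apply: le_lt_trans hp; exact: jump_int_le_horizon.
have h3 := hb z (ltW bz).
rewrite EFinD; apply: leeD => //.
move: h2 h3; have := jump_int_ge0 hq i p0 t `[0%R, z]%classic.
rewrite -/(jump_int _ _ _ _).
case: (jump_int i (pos_part W) t _) => [x| |] // _;
  case: (jump_int i (neg_part W) t _) => [w| |] //; rewrite ?leNye //.
by rewrite -EFinB !lte_fin !lee_fin => h2 h3; lra.
Qed.

(** The losses of W at late dates are, up to a constant, at least a fixed
    fraction of the losses from stopping then with some reward M. *)
Definition utility_growth (t0 : R) (j : S) : Prop :=
  exists a M K : R, [/\ (0 < a)%R, (0 <= K)%R & forall t, (t0 <= t)%R ->
    a%:E * eneg (U (M - c * t)%R) <= neg_part W t j + K%:E].

Lemma exists_jump : exists2 j, j != i & (0 < q i j)%R.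
Proof.
apply: contrapT => nex; have := rate_gt0 hq i.
rewrite -lte_fin /rate (intensity_conservative hq) esum1 ?ltxx // => j /= ji.
have := intensity_ge0 hq (i := i) (j := j); rewrite eq_sym => /(_ ji).
rewrite le_eqVlt => /orP[/eqP <- //|q0]; exfalso; apply: nex.
by exists j.
Qed.

Lemma jump_sum_ge_term (f : S -> \bar R) j : (forall k, 0 <= f k) ->
  (jump_weight q i j)%:E * f j <= jump_sum q i f.
Proof.
move=> f0; rewrite /jump_sum (esumID [set j]) //; last first.
  by move=> k _; rewrite mule_ge0 ?lee_fin ?jump_weight_ge0.
rewrite setTI esum_set1; last by rewrite mule_ge0 ?lee_fin ?jump_weight_ge0.
apply: leeDl; apply: esum_ge0 => k _.
by rewrite mule_ge0 ?lee_fin ?jump_weight_ge0.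
Qed.

Lemma eneg_utility_le (x y : R) : (x <= y)%R -> eneg (U y) <= eneg (U x).
Proof. by move=> xy; apply: le_eneg; exact: (utility_nondecreasing hu). Qed.

Lemma jump_intD_cst (f : R -> S -> \bar R) (K t : R) : (0 <= K)%R ->
  (forall j, measurable_fun [set: R] (f^~ j)) -> (forall s j, 0 <= f s j) ->
  jump_int i (fun s j => f s j + K%:E) t `[0%R, +oo[%classic =
  jump_int i f t `[0%R, +oo[%classic + K%:E.
Proof.
move=> K0 mf f0; rewrite (@jump_intD _ _ _ hq i f (fun _ _ => K%:E)) //.
by rewrite jump_int_cst.
Qed.

(** The point is that stopping later and later must not cost more than waiting
    for the jump. If the losses after the jump have infinite expectation,
    waiting is worth -oo. Otherwise, by utility_growth at a state j reached
    with positive intensity, the losses of late stops are integrable against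
    e^(-q_i s); the stop term then gets close to 0 along a sequence of waiting
    times. *)
Lemma wait_le_sup t : (forall j, utility_growth t j) ->
  wait_value W t i <= bellman_sup W t i.
Proof.
move=> growth; rewrite /wait_value.
set P := jump_int i (pos_part W) t _; set N := jump_int i (neg_part W) t _.
have [->|NN] := eqVneq N +oo.
  by rewrite addeC /= leNye.
have N0 : 0 <= N by exact: jump_int_ge0.
have P0 : 0 <= P by exact: jump_int_ge0.
have q0 := rate_gt0 hq i.
have small e th0 : (0 < e)%R -> (0 <= th0)%R -> exists2 th, (th0 <= th)%R &
    (expR (- (rate q i * th)))%:E * eneg (stop_value (t + th)%R i) < e%:E.
  move=> e0 th00; apply: contrapT => nex.
  have {nex}big th : (th0 <= th)%R ->
      (e * expR (rate q i * th))%:E <= eneg (stop_value (t + th)%R i).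
    move=> hth; rewrite leNgt; apply/negP => h; apply: nex; exists th => //.
    rewrite expRN muleC -lte_pdivlMr ?invr_gt0 ?expR_gt0 // invrK.
    by rewrite -EFinM.
  have [j ji qj] := exists_jump.
  have [a [M [K [a0 K0 hg]]]] := growth j.
  (* a delay by dl costs at least the difference between the rewards M and g
     i *)
  pose dl := Num.max 0%R ((M - g i) / c)%R.
  have dl0 : (0 <= dl)%R by rewrite le_max lexx.
  have dlM : (M - g i <= c * dl)%R.
    rewrite -ler_pdivrMl // mulrC le_max lexx orbT //.
  have : jump_int i (fun s j => neg_part W s j + K%:E) t `[0%R, +oo[%classic < +oo.
    rewrite jump_intD_cst // -/N.
    by case: (N) NN => [x| |] //; rewrite ?ltry // -EFinD ltry.
  pose k := (q i j * (a * e * expR (- (rate q i * dl))))%R.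
  have k0 : (0 < k)%R by rewrite !mulr_gt0 // expR_gt0.
  rewrite ltNge => /negP; apply.
  apply: (@le_trans _ _ (\int[mu]_(s in `[(th0 + dl)%R, +oo[%classic) k%:E)).
    rewrite integral_cst //= lebesgue_measure_itv /= ltry /=.
    by rewrite gt0_muley ?lte_fin.
  have nK0 s l : 0 <= neg_part W s l + K%:E by rewrite adde_ge0 ?lee_fin.
  have mnK l : measurable_fun [set: R] (fun s => neg_part W s l + K%:E).
    by apply: emeasurable_funD.
  apply: (@le_trans _ _ (jump_int i (fun s j => neg_part W s j + K%:E) t
      `[(th0 + dl)%R, +oo[%classic)); last first.
    by apply: subset_jump_int => //; apply: subset_itvr; rewrite bnd_simp addr_ge0.
  apply: ge0_le_integral => //.
  - by move=> s _; rewrite lee_fin ltW.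
  - by apply: measurable_funTS; exact: (measurable_jump_integrand hq i mnK nK0 t).
  - move=> s /=; rewrite in_itv /= andbT => ths.
    have s0 : (0 <= s)%R by lra.
    apply: (@le_trans _ _ ((expR (- (rate q i * s)))%:E *
        ((jump_weight q i j)%:E * (neg_part W (t + s)%R j + K%:E)))); last first.
      apply: lee_wpmul2l; first by rewrite lee_fin expR_ge0.
      exact: (@jump_sum_ge_term (fun j => neg_part W (t + s)%R j + K%:E)).
    apply: (@le_trans _ _ ((expR (- (rate q i * s)))%:E *
        ((jump_weight q i j)%:E * (a%:E * (e * expR (rate q i * (s - dl)))%:E)))).
      rewrite /jump_weight ji -!EFinM lee_fin /k.
      have -> : expR (rate q i * (s - dl)) =
          (expR (rate q i * s) * expR (- (rate q i * dl)))%R.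
        by rewrite -expRD; congr expR; lra.
      rewrite (expRN (rate q i * s)); set E1 := expR (rate q i * s).
      have E10 : E1 != 0%R by rewrite gt_eqF // expR_gt0.
      rewrite (_ : (E1^-1 * _ = (E1^-1 * E1) *
         (q i j * (a * e * expR (- (rate q i * dl)))))%R); last by lra.
      by rewrite mulVf // mul1r.
    apply: lee_wpmul2l; first by rewrite lee_fin expR_ge0.
    apply: lee_wpmul2l; first by rewrite lee_fin jump_weight_ge0.
    apply: (@le_trans _ _ (a%:E * eneg (U (M - c * (t + s))%R))); last first.
      by apply: hg; rewrite lerDl.
    apply: lee_wpmul2l; first by rewrite lee_fin ltW.
    apply: (le_trans (big (s - dl)%R _)); first by lra.
    by apply: eneg_utility_le; lra.
apply/lee_addgt0Pr => e e0; pose e2 := (e / 2)%R.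
have e20 : (0 < e2)%R by rewrite divr_gt0.
have PP : P < +oo by exact: Wfin.
have Pe : P - e2%:E < P.
  by case: (P) PP P0 => [x| |] // _ _; rewrite -EFinB lte_fin; lra.
have [b b0 hb] := integral_0y_lt (measurable_jump_integrand hq i mp p0 t)
   (jump_integrand_ge0 hq i p0 t) Pe.
have [th bth hth] := small _ _ e20 b0.
have th0 : (0 <= th)%R by apply: le_trans bth.
have hP := hb _ bth.
apply: (@le_trans _ _ (bellman_rhs W t i th + e%:E)); last first.
  by apply: leeD => //; exact: bellman_le_sup.
rewrite bellmanE //; last exact: jump_int_pos_horizon.
have hN : jump_int i (neg_part W) t `[0%R, th]%classic <= N.
  exact: jump_int_le_horizon.
have hPle : jump_int i (pos_part W) t `[0%R, th]%classic <= P.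
  exact: jump_int_le_horizon.
have := jump_int_ge0 hq i n0 t `[0%R, th]%classic.
have := jump_int_ge0 hq i p0 t `[0%R, th]%classic.
move: hP hPle hN.
rewrite -/(jump_int _ _ _ _).
have hst : (- e2)%:E <= stop_value (t + th)%R i * (expR (- (rate q i * th)))%:E.
  apply: (@le_trans _ _ (- eneg (stop_value (t + th)%R i) * (expR (- (rate q i * th)))%:E)).
    by rewrite EFinN mulNe leeN2 muleC ltW.
  apply: lee_wpmul2r; first by rewrite lee_fin expR_ge0.
  by rewrite leeNl le_max lexx.
move: hst; have := stop_term_lty q g c dom u t i th.
case: (stop_value (t + th)%R i * _) => [x| |] // _ hx.
case: (jump_int i (pos_part W) t `[0%R, th]%classic) => [x1| |] //;
case: (jump_int i (neg_part W) t `[0%R, th]%classic) => [x2| |] //;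
case: (P) PP P0 => [x3| |] // _ _;
case: (N) NN N0 => [x4| |] // _ _; rewrite -?EFinB ?lee_fin ?lte_fin //.
move: hx; rewrite -?EFinB -?EFinD ?lee_fin ?lte_fin /e2 => *; lra.
Qed.

End Waiting.
End Iterates.

Section Growth.
Local Open Scope ereal_scope.
Context {R : realType} {S : countType} (q : S -> S -> R) (g : S -> R) (c : R)
  (dom : set R) (u : R -> R).
Hypotheses (hq : intensity_matrix q) (hc : (0 < c)%R) (hu : is_utility g dom u).
Local Notation mu := (@lebesgue_measure R).
Local Notation U := (utility dom u).
Local Notation stop_value := (stop_value g c dom u).
Local Notation bellman_rhs := (bellman_rhs q g c dom u).
Local Notation bellman_sup := (bellman_sup q g c dom u).
Local Notation jump_int := (jump_int q).
Local Notation utility_growth := (utility_growth c dom u).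

Lemma integral_exp_upto (r x : R) : (0 < r)%R -> (0 <= x)%R ->
  \int[mu]_(s in `[0%R, x]%classic) (r * expR (- (r * s)))%:E = (1 - expR (- (r * x)))%:E.
Proof.
move=> r0 x0.
have mf (D : set R) := @measurable_exponential_density R r D.
have f0 s : 0 <= (r * expR (- (r * s)))%:E by rewrite lee_fin mulr_ge0 ?expR_ge0 // ltW.
have : \int[mu]_(s in `[0%R, +oo[%classic) (r * expR (- (r * s)))%:E =
    \int[mu]_(s in `[0%R, x[%classic) (r * expR (- (r * s)))%:E +
    \int[mu]_(s in `[x, +oo[%classic) (r * expR (- (r * s)))%:E.
  rewrite -ge0_integral_setU //.
  - congr (integral _ _ _); apply/seteqP; split=> s /=; rewrite !in_itv /= !andbT.
      by move=> s0; case: (ltP s x) => sx; [left; rewrite s0|right].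
    by move=> [/andP[]//|xs]; exact: le_trans xs.
  - exact: mf.
  - by apply/disj_setPS => s [] /=; rewrite !in_itv /= !andbT => /andP[_ h] h2; lra.
rewrite (integral_exp_tail r0 x0) (integral_exp_tail r0 (lexx 0%R)).
rewrite mulr0 oppr0 expR0 integral_itv_bndo_bndc //.
have : 0 <= \int[mu]_(s in `[0%R, x]%classic) (r * expR (- (r * s)))%:E.
  by apply: integral_ge0.
case: (\int[mu]_(s in `[0%R, x]%classic) _) => [y| |] //= _ [h].
by congr EFin; lra.
Qed.

Lemma growth_stop t0 j : utility_growth stop_value t0 j.
Proof.
exists 1%R, (g j), 0%R; split => // t _.
by rewrite mul1e adde0.
Qed.

Lemma jump_int_time_le i (f : R -> S -> \bar R) t t' (D : set R) : measurable D ->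
  (forall j x y, (x <= y)%R -> f y j <= f x j) -> (forall s j, 0 <= f s j) ->
  (t <= t')%R -> jump_int i f t' D <= jump_int i f t D.
Proof.
move=> mD fni f0 tt'.
have mf j : measurable_fun [set: R] (f^~ j).
  by apply: nonincreasing_emeasurable => x y; exact: fni.
apply: ge0_le_integral => //.
- by move=> s _; exact: (jump_integrand_ge0 hq i f0).
- by apply: measurable_funTS; exact: (measurable_jump_integrand hq i mf f0).
- by apply: measurable_funTS; exact: (measurable_jump_integrand hq i mf f0).
- move=> s _; apply: lee_wpmul2l; first by rewrite lee_fin expR_ge0.
  by apply: (le_jump_sum hq) => j; apply: fni; rewrite lerD2r.
Qed.

(** A loss of the size of the utility at date t is incurred at the stop, which
    has weight e^(-q_i theta), and, by assumption on W, a fraction of it after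
    a jump to j before theta, which has a probability proportional to 1 -
    e^(-q_i theta). The two weights cannot both be small. *)
Lemma growth_step (W : R -> S -> \bar R) t0 i :
  (forall j x y, (x <= y)%R -> W y j <= W x j) ->
  (forall t, jump_int i (pos_part W) t `[0%R, +oo[%classic < +oo) ->
  (forall j, utility_growth W t0 j) -> utility_growth (bellman_sup W) t0 i.
Proof.
move=> Wni Wfin growth.
have mW j : measurable_fun [set: R] (W^~ j).
  by apply: nonincreasing_emeasurable => x y; exact: Wni.
have mp j : measurable_fun [set: R] (fun t => pos_part W t j) by exact: measurable_epos.
have mn j : measurable_fun [set: R] (fun t => neg_part W t j) by exact: measurable_eneg.
have p0 s j : 0 <= pos_part W s j by exact: epos_ge0.
have n0 s j : 0 <= neg_part W s j by exact: eneg_ge0.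
have q0 := rate_gt0 hq i.
have [j ji qj] := exists_jump hq i.
have [a [M [K [a0 K0 hg]]]] := growth j.
pose M' := Num.max M (g i).
have MM' : (M <= M')%R by rewrite le_max lexx.
have gM' : (g i <= M')%R by rewrite le_max lexx orbT.
pose b := (a * q i j / rate q i)%R.
have b0 : (0 < b)%R by rewrite divr_gt0 // mulr_gt0.
have bE : (b * rate q i = a * q i j)%R by rewrite /b divfK // gt_eqF.
(* ga <= e + b (1 - e) for all e in [0, 1] *)
pose ga := Num.min 1%R b.
have ga0 : (0 < ga)%R by rewrite lt_min ltr01.
have CE : epos (U (M' - c * t0)%R) \is a fin_num.
  by rewrite ge0_fin_numE ?epos_ge0 // /epos gt_max ltry andbT; exact: utility_lty.
pose C := fine (epos (U (M' - c * t0)%R)).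
have C0 : (0 <= C)%R by rewrite fine_ge0 // epos_ge0.
have PE : jump_int i (pos_part W) t0 `[0%R, +oo[%classic \is a fin_num.
  by rewrite ge0_fin_numE //; exact: jump_int_ge0.
pose P := fine (jump_int i (pos_part W) t0 `[0%R, +oo[%classic).
have P0 : (0 <= P)%R by rewrite fine_ge0 //; exact: jump_int_ge0.
exists ga, M', (C + P + K)%R; split => //; first by rewrite !addr_ge0.
move=> t t0t.
suff : bellman_sup W t i <= (C + P + K)%:E - ga%:E * eneg (U (M' - c * t)%R).
  rewrite /neg_part; move: (bellman_sup W t i) => x hx.
  apply: (@le_trans _ _ (- x + (C + P + K)%:E)); last first.
    by apply: leeD => //; rewrite /eneg le_max lexx.
  move: hx; have : 0 <= ga%:E * eneg (U (M' - c * t)%R).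
    by rewrite mule_ge0 ?eneg_ge0 // lee_fin ltW.
  case: (_ * _) => [y| |] // _; case: x => [x| |] //; rewrite ?leey ?leNye //.
    by rewrite -EFinB -EFinN -EFinD !lee_fin => ?; lra.
apply: ge_ereal_sup => _ [th /= th0 <-].
have hX : stop_value (t + th)%R i <= U (M' - c * t)%R.
  apply: (utility_nondecreasing hu).
  have : (0 <= c * th)%R by rewrite mulr_ge0 // ltW.
  by lra.
have Pfin : jump_int i (pos_part W) t `[0%R, th]%classic <= P%:E.
  rewrite (fineK PE : P%:E = _).
  apply: (@le_trans _ _ (jump_int i (pos_part W) t `[0%R, +oo[%classic)).
    by apply: subset_jump_int => //; apply: subset_itvl; rewrite bnd_simp.
  by apply: jump_int_time_le => // k x y xy; apply: le_epos; exact: Wni.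
rewrite bellmanE //; last by apply: le_lt_trans Pfin _; rewrite ltry.
have [yy|yy] := eqVneq (eneg (U (M' - c * t)%R)) +oo.
  have XN : stop_value (t + th)%R i = -oo.
    apply/eqP; rewrite -leeNy_eq; apply: (le_trans hX).
    move: yy; have := utility_lty dom u (M' - c * t)%R.
    by rewrite /eneg; case: (U _) => [r| |] // _; rewrite -EFinN -EFin_max.
  by rewrite XN mulNy_discount addNye leNye.
have yfin : eneg (U (M' - c * t)%R) \is a fin_num.
  by rewrite ge0_fin_numE ?eneg_ge0 // ltey.
pose y := fine (eneg (U (M' - c * t)%R)).
have yE : eneg (U (M' - c * t)%R) = y%:E by rewrite /y fineK.
have y0 : (0 <= y)%R by rewrite fine_ge0 // eneg_ge0.
rewrite yE.
pose e := expR (- (rate q i * th)).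
have e0 : (0 < e)%R by exact: expR_gt0.
have e1 : (e <= 1)%R by rewrite -expR0 ler_expR oppr_le0 mulr_ge0 // ltW.
have hX' : stop_value (t + th)%R i * e%:E <= (C - e * y)%:E.
  apply: (@le_trans _ _ ((C - y)%:E * e%:E)).
    apply: lee_wpmul2r; first by rewrite lee_fin ltW.
    apply: (le_trans hX); rewrite -(eposBeneg (U (M' - c * t)%R)) yE EFinB.
    apply: leeB => //; rewrite /C fineK //; apply: le_epos.
    apply: (utility_nondecreasing hu); rewrite lerB // ler_wpM2l //; exact: ltW.
  rewrite -EFinM lee_fin.
  have : (C * e <= C)%R by rewrite ler_piMr.
  by lra.
have hN : (b * (1 - e) * y)%:E <= jump_int i (neg_part W) t `[0%R, th]%classic + K%:E.
  have nK0 s l : 0 <= neg_part W s l + K%:E by rewrite adde_ge0 ?lee_fin.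
  have mnK l : measurable_fun [set: R] (fun s => neg_part W s l + K%:E).
    by apply: emeasurable_funD.
  apply: (@le_trans _ _ (jump_int i (fun s l => neg_part W s l + K%:E) t
      `[0%R, th]%classic)); last first.
    rewrite (@jump_intD _ _ _ hq i (neg_part W) (fun _ _ => K%:E)) //.
    apply: leeD => //; rewrite -[leRHS](jump_int_cst hq i t K0).
    apply: subset_jump_int => //; apply: subset_itvl; by rewrite bnd_simp.
  have -> : (b * (1 - e) * y)%:E = \int[mu]_(s in `[0%R, th]%classic)
      ((b * y)%:E * (rate q i * expR (- (rate q i * s)))%:E).
    rewrite ge0_integralZl //.
    - by rewrite integral_exp_upto // -EFinM; congr EFin; rewrite /e; lra.
    - apply: measurable_funTS; apply/measurable_EFinP; apply: measurable_funM => //.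
      by apply/measurable_EFinP; exact: measurable_expR_rate.
    - by move=> s _; rewrite lee_fin mulr_ge0 ?expR_ge0 // ltW.
    - by rewrite lee_fin mulr_ge0 // ltW.
  apply: ge0_le_integral => //.
  - move=> s _; rewrite -EFinM lee_fin; apply: mulr_ge0; first by rewrite mulr_ge0 // ltW.
    by rewrite mulr_ge0 ?expR_ge0 // ltW.
  - apply: measurable_funTS; apply/measurable_EFinP; apply: measurable_funM => //.
    apply: measurable_funM => //.
    by apply/measurable_EFinP; exact: measurable_expR_rate.
  - by apply: measurable_funTS; exact: (measurable_jump_integrand hq i mnK nK0 t).
  move=> s /=; rewrite in_itv /= => /andP[s0 _].
  apply: (@le_trans _ _ ((expR (- (rate q i * s)))%:E *
        ((jump_weight q i j)%:E * (neg_part W (t + s)%R j + K%:E)))); last first.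
    apply: lee_wpmul2l; first by rewrite lee_fin expR_ge0.
    exact: (@jump_sum_ge_term _ _ _ hq i (fun j => neg_part W (t + s)%R j + K%:E)).
  apply: (@le_trans _ _ ((expR (- (rate q i * s)))%:E *
        ((jump_weight q i j)%:E * (a%:E * y%:E)))).
    rewrite /jump_weight ji -!EFinM lee_fin.
    set E1 := expR _.
    rewrite (_ : (b * y * (rate q i * E1) = (b * rate q i) * y * E1)%R); last by lra.
    by rewrite bE; lra.
  apply: lee_wpmul2l; first by rewrite lee_fin expR_ge0.
  apply: lee_wpmul2l; first by rewrite lee_fin jump_weight_ge0.
  apply: (@le_trans _ _ (a%:E * eneg (U (M - c * (t + s))%R))); last first.
    by apply: hg; lra.
  apply: lee_wpmul2l; first by rewrite lee_fin ltW.
  rewrite -yE; apply: le_eneg; apply: (utility_nondecreasing hu).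
  have : (0 <= c * s)%R by rewrite mulr_ge0 // ltW.
  by lra.
have hga : (ga * y <= e * y + b * (1 - e) * y)%R.
  rewrite -mulrDl ler_wpM2r //.
  have g1 : (ga <= 1)%R by rewrite ge_min lexx.
  have g2 : (ga <= b)%R by rewrite ge_min lexx orbT.
  have : (ga * e <= e)%R by rewrite ler_piMl // ltW.
  have : (ga * (1 - e) <= b * (1 - e))%R by rewrite ler_wpM2r // subr_ge0.
  by lra.
move: hX' Pfin hN; rewrite /e.
have := jump_int_ge0 hq i n0 t `[0%R, th]%classic.
have := jump_int_ge0 hq i p0 t `[0%R, th]%classic.
have := stop_term_lty q g c dom u t i th.
case: (stop_value (t + th)%R i * _) => [x| |] // _;
case: (jump_int i (pos_part W) t `[0%R, th]%classic) => [x1| |] // _;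
case: (jump_int i (neg_part W) t `[0%R, th]%classic) => [x2| |] // _;
rewrite -?EFinM -?EFinB -?EFinD ?lee_fin ?leNye // -/e => *; lra.
Qed.

End Growth.

(** * Information carried by the jumps *)

Section Paths.
Context {R : realType} {S : countType} {d : measure_display}
  {T : measurableType d} (P : S -> probability T R) (X : R -> T -> S)
  (J : nat -> T -> R) (q : S -> S -> R).
Hypothesis hX : markov_chain P X J q.
Local Notation Z := (embedded X J).

Lemma jump_le m n w : (m <= n)%N -> J m w <= J n w.
Proof.
move=> mn; rewrite -(subnKC mn); elim: (n - m)%N => [|k IH]; first by rewrite addn0.
by rewrite addnS; apply: (le_trans IH); exact/ltW/(jump_lt hX).
Qed.

Lemma jump_ge0 n w : 0 <= J n w.
Proof. by rewrite -(jump0 hX w); exact: jump_le. Qed.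

Section Countable.
Context {d' : measure_display} {T' : measurableType d'} {I : countType}.

Lemma bigcup_countType (F : I -> set T') :
  (forall i, measurable (F i)) -> measurable (\bigcup_(i in [set: I]) F i).
Proof.
move=> mF; apply: countable_bigcupT_measurable => //.
Qed.

Lemma measurable_preimage_countType (f : T' -> I) (B : set I) :
  (forall i, measurable (f @^-1` [set i])) -> measurable (f @^-1` B).
Proof.
move=> mf.
rewrite (_ : f @^-1` B = \bigcup_(i in [set: I]) (if i \in B then f @^-1` [set i] else set0)).
  by apply: bigcup_countType => i; case: ifP.
apply/seteqP; split=> x /=.
  by move=> Bfx; exists (f x) => //; rewrite mem_set.
by move=> [i _]; case: ifPn => // /set_mem Bi /= ->.
Qed.

End Countable.

(** The generators of natural_filtration and of jump_history, from which these
    sigma-algebras are made into measurable types. *)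
Definition past_events (t : R) : set (set T) :=
  [set A | exists s (B : set S), 0 <= s <= t /\ A = X s @^-1` B].
Definition history_events (k : nat) : set (set T) :=
  [set A | exists m : nat, (m <= k)%N /\
        ((exists B : set S, A = embedded X J m @^-1` B) \/
         (exists a : R, A = [set w | J m w <= a]))].
Local Notation past t := (g_sigma_algebraType (past_events t)).
Local Notation history k := (g_sigma_algebraType (history_events k)).

Lemma past_measurable (t : R) (A : set T) : natural_filtration X t A -> measurable A.
Proof.
apply: smallest_sub; first exact: sigma_algebra_measurable.
move=> _ [s [B [/andP[s0 _] ->]]]; exact: (chain_measurable hX).
Qed.

Lemma past_mono (s t : R) (A : set T) : s <= t ->
  natural_filtration X s A -> natural_filtration X t A.
Proof.
move=> st; apply: sub_sigma_algebra2 => _ [r [B [/andP[r0 rs] ->]]].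
by exists r, B; rewrite r0 (le_trans rs).
Qed.

Lemma past_X (s t : R) (B : set S) : 0 <= s -> s <= t ->
  natural_filtration X t (X s @^-1` B).
Proof. by move=> s0 st; apply: sub_sigma_algebra; exists s, B; rewrite s0 st. Qed.

(** Countably many dates of [0, t], dense and including t itself, with which
    events on the path up to t are written as countable unions. *)
Definition date (t : R) (o : option rat) : R :=
  if o is Some r then Num.min (Num.max (ratr r) 0) t else t.

Lemma date_ge0 t o : 0 <= t -> 0 <= date t o.
Proof. by move=> t0; case: o => [r|] //=; rewrite le_min le_max lexx orbT. Qed.

Lemma date_le t o : date t o <= t.
Proof. by case: o => [r|] //=; rewrite ge_min lexx orbT. Qed.

Lemma date_dense t a b : 0 <= a -> a <= t -> a < b ->
  exists o, a <= date t o < b.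
Proof.
move=> a0; rewrite le_eqVlt => /orP[/eqP ->|at_] ab; first by exists None; rewrite /= lexx.
have [r] : exists r : rat, ratr r \in `]a, Num.min b t[.
  by apply: rat_in_itvoo; rewrite lt_min ab.
rewrite in_itv /= lt_min => /and3P[ar rb rt]; exists (Some r) => /=.
have r0 : 0 <= (ratr r : R) by apply: (le_trans a0); exact: ltW.
by rewrite (max_l r0) (min_l (ltW rt)) (ltW ar).
Qed.

(** As consecutive states differ, the jump after the n-th one has occurred by
    t iff the chain is in different states at two of these dates, the earlier
    of which is not before the n-th jump. *)
Lemma past_jump n (t : R) : 0 <= t -> natural_filtration X t [set w | J n w <= t].
Proof.
elim: n t => [|n IH] t t0.
  rewrite (_ : [set w | _] = setT); first exact: (@measurableT _ (past t)).
  by apply/seteqP; split => // w _ /=; rewrite (jump0 hX).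
rewrite (_ : [set w | _] = \bigcup_(p in [set: option rat * option rat])
   (if date t p.1 <= date t p.2 then
      [set w | J n w <= date t p.1] `&`
      ~` (\bigcup_(l in [set: S]) (X (date t p.1) @^-1` [set l] `&` X (date t p.2) @^-1` [set l]))
    else set0)).
  apply: (@bigcup_countType _ (past t)) => -[ o o'] /=; case: ifP => // oo'.
  apply: (@measurableI _ (past t)).
    by apply: (@past_mono (date t o)); [exact: date_le|apply: IH; exact: date_ge0].
  apply: (@measurableC _ (past t)); apply: (@bigcup_countType _ (past t)) => l.
  by apply: (@measurableI _ (past t)); apply: past_X; rewrite ?date_ge0 ?date_le.
apply/seteqP; split=> w /=.
  move=> Jt.
  have [ o /andP[h1 h2]] := date_dense (jump_ge0 n w)
    (le_trans (ltW (jump_lt hX n w)) Jt) (jump_lt hX n w).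
  have [ o' /andP[h3 h4]] := date_dense (jump_ge0 n.+1 w) Jt (jump_lt hX n.+1 w).
  exists (o, o') => //=; rewrite (le_trans (ltW h2) h3); split => // -[l _ [/= e1 e2]].
  apply: (jump_neq hX (n := n) (w := w)).
  rewrite /embedded -(@jump_constant _ _ _ _ _ _ _ _ hX w (date t o) n) ?h1 //.
  by rewrite -(@jump_constant _ _ _ _ _ _ _ _ hX w (date t o') n.+1) ?h3 // e1 e2.
move=> [[ o o'] _] /=; case: ifP => // oo' [Jo nX].
rewrite leNgt; apply/negP => tJ; apply: nX.
exists (X (J n w) w) => //; split => /=.
  by apply: (jump_constant hX); rewrite Jo (le_lt_trans (date_le _ _)).
by apply: (jump_constant hX); rewrite (le_trans Jo) // (le_lt_trans (date_le _ _)).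
Qed.

(** The state after the m-th jump is the one seen at any date before the next
    jump. *)
Lemma past_embedded m l (t : R) : 0 <= t ->
  natural_filtration X t ((Z m @^-1` [set l]) `&` [set w | J m w <= t]).
Proof.
move=> t0.
rewrite (_ : _ `&` _ = \bigcup_(o in [set: option rat])
  ([set w | J m w <= date t o] `&` ~` [set w | J m.+1 w <= date t o] `&`
   X (date t o) @^-1` [set l])).
  apply: (@bigcup_countType _ (past t)) => o.
  apply: (@measurableI _ (past t)).
    apply: (@measurableI _ (past t)); last apply: (@measurableC _ (past t)).
      by apply: (@past_mono (date t o)); [exact: date_le|apply: past_jump; exact: date_ge0].
    by apply: (@past_mono (date t o)); [exact: date_le|apply: past_jump; exact: date_ge0].
  by apply: past_X; [exact: date_ge0|exact: date_le].
apply/seteqP; split=> w /=.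
  move=> [Zl Jt]; have [ o /andP[h1 h2]] := date_dense (jump_ge0 m w) Jt (jump_lt hX m w).
  exists o => //; split; first by split => //; apply/negP; rewrite -ltNge.
  by rewrite /= (@jump_constant _ _ _ _ _ _ _ _ hX w (date t o) m) ?h1.
move=> [ o _ [[h1 /negP h2] /= Xl]]; rewrite -ltNge in h2.
split; last by apply: (le_trans h1); exact: date_le.
by rewrite /embedded -(@jump_constant _ _ _ _ _ _ _ _ hX w (date t o) m) ?h1.
Qed.

(** On the event that the k-th jump has occurred by t, the dates of the first
    k jumps and the states after them can be read off the path up to t. *)
Lemma past_history k (t : R) (A : set T) : 0 <= t -> jump_history X J k A ->
  natural_filtration X t (A `&` [set w | J k w <= t]).
Proof.
move=> t0; pose C := [set A | natural_filtration X t (A `&` [set w | J k w <= t])].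
suff : jump_history X J k `<=` C by apply.
apply: smallest_sub.
  split.
  - by rewrite /C /= set0I; exact: (@measurable0 _ (past t)).
  - move=> B CB; rewrite /C /= setTD.
    rewrite (_ : _ `&` _ = [set w | J k w <= t] `\` (B `&` [set w | J k w <= t])); last first.
      apply/seteqP; split=> w /= [h1 h2]; split => //; first by move=> [].
      by move=> Bw; apply: h2.
    by apply: (@measurableD _ (past t)) => //; exact: past_jump.
  - move=> F CF; rewrite /C /= setI_bigcupl.
    exact: (@bigcupT_measurable _ (past t)).
move=> _ [m [mk [[B ->]|[a ->]]]]; rewrite /C /=.
  rewrite (_ : _ `&` _ = (\bigcup_(l in [set: S]) (if l \in B then
     (Z m @^-1` [set l]) `&` [set w | J m w <= t] else set0)) `&` [set w | J k w <= t]).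
    apply: (@measurableI _ (past t)); last exact: past_jump.
    apply: (@bigcup_countType _ (past t)) => l; case: ifP => // _.
    exact: past_embedded.
  apply/seteqP; split=> w /= [h1 h2]; split => //.
    exists (Z m w) => //; rewrite mem_set //; split => //=.
    by apply: le_trans h2; exact: jump_le.
  by move: h1 => [l _]; case: ifPn => // /set_mem Bl [/= ->].
have [a0|a0] := ltP a 0.
  rewrite (_ : _ `&` _ = set0); first exact: (@measurable0 _ (past t)).
  apply/seteqP; split=> w //= [h1 _].
  by have := jump_ge0 m w; rewrite leNgt (le_lt_trans h1).
rewrite (_ : _ `&` _ = [set w | J m w <= Num.min a t] `&` [set w | J k w <= t]).
  apply: (@measurableI _ (past t)); last exact: past_jump.
  apply: (@past_mono (Num.min a t)); first by rewrite ge_min lexx orbT.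
  by apply: past_jump; rewrite le_min a0.
apply/seteqP; split=> w /= [h1 h2]; split => //.
  by rewrite le_min h1 (le_trans _ h2) // jump_le.
by move: h1; rewrite le_min => /andP[].
Qed.

Lemma measurable_of_sublevels (d' : measure_display) (T' : measurableType d') (f : T' -> R) :
  (forall a, measurable [set w | f w <= a]) -> measurable_fun [set: T'] f.
Proof.
move=> mf; apply: (measurability (@RGenOInfty.G R)) => [|/= _ [_] [r] -> <-].
  exact: RGenOInfty.measurableE.
rewrite setTI (_ : f @^-1` _ = ~` [set w | f w <= r]); first exact: measurableC.
by apply/seteqP; split=> w /=; rewrite in_itv /= andbT ltNge => /negP.
Qed.

Lemma history_jump k m : (m <= k)%N -> measurable_fun [set: history k] (J m : history k -> R).
Proof.
move=> mk; apply: measurable_of_sublevels => a.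
by apply: sub_sigma_algebra; exists m; split => //; right; exists a.
Qed.

Lemma history_embedded k m (B : set S) : (m <= k)%N -> jump_history X J k (Z m @^-1` B).
Proof.
by move=> mk; apply: sub_sigma_algebra; exists m; split => //; left; exists B.
Qed.

Lemma history_mono k k' (A : set T) : (k <= k')%N ->
  jump_history X J k A -> jump_history X J k' A.
Proof.
move=> kk'; apply: sub_sigma_algebra2 => B [m [mk h]].
by exists m; split => //; exact: leq_trans kk'.
Qed.

Lemma measurable_jump_le n a : measurable [set w | J n w <= a].
Proof.
have [a0|a0] := leP 0 a; first by apply: (@past_measurable a); exact: past_jump.
rewrite (_ : [set w | _] = set0) //; apply/seteqP; split=> w //= h.
by have := jump_ge0 n w; rewrite leNgt (le_lt_trans h).
Qed.

Lemma measurable_jump n : measurable_fun [set: T] (J n).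
Proof. by apply: measurable_of_sublevels => a; exact: measurable_jump_le. Qed.

Lemma measurable_embedded1 n l : measurable (Z n @^-1` [set l]).
Proof.
rewrite (_ : _ @^-1` _ = \bigcup_m ((Z n @^-1` [set l]) `&` [set w | J n w <= m%:R])).
  by apply: bigcupT_measurable => m; apply: (@past_measurable m%:R); exact: past_embedded.
apply/seteqP; split=> w /=; last by move=> [m _ []].
move=> Zl; exists (Num.truncn (J n w)).+1 => //; split => //=.
exact/ltW/truncnS_gt.
Qed.

Lemma measurable_embedded n (B : set S) : measurable (Z n @^-1` B).
Proof. by apply: measurable_preimage_countType => l; exact: measurable_embedded1. Qed.

Lemma history_measurable k (A : set T) : jump_history X J k A -> measurable A.
Proof.
apply: smallest_sub; first exact: sigma_algebra_measurable.
move=> _ [m [_ [[B ->]|[a ->]]]]; [exact: measurable_embedded|exact: measurable_jump_le].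
Qed.

End Paths.

(** * The law of one jump *)

Section ExponentialDensity.
Local Open Scope ereal_scope.
Context {R : realType} (r : R).
Hypothesis r0 : (0 < r)%R.
Local Notation mu := (@lebesgue_measure R).
Import HBNNSimple.

Lemma exponential_probE (D : set R) :
  exponential_prob r D =
  \int[mu]_(x in D `&` `[0%R, +oo[%classic) (r * expR (- (r * x)))%:E.
Proof.
rewrite /exponential_prob integral_mkcondr; apply: eq_integral => x _.
rewrite /exponential_pdf !patchE; case: ifP => //.
by rewrite mulNr.
Qed.

Lemma exponential_prob_tail (a : R) : (0 <= a)%R ->
  exponential_prob r `]a, +oo[%classic = (expR (- (r * a)))%:E.
Proof.
move=> a0; rewrite exponential_probE (_ : _ `&` _ = `]a, +oo[%classic); last first.
  apply/seteqP; split=> s /=; rewrite !in_itv /= !andbT; first by case.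
  by move=> h; split => //; lra.
rewrite integral_itv_obnd_cbnd ?integral_exp_tail //.
exact: measurable_exponential_density.
Qed.

Let dens (x : R) : R := (r * expR (- (r * x)))%R.

Let mdens : measurable_fun [set: R] (fun x => (dens x)%:E).
Proof. exact: measurable_exponential_density. Qed.

Let dens0 x : 0 <= (dens x)%:E.
Proof. by rewrite lee_fin mulr_ge0 ?expR_ge0 // ltW. Qed.

Let D0 : set R := `[0%R, +oo[%classic.

Let mD0 : measurable D0. Proof. exact: measurable_itv. Qed.

Let exponential_nnsfun (h : {nnsfun (measurableTypeR R) >-> R}) :
  \int[exponential_prob r]_x (h x)%:E = \int[mu]_(x in D0) ((h x)%:E * (dens x)%:E).
Proof.
under [LHS]eq_integral do rewrite fimfunE -fsumEFin//.
rewrite [LHS]ge0_integral_fsum//; last 2 first.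
  - move=> y; apply/measurable_EFinP; apply: measurable_funM => //.
  - by move=> n x _; rewrite EFinM nnfun_muleindic_ge0.
under [RHS]eq_integral.
  move=> x xD; rewrite fimfunE -fsumEFin// ge0_mule_fsuml; last first.
    by move=> y; rewrite EFinM nnfun_muleindic_ge0.
  over.
rewrite [RHS]ge0_integral_fsum//; last 2 first.
  - move=> y; apply: emeasurable_funM; last exact: measurable_funTS.
    by apply: measurable_funTS; apply/measurable_EFinP; exact: measurable_funM.
  - by move=> n x _; rewrite mule_ge0// EFinM nnfun_muleindic_ge0.
apply: eq_fsbigr => y _.
rewrite integralZl_indic_nnsfun // integral_indic // setIT.
transitivity (y%:E * \int[mu]_(x in (h @^-1` [set y]) `&` `[0%R, +oo[%classic)
    (r * expR (- (r * x)))%:E); first by rewrite -exponential_probE.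
have [y0|y0] := ltP y 0%R.
  have h0 : (h : R -> R) @^-1` [set y] = set0.
    apply/seteqP; split => x //= hx; have : (0 <= h x)%R by [].
    by rewrite (hx : h x = y) leNgt y0.
  rewrite !h0 set0I integral_set0 mule0 integral0_eq // => x _.
  by rewrite indic0 mulr0 mul0e.
under [RHS]eq_integral do rewrite EFinM -muleA.
rewrite ge0_integralZl //; last 2 first.
  - apply: emeasurable_funM; last exact: measurable_funTS.
    by apply: measurable_funTS; exact/measurable_EFinP.
  - by move=> x _; rewrite mule_ge0 // lee_fin.
congr (_ * _); rewrite setIC integral_mkcondr; apply: eq_integral => x _.
by rewrite epatch_indic muleC.
Qed.

(** The density formula, first for simple functions and then by monotone
    convergence. *)
Lemma integral_exponential_prob (f : R -> \bar R) :
  measurable_fun [set: R] f -> (forall x, 0 <= f x) ->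
  \int[exponential_prob r]_x f x =
  \int[mu]_(x in `[0%R, +oo[%classic) (f x * (r * expR (- (r * x)))%:E).
Proof.
move=> mf f0.
pose f_ := nnsfun_approx measurableT (mf : measurable_fun [set: measurableTypeR R] f).
transitivity (limn (fun n => \int[exponential_prob r]_x (f_ n x)%:E)).
  rewrite -monotone_convergence//=.
  - congr (integral _ _ _); apply/funext => x; apply/esym/cvg_lim => //=.
    exact: cvg_nnsfun_approx.
  - by move=> n; exact/measurable_EFinP.
  - by move=> n x _; rewrite lee_fin.
  - by move=> x _ a b ab; rewrite lee_fin//; exact/lefP/nd_nnsfun_approx.
under eq_fun do rewrite exponential_nnsfun.
rewrite -monotone_convergence//=.
- apply: eq_integral => x _; rewrite -/(dens x); apply/cvg_lim => //.
  apply: cvgeZr => //; exact: cvg_nnsfun_approx.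
- move=> n; apply: measurable_funTS; apply: emeasurable_funM => //.
  exact/measurable_EFinP.
- by move=> n x _; rewrite mule_ge0 // lee_fin.
- move=> x _ a b ab; apply: lee_wpmul2r => //.
  by rewrite lee_fin; exact/lefP/nd_nnsfun_approx.
Qed.

End ExponentialDensity.

Section RestrictedIntegral.
Local Open Scope ereal_scope.
Context {R : realType} {d : measure_display} {T : measurableType d}.

Lemma integral_mrestr (mu : {measure set T -> \bar R}) (D : set T) (mD : measurable D)
    (f : T -> \bar R) : measurable_fun [set: T] f -> (forall x, 0 <= f x) ->
  \int[mrestr mu mD]_x f x = \int[mu]_(x in D) f x.
Proof.
move=> mf f0; rewrite -(setUv D) ge0_integral_setU //; last 3 first.
- exact: measurableC.
- by rewrite setUv.
- exact/disj_setPCl.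
rewrite (eq_measure_integral mu); last by move=> A mA AD; rewrite /= /mrestr setIidl.
rewrite [X in _ + X](eq_measure_integral mzero); last first.
  move=> A mA AD; rewrite /= /mrestr /mzero (_ : A `&` D = set0) ?measure0 //.
  by apply/seteqP; split => x // [/AD].
by rewrite integral_measure_zero adde0.
Qed.

End RestrictedIntegral.

Definition pushforward_measure {R : realType} {d d' : measure_display}
    {T : measurableType d} {T' : measurableType d'} (m : {measure set T -> \bar R})
    (f : T -> T') (mf : measurable_fun [set: T] f) : {measure set T' -> \bar R} :=
  measure_function_pushforward__canonical__measure_function_Measure m mf.

Definition exponential_measure {R : realType} (r : R) (r0 : 0 < r) :
    probability (measurableTypeR R) R :=
  exponential_distribution_exponential_prob__canonical__probability_measure_Probability r0.

Section OneStep.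
Local Open Scope ereal_scope.
Context {R : realType} {S : countType} {d : measure_display}
  {T : measurableType d} (P : S -> probability T R) (X : R -> T -> S)
  (J : nat -> T -> R) (q : S -> S -> R).
Hypotheses (hX : markov_chain P X J q) (hq : intensity_matrix q).
Local Notation Z := (embedded X J).
Local Notation mu := (@lebesgue_measure R).

Definition holding (k : nat) (w : T) : R := (J k.+1 w - J k w)%R.

Lemma measurable_holding k : measurable_fun [set: T] (holding k).
Proof. by apply: measurable_funB; exact: (measurable_jump hX). Qed.

Section Law.
Variables (i : S) (k : nat) (l j : S).
Hypothesis jl : j != l.
Let r := rate q l.
Let r0 : (0 < r)%R. Proof. exact: rate_gt0. Qed.
Let p := (q l j / r)%R.
Let p0 : (0 <= p)%R.
Proof. by rewrite divr_ge0 ?(ltW r0) // (intensity_ge0 hq) // eq_sym. Qed.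

(** Both sides are finite measures in C; by jump_law they agree on the
    half-lines, which determine them. *)
Lemma holding_law (A : set T) (C : set R) : jump_history X J k A -> measurable C ->
  P i (A `&` Z k @^-1` [set l] `&` Z k.+1 @^-1` [set j] `&` holding k @^-1` C) =
  p%:E * P i (A `&` Z k @^-1` [set l]) * exponential_prob r C.
Proof.
move=> hA mC.
have mE : measurable (A `&` Z k @^-1` [set l]).
  apply: measurableI; first exact: (history_measurable hX hA).
  exact: (measurable_embedded hX).
have mF : measurable (A `&` Z k @^-1` [set l] `&` Z k.+1 @^-1` [set j]).
  by apply: measurableI => //; exact: (measurable_embedded hX).
pose E0 := fine (P i (A `&` Z k @^-1` [set l])).
have E0E : P i (A `&` Z k @^-1` [set l]) = E0%:E.
  by rewrite /E0 fineK // fin_num_measure.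
have E00 : (0 <= E0)%R by rewrite fine_ge0.
have pE0 : (0 <= p * E0)%R by rewrite mulr_ge0.
pose m1 := @pushforward_measure _ _ _ T (measurableTypeR R) (mrestr (P i) mF) _
  (measurable_holding k).
pose m2 : {measure set (measurableTypeR R) -> \bar R} := mscale (NngNum pE0) (exponential_measure r0).
suff : m1 C = m2 C.
  rewrite /m1 /= /pushforward /mrestr /m2 /= /mscale /= setIC => ->.
  by rewrite E0E EFinM.
apply: (@measure_unique _ _ (measurableTypeR R)
    [set A : set R | exists x, A = `]x, +oo[%classic]
    (fun n => `](- n%:R)%R, +oo[%classic) _ _ _ _ m1 m2) => //.
- exact: (@RGenOInfty.measurableE R).
- move=> _ _ [x ->] [y ->]; exists (Num.max x y).
  by apply/seteqP; split=> s /=; rewrite !in_itv /= !andbT gt_max => /andP.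
- by move=> n; exists (- n%:R)%R.
- apply/seteqP; split => // x _; exists (Num.truncn `|x|).+1 => //=.
  rewrite in_itv /= andbT ltrNl; apply: le_lt_trans (truncnS_gt _).
  by rewrite ler_normr lexx orbT.
- move=> _ [x ->].
  rewrite /m1 /= /pushforward /mrestr /m2 /= /mscale /=.
  (* jump_law concerns x >= 0; holding times being positive, a negative x
     amounts to 0 *)
  pose x' := Num.max x 0%R.
  have x'0 : (0 <= x')%R by rewrite le_max lexx orbT.
  have -> : exponential_prob r `]x, +oo[%classic = (expR (- (r * x')))%:E.
    rewrite -exponential_prob_tail // !exponential_probE //.
    have [xlt|xge] := ltP x 0%R; last by rewrite /x' max_l.
    rewrite /x' max_r ?ltW //.
    rewrite (_ : `]x, +oo[ `&` _ = `[0%R, +oo[%classic); last first.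
      apply/seteqP; split=> s /=; rewrite !in_itv /= !andbT; first by case.
      by move=> s0; split => //; apply: lt_le_trans s0.
    rewrite (_ : `]0%R, +oo[ `&` _ = `]0%R, +oo[%classic); last first.
      by apply/seteqP; split=> s /=; rewrite !in_itv /= !andbT; [case|move=> s0; rewrite ltW].
    rewrite integral_itv_obnd_cbnd //.
    exact: measurable_exponential_density.
  rewrite (_ : _ `&` _ = A `&` Z k @^-1` [set l] `&` [set w | x' < J k.+1 w - J k w]%R
           `&` Z k.+1 @^-1` [set j]).
    rewrite (jump_law hX) // E0E -!EFinM; congr EFin.
    by rewrite -/r -/p; lra.
  have hpos w : (0 < J k.+1 w - J k w)%R by rewrite subr_gt0; exact: (jump_lt hX).
  apply/seteqP; split=> w /=; rewrite /holding in_itv /= andbT /x' gt_max hpos andbT.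
    by move=> [? [[? ?] ?]]; split => //; split.
  by move=> [[[? ?] ?] ?]; split.
- move=> n; rewrite /m1 /= /pushforward /mrestr /=.
  apply: le_lt_trans (ltry 1); apply: probability_le1.
  apply: measurableI => //; rewrite -[X in measurable X]setTI.
  exact: (measurable_holding k).
Qed.

(** By holding_law the joint law of J k and of the holding time is a product
    measure on this event, so that Tonelli applies. *)
Lemma transition_integral (A : set T) (G : R * R -> \bar R) :
  jump_history X J k A -> measurable_fun [set: R * R] G -> (forall x, 0 <= G x) ->
  \int[P i]_(w in A `&` Z k @^-1` [set l] `&` Z k.+1 @^-1` [set j]) G (J k w, holding k w) =
  \int[P i]_(w in A `&` Z k @^-1` [set l])
     \int[mu]_(s in `[0%R, +oo[%classic)
       ((expR (- (r * s)))%:E * ((q l j)%:E * G (J k w, s))).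
Proof.
move=> hA mG G0.
have mE : measurable (A `&` Z k @^-1` [set l]).
  apply: measurableI; first exact: (history_measurable hX hA).
  exact: (measurable_embedded hX).
have mF : measurable (A `&` Z k @^-1` [set l] `&` Z k.+1 @^-1` [set j]).
  by apply: measurableI => //; exact: (measurable_embedded hX).
have mpair : measurable_fun [set: T]
    ((fun w => (J k w, holding k w)) : T -> (measurableTypeR R * measurableTypeR R)%type).
  by apply: measurable_fun_pair; [exact: (measurable_jump hX)|exact: measurable_holding].
pose m := pushforward_measure (mrestr (P i) mF) mpair.
pose m1 : {measure set (measurableTypeR R) -> \bar R} :=
  mscale (NngNum p0) (@pushforward_measure _ _ _ T (measurableTypeR R)
    (mrestr (P i) mE) _ (measurable_jump hX k)).
have m1fin : fin_num_fun m1.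
  move=> B mB; rewrite /m1 /= /mscale /= /pushforward /mrestr.
  by rewrite fin_numM // fin_num_measure //; apply: measurableI => //;
    rewrite -[X in measurable X]setTI; exact: (measurable_jump hX k).
pose m1' : {finite_measure set (measurableTypeR R) -> \bar R} :=
  HB.pack (Measure.sort m1) (Measure_isFinite.Build _ _ _ m1 m1fin).
have prodE E : measurable E -> (m1' \x exponential_measure r0) E = m E.
  apply: product_measure_unique => B C mB mC.
  have mJB : jump_history X J k (A `&` J k @^-1` B).
    apply: (@measurableI _ (g_sigma_algebraType (history_events X J k))) => //.
    rewrite -[X in _ X]setTI; exact: (history_jump (leqnn k) (@measurableT _ _) mB).
  rewrite /m /= /pushforward /mrestr.
  transitivity (P i (A `&` J k @^-1` B `&` Z k @^-1` [set l] `&` Z k.+1 @^-1` [set j]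
     `&` holding k @^-1` C)).
    congr (P i _); apply/seteqP; split=> w /=; first by move=> [[? ?] [[? ?] ?]].
    by move=> [[[[? ?] ?] ?] ?].
  rewrite holding_law // /m1' /= /m1 /= /mscale /= /pushforward /mrestr.
  congr (_ * P i _ * _); apply/seteqP; split=> w /=; first by move=> [[? ?] ?].
  by move=> [? [? ?]].
transitivity (\int[m]_z G z).
  rewrite /m /= ge0_integral_pushforward // integral_mrestr //.
    exact: (measurableT_comp mG mpair).
  by move=> w; exact: G0.
transitivity (\int[m1' \x exponential_measure r0]_z G z).
  by apply: eq_measure_integral => E mE' _; exact: (esym (prodE _ _)).
transitivity (\int[m1']_x fubini_F (exponential_measure r0) G x).
  exact: (@fubini_tonelli1 _ _ _ _ R m1' (exponential_measure r0) G mG G0).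
have mF2 : measurable_fun [set: measurableTypeR R] (fubini_F (exponential_measure r0) G).
  exact: (@measurable_fun_fubini_tonelli_F _ _ (measurableTypeR R) (measurableTypeR R) R
    (exponential_measure r0) G mG G0).
have F20 x : 0 <= fubini_F (exponential_measure r0) G x by apply: integral_ge0.
rewrite /m1' /= ge0_integral_mscale //.
transitivity (p%:E * \int[P i]_(w in A `&` Z k @^-1` [set l])
    fubini_F (exponential_measure r0) G (J k w)).
  congr (_ * _).
  transitivity (\int[mrestr (P i) mE]_w fubini_F (exponential_measure r0) G (J k w)).
    by rewrite /= ge0_integral_pushforward //; exact: (measurable_jump hX k).
  rewrite integral_mrestr //.
  exact: (measurableT_comp mF2 (measurable_jump hX k)).
rewrite -ge0_integralZl //; last first.
- by apply: measurable_funTS; exact: (measurableT_comp mF2 (measurable_jump hX k)).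
apply: eq_integral => w _; rewrite /fubini_F /=.
have mGw : measurable_fun [set: R] (fun s => G (J k w, s)) by exact: measurable_fun_pair2.
rewrite [X in _ * X](_ : _ = \int[mu]_(s in `[0%R, +oo[%classic)
  (G (J k w, s) * (r * expR (- (r * s)))%:E)); last exact: integral_exponential_prob.
rewrite -ge0_integralZl //; last 2 first.
- apply: emeasurable_funM; first exact: measurable_funTS.
  exact: measurable_exponential_density.
- by move=> s _; rewrite mule_ge0 // lee_fin mulr_ge0 ?expR_ge0 // ltW.
apply: eq_integral => s _.
rewrite muleCA -EFinM muleC muleA -EFinM; congr (_%:E * _).
have pr : (p * r = q l j)%R by rewrite /p divfK // gt_eqF.
by rewrite -pr; lra.
Qed.

End Law.

(** The strong Markov property at the k-th jump in one-step form:
    transition_integral summed over the next state. *)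
Lemma one_step_integral i k l (A : set T) (G : S -> R * R -> \bar R) :
  jump_history X J k A -> (forall j, measurable_fun [set: R * R] (G j)) ->
  (forall j x, 0 <= G j x) ->
  \int[P i]_(w in A `&` Z k @^-1` [set l]) G (Z k.+1 w) (J k w, holding k w) =
  \int[P i]_(w in A `&` Z k @^-1` [set l])
     \int[mu]_(s in `[0%R, +oo[%classic)
       ((expR (- (rate q l * s)))%:E * jump_sum q l (fun j => G j (J k w, s))).
Proof.
move=> hA mG G0.
have mE : measurable (A `&` Z k @^-1` [set l]).
  apply: measurableI; first exact: (history_measurable hX hA).
  exact: (measurable_embedded hX).
have mpair : measurable_fun [set: T] (fun w => (J k w, holding k w)).
  by apply: measurable_fun_pair; [exact: (measurable_jump hX)|exact: measurable_holding].
have mGZ : measurable_fun [set: T] (fun w => G (Z k.+1 w) (J k w, holding k w)).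
  apply: (@measurable_select _ _ _ _ (Z k.+1) (fun j w => G j (J k w, holding k w))).
    exact: (measurable_embedded1 hX).
  by move=> j; exact: (measurableT_comp (mG j) mpair).
rewrite (@integral_fibers _ _ _ _ _ _ (Z k.+1)) //; last exact: (measurable_embedded1 hX).
have mInt j : measurable_fun [set: R * R] (fun p : R * R =>
    (expR (- (rate q l * p.2)))%:E * ((jump_weight q l j)%:E * G j p)).
  apply: emeasurable_funM; last by apply: measurable_funeM.
  exact: (measurableT_comp (measurable_expR_rate q l) measurable_snd).
have Int0 j p : 0 <= (expR (- (rate q l * p.2)))%:E * ((jump_weight q l j)%:E * G j p).
  by rewrite !mule_ge0 ?lee_fin ?expR_ge0 // jump_weight_ge0.
transitivity (\esum_(j in [set: S]) \int[P i]_(w in A `&` Z k @^-1` [set l])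
     \int[mu]_(s in `[0%R, +oo[%classic)
       ((expR (- (rate q l * s)))%:E * ((jump_weight q l j)%:E * G j (J k w, s)))).
  apply: eq_esum => j _; rewrite /jump_weight; case: ifPn => jl.
    rewrite -transition_integral //; apply: eq_integral => w /set_mem [_ /= ->].
    by [].
  rewrite negbK in jl; rewrite (eqP jl).
  rewrite (_ : _ `&` _ = set0) ?integral_set0; last first.
    apply/seteqP; split=> w //= [[_ e1] e2].
    by apply: (jump_neq hX (n := k) (w := w)); rewrite e1 e2.
  rewrite integral0_eq // => w _; rewrite integral0_eq // => s _.
  by rewrite mul0e mule0.
have mpart j : measurable_fun [set: R] (fun x : R => \int[mu]_(s in `[0%R, +oo[%classic)
       ((expR (- (rate q l * s)))%:E * ((jump_weight q l j)%:E * G j (x, s)))).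
  pose F (p : R * R) := (\1_(`[0%R, +oo[%classic) p.2)%:E *
     ((expR (- (rate q l * p.2)))%:E * ((jump_weight q l j)%:E * G j p)).
  have mF : measurable_fun [set: R * R] F.
    apply: emeasurable_funM => //; apply/measurable_EFinP.
    by apply: measurableT_comp => //; exact: measurable_indic.
  have F0 p : 0 <= F p by rewrite mule_ge0 ?lee_fin.
  have := @measurable_fun_fubini_tonelli_F _ _ _ _ R mu F mF F0.
  apply: eq_measurable_fun => x _; rewrite /fubini_F [RHS]integral_mkcond.
  by apply: eq_integral => s _; rewrite epatch_indic muleC.
rewrite -integral_esum //; last 2 first.
- move=> j; apply: measurable_funTS.
  exact: (measurableT_comp (mpart j) (measurable_jump hX k)).
- move=> j w; apply: integral_ge0 => s _; exact: (Int0 j (J k w, s)).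
apply: eq_integral => w _.
rewrite -integral_esum //; last 2 first.
- move=> j; apply: measurable_funTS.
  exact: (measurableT_comp (mInt j) (pair1_measurable (J k w))).
- by move=> j s; exact: (Int0 j (J k w, s)).
apply: eq_integral => s _; rewrite /jump_sum esumZl ?expR_ge0 // => j.
by rewrite mule_ge0 // lee_fin jump_weight_ge0.
Qed.

End OneStep.

(** * Stopping rules along the jumps *)

Section Rules.
Context {R : realType} {S : countType} {d : measure_display}
  {T : measurableType d} (P : S -> probability T R) (X : R -> T -> S)
  (J : nat -> T -> R) (q : S -> S -> R).
Hypothesis hX : markov_chain P X J q.
Local Notation Z := (embedded X J).
Local Notation past t := (g_sigma_algebraType (past_events X t)).
Local Notation history k := (g_sigma_algebraType (history_events X J k)).

(** H k w is the waiting time prescribed after the k-th jump. It may depend on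
    the whole path, so that rules include those which remember a choice made
    at an earlier jump. *)
Definition stops (H : nat -> T -> \bar R) (w : T) (k : nat) : bool :=
  ((J k w)%:E + H k w < (J k.+1 w)%:E)%E.

Definition rule_time (H : nat -> T -> \bar R) (w : T) : \bar R :=
  match pselect (exists k, stops H w k) with
  | left ex => let k := ex_minn ex in ((J k w)%:E + H k w)%E
  | right _ => +oo%E
  end.

Lemma markov_time_rule h t :
  markov_time X J h t = rule_time (fun k w => h k (t + J k w) (Z k w)).
Proof. by []. Qed.

Lemma rule_time_first H w k : stops H w k -> (forall m, (m < k)%N -> ~~ stops H w m) ->
  rule_time H w = ((J k w)%:E + H k w)%E.
Proof.
move=> sk nk; rewrite /rule_time; case: pselect => [ex|nex]; last by exfalso; apply: nex; exists k.
case: ex_minnP => m sm mmin /=; suff -> : m = k by [].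
apply/eqP; rewrite eqn_leq mmin //= leqNgt; apply/negP => /nk.
by rewrite sm.
Qed.

Lemma rule_time_oo H w : (forall k, ~~ stops H w k) -> rule_time H w = +oo%E.
Proof.
move=> ns; rewrite /rule_time; case: pselect => // -[k sk].
by move: (ns k); rewrite sk.
Qed.

Lemma rule_timeP H w :
  (exists k, [/\ stops H w k, (forall m, (m < k)%N -> ~~ stops H w m) &
     rule_time H w = ((J k w)%:E + H k w)%E]) \/
  ((forall k, ~~ stops H w k) /\ rule_time H w = +oo%E).
Proof.
have [ex|nex] := pselect (exists k, stops H w k).
  left; exists (ex_minn ex); case: ex_minnP => k sk kmin.
  have nk m : (m < k)%N -> ~~ stops H w m.
    by move=> mk; apply/negP => /kmin; rewrite leqNgt mk.
  by split => //; exact: rule_time_first.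
right; have ns k : ~~ stops H w k by apply/negP => sk; apply: nex; exists k.
by split => //; exact: rule_time_oo.
Qed.

Lemma eq_rule_time H H' w : (forall k, H k w = H' k w) -> rule_time H w = rule_time H' w.
Proof.
move=> HH'; have sE k : stops H w k = stops H' w k by rewrite /stops HH'.
case: (rule_timeP H w) => [[k [sk nk ->]]|[ns ->]].
  rewrite HH'; apply/esym/rule_time_first; first by rewrite -sE.
  by move=> m mk; rewrite -sE nk.
by apply/esym/rule_time_oo => k; rewrite -sE.
Qed.

Section Adapted.
Variable H : nat -> T -> \bar R.
Hypothesis H0 : forall k w, (0 <= H k w)%E.
Hypothesis mH : forall k, measurable_fun [set: history k] (H k : history k -> \bar R).

Lemma rule_time_ge0 w : (0 <= rule_time H w)%E.
Proof.
case: (rule_timeP H w) => [[k [_ _ ->]]|[_ ->]]; last by rewrite leey.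
by rewrite adde_ge0 // lee_fin; exact: (jump_ge0 hX).
Qed.

Lemma history_deadline k :
  measurable_fun [set: history k] (fun w : history k => ((J k w)%:E + H k w)%E).
Proof.
apply: emeasurable_funD => //; apply/measurable_EFinP.
exact: (history_jump (leqnn k)).
Qed.

Lemma history_stops k : jump_history X J k.+1 [set w | stops H w k].
Proof.
have mJ : measurable_fun [set: history k.+1] (fun w : history k.+1 => (J k.+1 w)%:E).
  by apply/measurable_EFinP; exact: (history_jump (leqnn k.+1)).
have mD : measurable_fun [set: history k.+1]
    (fun w : history k.+1 => ((J k w)%:E + H k w)%E).
  move=> _ B mB; rewrite setTI; apply: (history_mono (leqnSn k)).
  by rewrite -[X in _ X]setTI; exact: (history_deadline (@measurableT _ _) mB).
have := @measurable_lee_fun R _ (history k.+1) _ _ mJ mD.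
move=> /(@measurableC _ (history k.+1)).
rewrite (_ : ~` _ = [set w | stops H w k]) //.
by apply/seteqP; split=> w /=; rewrite /stops ltNge => /negP.
Qed.

(** If the deadline J k + H k is at most t, the rule fails to stop there only
    because the next jump comes first, hence by t: both events are visible at
    t. *)
Lemma rule_time_adapted (t : R) : 0 <= t ->
  natural_filtration X t [set w | (rule_time H w <= t%:E)%E].
Proof.
move=> t0.
pose nostop k := [set w | forall m, (m < k)%N -> ~~ stops H w m].
have hno k : jump_history X J k (nostop k).
  rewrite (_ : nostop k =
      \bigcap_m (if (m < k)%N then ~` [set w | stops H w m] else setT)).
    apply: (@bigcapT_measurable _ (history k)) => m.
    case: ifP => mk; last exact: (@measurableT _ (history k)).
    apply: (@measurableC _ (history k)); apply: (history_mono mk); exact: history_stops.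
  apply/seteqP; split=> w /= h m => [_|mk].
    by case: ifP => //= mk; apply/negP; exact: h.
  by apply/negP; have := h m I; rewrite mk.
pose E k := nostop k `&` [set w | ((J k w)%:E + H k w <= t%:E)%E].
have hE k : jump_history X J k (E k).
  apply: (@measurableI _ (history k)); first exact: hno.
  exact: (@measurable_lee_fun R _ (history k) _ _ (@history_deadline k)
    (@measurable_cst _ _ _ _ _ t%:E)).
rewrite (_ : [set w | _] = \bigcup_k ((E k `&` [set w | J k w <= t]) `\`
   ((E k `&` ~` [set w | stops H w k]) `&` [set w | J k.+1 w <= t]))).
  apply: (@bigcupT_measurable _ (past t)) => k; apply: (@measurableD _ (past t)).
    exact: (past_history hX t0 (hE k)).
  apply: (past_history hX t0); apply: (@measurableI _ (history k.+1)).
    exact: (history_mono (leqnSn k)).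
  by apply: (@measurableC _ (history k.+1)); exact: history_stops.
have deadline_ge k w : ((J k w)%:E + H k w <= t%:E)%E -> J k w <= t.
  by move=> h; rewrite -lee_fin; apply: le_trans h; rewrite leeDl.
apply/seteqP; split=> w /=.
  case: (rule_timeP H w) => [[k [sk nk ->]] h|[_ ->]]; last by rewrite leye_eq.
  by exists k => //=; split; [split => //; exact: deadline_ge|move=> [[_]]].
move=> [k _ [[[nk h] Jt] ns]].
have sk : stops H w k.
  apply: contrapT => nsk; apply: ns; split; first by split.
  rewrite /= -lee_fin; apply: le_trans h.
  by move: nsk => /negP; rewrite /stops -leNgt.
by rewrite /= (rule_time_first sk nk).
Qed.

Lemma rule_stopping_time : (forall i, P i [set w | (rule_time H w < +oo)%E] = 1%E) ->
  stopping_time P X (rule_time H).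
Proof.
by move=> fin; split => //; [exact: rule_time_ge0|exact: rule_time_adapted].
Qed.

End Adapted.

(** The reward f (date, state) collected by the rule H from the k-th jump on,
    if it is stopped after n more jumps and if the clock shows t at date 0. *)
Fixpoint pay (f : R -> S -> \bar R) (t : R) (H : nat -> T -> \bar R) (n k : nat) (w : T)
    : \bar R :=
  if n is m.+1 then
    if stops H w k then f (t + (J k w + fine (H k w))) (Z k w) else pay f t H m k.+1 w
  else f (t + J k w) (Z k w).

Lemma rule_time_ge_jump H N w : (forall k w, (0 <= H k w)%E) ->
  (forall m, (m < N)%N -> ~~ stops H w m) -> ((J N w)%:E <= rule_time H w)%E.
Proof.
move=> H0 nN; case: (rule_timeP H w) => [[k [sk nk ->]]|[_ ->]]; last by rewrite leey.
have Nk : (N <= k)%N by rewrite leqNgt; apply/negP => /nN; rewrite sk.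
apply: (@le_trans _ _ (J k w)%:E); first by rewrite lee_fin; exact: (jump_le hX).
by rewrite leeDl.
Qed.

(** Between the last jump and the stop the chain does not move. *)
Lemma pay_stopped f t H N w : (forall k w, (0 <= H k w)%E) ->
  let s := fine (Order.min (rule_time H w) (J N w)%:E) in
  f (t + s) (X s w) = pay f t H N 0 w.
Proof.
move=> H0 s.
suff gen n k : (forall m, (m < k)%N -> ~~ stops H w m) -> (n + k)%N = N ->
    pay f t H n k w = f (t + s) (X s w) by rewrite -(gen N 0%N) ?addn0.
elim: n k => [|n IH] k nk nkN.
  rewrite add0n in nkN; subst k.
  rewrite /= /s (_ : Order.min _ _ = (J N w)%:E) //; apply: min_r.
  exact: rule_time_ge_jump.
rewrite /=; case: ifPn => sk; last first.
  apply: IH; last by rewrite addnS -addSn.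
  by move=> m; rewrite ltnS leq_eqVlt => /orP[/eqP -> //|]; exact: nk.
have tE := rule_time_first sk nk.
have Hfin : H k w \is a fin_num.
  rewrite ge0_fin_numE //; move: sk; rewrite /stops; case: (H k w) (H0 k w) => [x| |] // _.
  by rewrite ltry.
have HE : H k w = (fine (H k w))%:E by rewrite fineK.
have sE : s = J k w + fine (H k w).
  rewrite /s tE min_l; first by rewrite HE.
  apply: ltW; apply: (lt_le_trans sk); rewrite lee_fin; apply: (jump_le hX).
  by rewrite -nkN addSn ltnS leq_addl.
rewrite sE; congr f; rewrite /embedded; apply/esym; apply: (jump_constant hX).
rewrite lerDl fine_ge0 //=.
by move: sk; rewrite /stops {1}HE -EFinD lte_fin.
Qed.

Lemma rule_time_le_jump H N w : (forall k w, (0 <= H k w)%E) -> H N w = 0%E ->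
  Order.min (rule_time H w) (J N w)%:E = rule_time H w.
Proof.
move=> H0 HN; apply: min_l.
have sN : stops H w N by rewrite /stops HN adde0 lte_fin; exact: (jump_lt hX).
case: (rule_timeP H w) => [[k [sk nk ->]]|[ns _]]; last by move: (ns N); rewrite sN.
have kN : (k <= N)%N by rewrite leqNgt; apply/negP => /nk; rewrite sN.
move: kN; rewrite leq_eqVlt => /orP[/eqP ->|kN]; first by rewrite HN adde0.
by apply: ltW; apply: (lt_le_trans sk); rewrite lee_fin; exact: (jump_le hX).
Qed.

End Rules.

(** * Expected rewards by backward induction *)

Section Reward.
Local Open Scope ereal_scope.
Context {R : realType} {S : countType} (q : S -> S -> R).
Hypothesis hq : intensity_matrix q.
Local Notation mu := (@lebesgue_measure R).
Local Notation jump_int := (jump_int q).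

(** Rules defined at negative dates as well, which saves conditions on
    dates. *)
Definition total_rule (h : nat -> R -> S -> \bar R) : Prop :=
  (forall k i, measurable_fun [set: R] (h k ^~ i)) /\ (forall k t i, 0 <= h k t i).

Definition stop_reward (f : R -> S -> \bar R) (i : S) (t : R) (x : \bar R) : \bar R :=
  if x is r%:E then f (t + r)%R i * (expR (- (rate q i * r)))%:E else 0.

(** The expectation of pay, in terms of the date and the state, for the rule h
    k, h k.+1, and so on; pay_reward makes the link. *)
Fixpoint reward (f : R -> S -> \bar R) (h : nat -> R -> S -> \bar R) (n k : nat)
    (t : R) (i : S) : \bar R :=
  if n is m.+1 then
    stop_reward f i t (h k t i) + jump_int i (reward f h m k.+1) t (upto (h k t i))
  else f t i.

Variable f : R -> S -> \bar R.
Hypotheses (mf : forall i, measurable_fun [set: R] (f^~ i)) (f0 : forall t i, 0 <= f t i).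

Lemma stop_reward_ge0 i t x : 0 <= stop_reward f i t x.
Proof. by case: x => [r| |] //=; rewrite mule_ge0 // lee_fin expR_ge0. Qed.

Lemma measurable_stop_reward i (h : R -> \bar R) : measurable_fun [set: R] h ->
  (forall t, 0 <= h t) -> measurable_fun [set: R] (fun t => stop_reward f i t (h t)).
Proof.
move=> mh h0.
have mfine : measurable_fun [set: R] (fun t => fine (h t)).
  exact: measurableT_comp mh.
pose D := ~` (h @^-1` [set +oo]).
have mD : measurable D.
  apply: measurableC; rewrite -[X in measurable X]setTI; apply: mh => //.
apply: (@eq_measurable_fun _ _ _ _ _ (fun t => (\1_D t)%:E *
   (f (t + fine (h t))%R i * (expR (- (rate q i * fine (h t))))%:E))).
  move=> t _; rewrite indicE; case E : (h t) (h0 t) => [r| |] // _.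
    by rewrite mem_set ?mul1e // /D /= E.
  by rewrite memNset ?mul0e // /D /= => /(_ E).
apply: emeasurable_funM; first by apply/measurable_EFinP; exact: measurable_indic.
apply: emeasurable_funM; last exact: (measurableT_comp (measurable_expR_rate q i) mfine).
by apply: (measurableT_comp (mf i)); exact: measurable_funD.
Qed.

Lemma reward_ge0 h n k t i : 0 <= reward f h n k t i.
Proof.
elim: n k t i => [|n IH] k t i //=.
by rewrite adde_ge0 ?stop_reward_ge0 //; apply: jump_int_ge0.
Qed.

Lemma measurable_reward h n k i : total_rule h ->
  measurable_fun [set: R] (reward f h n k ^~ i).
Proof.
move=> [mh h0]; elim: n k i => [|n IH] k i //=.
apply: emeasurable_funD; first exact: measurable_stop_reward.
by apply: measurable_jump_int => // *; exact: reward_ge0.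
Qed.

Lemma jump_sum_cste i (a : \bar R) : 0 <= a -> jump_sum q i (fun=> a) = a * (rate q i)%:E.
Proof.
case: a => [a| |] // a0; first by rewrite jump_sum_cst // EFinM.
rewrite gt0_mulye ?lte_fin; last exact: rate_gt0.
have [j ji qj] := exists_jump hq i.
apply/eqP; rewrite -leye_eq.
have := @jump_sum_ge_term _ _ _ hq i (fun=> +oo) j (fun=> a0).
by rewrite /jump_weight ji gt0_muley ?lte_fin.
Qed.

(** The holding time exceeds the waiting time x with probability e^(-q_l x),
    and otherwise the jump is waited for. *)
Lemma wait_integral l (a : \bar R) (b : R -> S -> \bar R) (x : \bar R) :
  0 <= x -> 0 <= a -> (forall s j, 0 <= b s j) ->
  (forall j, measurable_fun [set: R] (b^~ j)) ->
  \int[mu]_(s in `[0%R, +oo[%classic) ((expR (- (rate q l * s)))%:E *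
      jump_sum q l (fun j => if x < s%:E then a else b s j)) =
  (if x is r%:E then a * (expR (- (rate q l * r)))%:E else 0) +
  \int[mu]_(s in upto x) ((expR (- (rate q l * s)))%:E * jump_sum q l (b s)).
Proof.
case: x => [r| |] // x0 a0 b0 mb; last first.
  by rewrite upto_oo add0e; apply: eq_integral => s _.
rewrite upto_fin; rewrite lee_fin in x0.
have mI (c : R -> S -> \bar R) D : (forall j, measurable_fun [set: R] (c^~ j)) ->
    (forall s j, 0 <= c s j) -> measurable_fun D
    (fun s => (expR (- (rate q l * s)))%:E * jump_sum q l (c s)).
  move=> mc c0; apply: measurable_funTS; apply: emeasurable_funM.
    exact: measurable_expR_rate.
  exact: measurable_jump_sum.
have I0 (c : R -> S -> \bar R) s : (forall s j, 0 <= c s j) ->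
    0 <= (expR (- (rate q l * s)))%:E * jump_sum q l (c s).
  by move=> c0; rewrite mule_ge0 ?lee_fin ?expR_ge0 //; exact: jump_sum_ge0.
have c0 s j : 0 <= (if r%:E < s%:E then a else b s j) by case: ifP.
have mc j : measurable_fun [set: R] (fun s => if r%:E < s%:E then a else b s j).
  apply: measurable_fun_ifT => //.
  apply: (measurable_fun_bool true).
  rewrite setTI (_ : _ @^-1` _ = `]r, +oo[%classic) //.
  by apply/seteqP; split=> s /=; rewrite in_itv /= andbT lte_fin.
rewrite (_ : `[0%R, +oo[%classic = `[0%R, r]%classic `|` `]r, +oo[%classic); last first.
  apply/seteqP; split=> s /=; rewrite !in_itv /= !andbT.
    by move=> s0; case: (leP s r) => sr; [left; rewrite s0|right].
  by move=> [/andP[]//|rs]; apply: (le_trans x0); exact: ltW.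
rewrite ge0_integral_setU //; last 3 first.
- exact: (mI (fun s j => if r%:E < s%:E then a else b s j)).
- by move=> s _; exact: (I0 (fun s j => if r%:E < s%:E then a else b s j)).
- by apply/disj_setPS => s [] /=; rewrite !in_itv /= !andbT => /andP[_ h] h2; move: h; rewrite leNgt h2.
rewrite addeC; congr (_ + _).
  transitivity (\int[mu]_(s in `]r, +oo[%classic)
      (a * (rate q l * expR (- (rate q l * s)))%:E)).
    apply: eq_integral => s; rewrite inE /= in_itv /= andbT => rs.
    rewrite (_ : jump_sum _ _ _ = a * (rate q l)%:E); last first.
      rewrite -jump_sum_cste //; congr (jump_sum _ _ _); apply/funext => j.
      by rewrite lte_fin rs.
    by rewrite muleCA -EFinM mulrC.
  have mexp (D : set R) : measurable_fun D
      (fun s => (rate q l * expR (- (rate q l * s)))%:E).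
    apply: measurable_funTS; apply/measurable_EFinP; apply: measurable_funM => //.
    by apply/measurable_EFinP; exact: measurable_expR_rate.
  rewrite ge0_integralZl //; last 2 first.
  - exact: mexp.
  - by move=> s _; rewrite lee_fin mulr_ge0 ?expR_ge0 // ltW // rate_gt0.
  rewrite integral_itv_obnd_cbnd // integral_exp_tail //.
  exact: rate_gt0.
apply: eq_integral => s; rewrite inE /= in_itv /= => /andP[_ sr].
congr (_ * jump_sum _ _ _); apply/funext => j.
by rewrite lte_fin ltNge sr.
Qed.

End Reward.

Section Tower.
Local Open Scope ereal_scope.
Context {R : realType} {S : countType} {d : measure_display}
  {T : measurableType d} (P : S -> probability T R) (X : R -> T -> S)
  (J : nat -> T -> R) (q : S -> S -> R).
Hypotheses (hX : markov_chain P X J q) (hq : intensity_matrix q).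
Local Notation Z := (embedded X J).
Local Notation mu := (@lebesgue_measure R).

Definition rule_of (h : nat -> R -> S -> \bar R) (t : R) (k : nat) (w : T) : \bar R :=
  h k (t + J k w)%R (Z k w).

Lemma measurable_rule_of (d' : measure_display) (T' : measurableType d')
    (Y : T' -> R) (Z' : T' -> S) h t k : total_rule h ->
  measurable_fun [set: T'] Y -> (forall j, measurable (Z' @^-1` [set j])) ->
  measurable_fun [set: T'] (fun w => h k (t + Y w)%R (Z' w)).
Proof.
move=> [mh h0] mY mZ; apply: (@measurable_select _ _ _ _ Z' (fun j w => h k (t + Y w)%R j)).
  exact: mZ.
move=> j; apply: (measurableT_comp (mh k j)).
exact: measurable_funD.
Qed.

Lemma history_rule_of h t k k' : total_rule h -> (k <= k')%N ->
  measurable_fun [set: g_sigma_algebraType (history_events X J k')]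
    (rule_of h t k : g_sigma_algebraType (history_events X J k') -> \bar R).
Proof.
move=> hh kk'.
apply: (@measurable_rule_of _ (g_sigma_algebraType (history_events X J k')) (J k) (Z k)) => //.
  exact: (history_jump kk').
by move=> j; exact: (@history_embedded _ _ _ _ X J k' k [set j] kk').
Qed.

Section Pay.
Variable f : R -> S -> \bar R.
Hypotheses (mf : forall i, measurable_fun [set: R] (f^~ i)) (f0 : forall t i, 0 <= f t i).

Lemma pay_ge0 t H n k w : 0 <= pay X J f t H n k w.
Proof. by elim: n k => [|n IH] k //=; case: ifP. Qed.

Lemma measurable_clock_state t (Y : T -> R) k : measurable_fun [set: T] Y ->
  measurable_fun [set: T] (fun w => f (t + Y w)%R (Z k w)).
Proof.
move=> mY; apply: (@measurable_select _ _ _ _ (Z k) (fun j w => f (t + Y w)%R j)).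
  exact: (measurable_embedded1 hX).
by move=> j; apply: (measurableT_comp (mf j)); exact: measurable_funD.
Qed.

Lemma measurable_stops (H : nat -> T -> \bar R) k : measurable_fun [set: T] (H k) ->
  measurable [set w | stops J H w k].
Proof.
move=> mH.
have mJ n : measurable_fun [set: T] (fun w => (J n w)%:E).
  by apply/measurable_EFinP; exact: (measurable_jump hX).
have mS : measurable_fun [set: T] (fun w => (J k w)%:E + H k w).
  exact: emeasurable_funD.
have := measurableC (measurable_lee_fun (mJ k.+1) mS).
rewrite (_ : ~` _ = [set w | stops J H w k]) //.
by apply/seteqP; split=> w /=; rewrite /stops ltNge => /negP.
Qed.

Lemma measurable_pay t (H : nat -> T -> \bar R) n k :
  (forall k, measurable_fun [set: T] (H k)) ->
  measurable_fun [set: T] (pay X J f t H n k).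
Proof.
move=> mH; elim: n k => [|n IH] k /=.
  by apply: measurable_clock_state; exact: (measurable_jump hX).
apply: measurable_fun_ifT => //.
  apply: (measurable_fun_bool true); rewrite setTI.
  exact: measurable_stops.
apply: (@measurable_clock_state t (fun w => J k w + fine (H k w))%R k).
apply: measurable_funD; first exact: (measurable_jump hX).
exact: measurableT_comp (mH k).
Qed.

Lemma ge0_integral_setID (mP : {measure set T -> \bar R}) (A C : set T) (F : T -> \bar R) :
  measurable A -> measurable C -> measurable_fun [set: T] F -> (forall w, 0 <= F w) ->
  \int[mP]_(w in A) F w = \int[mP]_(w in A `&` C) F w + \int[mP]_(w in A `\` C) F w.
Proof.
move=> mA mC mF F0; rewrite -ge0_integral_setU //.
- by rewrite setUIDK.
- exact: measurableI.
- exact: measurableD.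
- exact: measurable_funTS.
- by apply/disj_setPS => w [] /= [_ ?] [].
Qed.

Lemma measurable_history_rule h t k : total_rule h ->
  measurable_fun [set: T] (rule_of h t k).
Proof.
move=> hh; apply: measurable_rule_of => //; first exact: (measurable_jump hX).
exact: (measurable_embedded1 hX).
Qed.

Lemma history_rule_stops h t k : total_rule h ->
  jump_history X J k.+1 [set w | stops J (rule_of h t) w k].
Proof.
by move=> hh; apply: history_stops => // m; exact: (history_rule_of t hh (leqnn m)).
Qed.

Lemma measurable_at_jump (D : R -> S -> \bar R) t k :
  (forall i, measurable_fun [set: R] (D^~ i)) ->
  measurable_fun [set: T] (fun w => D (t + J k w)%R (Z k w)).
Proof.
move=> mD; apply: (@measurable_select _ _ _ _ (Z k) (fun j w => D (t + J k w)%R j)).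
  exact: (measurable_embedded1 hX).
move=> j; apply: (@measurableT_comp _ _ _ _ _ _ (D ^~ j)); first exact: mD.
by apply: measurable_funD => //; exact: (measurable_jump hX).
Qed.

(** What is collected if the continuation after the next jump is worth D. *)
Definition first_step_pay (D : R -> S -> \bar R) h t k w : \bar R :=
  if stops J (rule_of h t) w k then f (t + (J k w + fine (rule_of h t k w)))%R (Z k w)
  else D (t + J k.+1 w)%R (Z k.+1 w).

Lemma measurable_first_step_pay D h t k : total_rule h ->
  (forall i, measurable_fun [set: R] (D^~ i)) ->
  measurable_fun [set: T] (first_step_pay D h t k).
Proof.
move=> hh mD; apply: measurable_fun_ifT.
- apply: (measurable_fun_bool true); rewrite setTI.
  by apply: measurable_stops; exact: measurable_history_rule.
- apply: (@measurable_clock_state t (fun w => J k w + fine (rule_of h t k w))%R k).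
  apply: measurable_funD; first exact: (measurable_jump hX).
  exact: measurableT_comp (measurable_history_rule t k hh).
- exact: measurable_at_jump.
Qed.

(** Conditionally on the past, one_step_integral and wait_integral compute the
    expectation. *)
Lemma first_step i D h t k (A : set T) : total_rule h ->
  (forall i, measurable_fun [set: R] (D^~ i)) -> (forall t i, 0 <= D t i) ->
  jump_history X J k A ->
  \int[P i]_(w in A) first_step_pay D h t k w =
  \int[P i]_(w in A) (fun r j => stop_reward q f j r (h k r j) +
     jump_int q j D r (upto (h k r j))) (t + J k w)%R (Z k w).
Proof.
move=> hh mD D0 hA; have [mh h0] := hh.
have mA := history_measurable hX hA.
have fs0 w : 0 <= first_step_pay D h t k w by rewrite /first_step_pay; case: ifP.
have mfs := measurable_first_step_pay t k hh mD.
have rhs0 r j : 0 <= stop_reward q f j r (h k r j) + jump_int q j D r (upto (h k r j)).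
  by rewrite adde_ge0 ?stop_reward_ge0 //; apply: jump_int_ge0.
have mrhs j : measurable_fun [set: R]
    (fun r => stop_reward q f j r (h k r j) + jump_int q j D r (upto (h k r j))).
  apply: emeasurable_funD; first exact: measurable_stop_reward.
  by apply: measurable_jump_int.
rewrite (@integral_fibers _ _ _ _ _ _ (Z k)) //; last exact: (measurable_embedded1 hX).
rewrite [RHS](@integral_fibers _ _ _ _ _ _ (Z k)) //; last 2 first.
- exact: (measurable_embedded1 hX).
- exact: (measurable_at_jump t k mrhs).
apply: eq_esum => l _.
set E := A `&` _.
pose G (j : S) (x : R * R) : \bar R :=
  if h k (t + x.1)%R l < x.2%:E then f (t + (x.1 + fine (h k (t + x.1)%R l)))%R l
  else D (t + (x.1 + x.2))%R j.
have G0 j x : 0 <= G j x by rewrite /G; case: ifP.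
have mh1 : measurable_fun [set: R * R] (fun x => h k (t + x.1)%R l).
  apply: (@measurableT_comp _ _ _ _ _ _ (h k ^~ l)); first exact: mh.
  by apply: measurable_funD => //; exact: measurable_fst.
have mG j : measurable_fun [set: R * R] (G j).
  apply: measurable_fun_ifT.
  - apply: (measurable_fun_bool true); rewrite setTI.
    have m2 : measurable_fun [set: R * R] (fun x => x.2%:E).
      by apply/measurable_EFinP; exact: measurable_snd.
    have := measurableC (measurable_lee_fun m2 mh1).
    rewrite (_ : ~` _ = (fun x : R * R => h k (t + x.1)%R l < x.2%:E) @^-1` [set true]) //.
    by apply/seteqP; split=> x /=; rewrite ltNge => /negP.
  - apply: (@measurableT_comp _ _ _ _ _ _ (f ^~ l)); first exact: mf.
    apply: measurable_funD => //; apply: measurable_funD; first exact: measurable_fst.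
    exact: measurableT_comp mh1.
  - apply: (@measurableT_comp _ _ _ _ _ _ (D ^~ j)); first exact: mD.
    apply: measurable_funD => //.
    by apply: measurable_funD; [exact: measurable_fst|exact: measurable_snd].
have stopsE w : E w -> stops J (rule_of h t) w k =
    (h k (t + J k w)%R l < (holding J k w)%:E).
  move=> [_ /= Zl]; rewrite /stops /rule_of Zl /holding.
  case: (h k _ l) (h0 k (t + J k w)%R l) => [r| |] // _.
  by rewrite -EFinD !lte_fin; apply/idP/idP => ?; lra.
have JE w : (J k w + holding J k w = J k.+1 w)%R by rewrite /holding; lra.
transitivity (\int[P i]_(w in E) G (Z k.+1 w) (J k w, holding J k w)).
  apply: eq_integral => w /set_mem Ew.
  rewrite /first_step_pay /G /= -stopsE //; case: ifP => _; last by rewrite JE.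
  by move: Ew => [_ /= Zl]; rewrite /rule_of Zl.
rewrite /E (one_step_integral hX hq i l hA mG G0).
apply: eq_integral => w /set_mem [_ /= Zl]; rewrite Zl.
rewrite /G /= (@wait_integral _ _ q hq l (f (t + (J k w + fine (h k (t + J k w)%R l)))%R l)
   (fun s j => D (t + (J k w + s))%R j) (h k (t + J k w)%R l)) //; last first.
  move=> j; apply: (@measurableT_comp _ _ _ _ _ _ (D ^~ j)); first exact: mD.
  by apply: measurable_funD => //; exact: measurable_funD.
congr (_ + _).
  by rewrite /stop_reward; case: (h k _ l) => [r| |] //=; rewrite addrA.
by rewrite /jump_int; apply: eq_integral => s _; rewrite addrA.
Qed.

(** Backward induction with first_step: a rule that has not stopped before the
    next jump starts again there, with one jump less to go. *)
Lemma pay_reward i h t n k (A : set T) : total_rule h -> jump_history X J k A ->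
  \int[P i]_(w in A) pay X J f t (rule_of h t) n k w =
  \int[P i]_(w in A) reward q f h n k (t + J k w)%R (Z k w).
Proof.
move=> hh; have mH m := measurable_history_rule t m hh.
elim: n k A => [|n IH] k A hA //.
have mA := history_measurable hX hA.
have hC := @history_rule_stops h t k hh; have mC := history_measurable hX hC.
have mr j := measurable_reward hq mf f0 n k.+1 j hh.
have r0 s j := reward_ge0 hq f0 h n k.+1 s j.
rewrite -(first_step i t hh mr r0 hA) (ge0_integral_setID _ mA mC); last 2 first.
- exact: measurable_pay.
- by move=> w; exact: pay_ge0.
rewrite [RHS](ge0_integral_setID _ mA mC); last 2 first.
- exact: measurable_first_step_pay.
- by move=> w; rewrite /first_step_pay; case: ifP.
congr (_ + _).
  apply: eq_integral => w /set_mem [_ Cw].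
  by rewrite /first_step_pay /= (_ : stops _ _ _ _ = true).
transitivity (\int[P i]_(w in A `\` [set w | stops J (rule_of h t) w k])
    pay X J f t (rule_of h t) n k.+1 w).
  apply: eq_integral => w /set_mem [_ Cw] /=.
  by rewrite (_ : stops _ _ _ _ = false) //; apply/negP.
rewrite IH; last first.
  apply: (@measurableD _ (g_sigma_algebraType (history_events X J k.+1))) => //.
  exact: (history_mono (leqnSn k)).
apply: eq_integral => w /set_mem [_ Cw].
by rewrite /first_step_pay (_ : stops _ _ _ _ = false) //; apply/negP.
Qed.

End Pay.
End Tower.

(** * Expected payoffs of bounded rules *)

Section SignedJump.
Local Open Scope ereal_scope.
Context {R : realType} {S : countType} (q : S -> S -> R).
Hypothesis hq : intensity_matrix q.
Variables (a b : R -> S -> \bar R).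
Hypotheses (ma : forall j, measurable_fun [set: R] (a^~ j))
  (mb : forall j, measurable_fun [set: R] (b^~ j)).
Hypotheses (a0 : forall t j, 0 <= a t j) (b0 : forall t j, 0 <= b t j).
Let W t j := a t j - b t j.

Lemma jump_int_pos_le i t (D : set R) : measurable D ->
  jump_int q i (pos_part W) t D <= jump_int q i a t D.
Proof.
move=> mD; apply: (le_jump_int hq) => //.
- by move=> j; apply: measurable_epos; exact: emeasurable_funB.
- by move=> s j; exact: epos_ge0.
- by move=> s j _; apply: maxe_sub_le.
Qed.

(** The functions a and b exceed the positive and the negative part of a - b
    by a common function, which cancels as soon as the integral of a is
    finite. *)
Lemma jump_int_sub i t (D : set R) : measurable D -> jump_int q i a t D < +oo ->
  jump_int q i (pos_part W) t D - jump_int q i (neg_part W) t D =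
  jump_int q i a t D - jump_int q i b t D.
Proof.
move=> mD afin.
have mp j : measurable_fun [set: R] (fun s => pos_part W s j).
  by apply: measurable_epos; exact: emeasurable_funB.
have mn j : measurable_fun [set: R] (fun s => neg_part W s j).
  by apply: measurable_eneg; exact: emeasurable_funB.
have p0 s j : 0 <= pos_part W s j by exact: epos_ge0.
have n0 s j : 0 <= neg_part W s j by exact: eneg_ge0.
apply: sube_of_addeE => //; try exact: jump_int_ge0.
  exact: jump_int_pos_le.
have H f g := @jump_intD _ _ q hq i f g t D mD.
apply: (etrans (esym (H (pos_part W) b mp mb p0 b0))).
apply: (etrans _ (H a (neg_part W) ma mn a0 n0)).
apply: (congr1 (fun f => jump_int q i f t D)).
by apply/funext => s; apply/funext => j; exact: pos_neg_partsD.
Qed.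

End SignedJump.

Lemma integral_prob_cst {R : realType} {d : measure_display} {T : measurableType d}
  (mu : probability T R) (x : \bar R) : (\int[mu]_w x = x)%E.
Proof.
have h : mu setT = 1%E by exact: probability_setT.
rewrite integral_cst //.
by transitivity (x * 1)%E; [congr (_ * _)%E; exact: h|rewrite mule1].
Qed.

Section Payoffs.
Local Open Scope ereal_scope.
Context {R : realType} {S : countType} {d : measure_display}
  {T : measurableType d} (P : S -> probability T R) (X : R -> T -> S)
  (J : nat -> T -> R) (q : S -> S -> R) (g : S -> R) (c : R)
  (dom : set R) (u : R -> R).
Hypotheses (hq : intensity_matrix q) (hX : markov_chain P X J q) (hc : (0 < c)%R)
    (hu : is_utility g dom u) (hA1 : assumptionA1 P X g c).
Local Notation Z := (embedded X J).
Local Notation stop_value := (stop_value g c dom u).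
Local Notation payoff := (payoff X g c dom u).
Local Notation gain := (gain X g c).

(** U lies below an affine function, by utility_affine. *)
Lemma payoff_le_gain : exists b : R, (0 < b)%R /\ forall t, exists D : R,
  forall tau w, payoff t tau w <= D%:E + b%:E * gain tau w.
Proof.
have [A [b [b0 hA]]] := utility_affine hu.
exists b; split => // t; exists (A - b * (c * t))%R => tau w.
apply: (le_trans (hA _)); rewrite /Defs.gain -EFinM -EFinD lee_fin.
set s := fine (tau w); set x := g _.
have xm : (x <= Num.max x 0)%R by rewrite le_max lexx.
have : (b * x <= b * Num.max x 0)%R by rewrite ler_pM2l.
by lra.
Qed.

Section Bounds.
Variable i : S.
Local Notation measurable_gain tau := (measurable_fun [set: T] (gain tau)).
Local Notation measurable_payoff t tau := (measurable_fun [set: T] (payoff t tau)).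

Lemma payoff_pos_finite t tau : stopping_time P X tau -> measurable_gain tau ->
  measurable_payoff t tau -> \int[P i]_w epos (payoff t tau w) < +oo.
Proof.
move=> htau mg mp; have [b [b0 /(_ t) [D hD]]] := payoff_le_gain.
have [fin _] := hA1 i; have {}fin := fin _ htau.
have mgp : measurable_fun [set: T] (gain tau)^\+ by exact: measurable_funepos.
apply: (@le_lt_trans _ _ (\int[P i]_w (`|D|%:E + b%:E * (gain tau)^\+ w))).
  apply: ge0_le_integral => //.
  - by move=> w _; exact: epos_ge0.
  - exact: measurable_epos.
  - by apply: emeasurable_funD => //; exact: measurable_funeM.
  - move=> w _; rewrite /epos ge_max; apply/andP; split.
      apply: (le_trans (hD _ _)); apply: leeD; first by rewrite lee_fin ler_norm.
      apply: lee_wpmul2l; first by rewrite lee_fin ltW.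
      by rewrite funeposE le_max lexx.
    by rewrite adde_ge0 ?lee_fin // mule_ge0 // lee_fin ltW.
rewrite ge0_integralD //; last 2 first.
- by move=> w _; rewrite mule_ge0 // lee_fin ltW.
- exact: measurable_funeM.
rewrite integral_prob_cst ge0_integralZl //; last by rewrite lee_fin ltW.
by apply: lte_add_pinfty; rewrite ?ltry // lte_mul_pinfty // lee_fin ltW.
Qed.

(** assumptionA1 bounds the expected gains uniformly; payoff_le_gain carries
    this over to payoffs. *)
Lemma expected_payoff_bounded t : exists M : R, forall tau, stopping_time P X tau ->
  measurable_gain tau -> measurable_payoff t tau -> \int[P i]_w payoff t tau w <= M%:E.
Proof.
have [b [b0 /(_ t) [D hD]]] := payoff_le_gain.
have [fin supfin] := hA1 i.
have [s hs] : exists s : R, ereal_sup [set (\int[P i]_w gain tau w)%E |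
                tau in [set tau | stopping_time P X tau]] <= s%:E.
  case: (ereal_sup _) supfin => [x| |] // _; first by exists x.
  by exists 0%R; rewrite leNye.
exists (`|D| + b * s)%R => tau htau mg mp.
have {}fin := fin _ htau.
have gs : \int[P i]_w gain tau w <= s%:E.
  by apply: le_trans hs; apply: ereal_sup_ubound; exists tau.
have mgp : measurable_fun [set: T] (gain tau)^\+ by exact: measurable_funepos.
have mgn : measurable_fun [set: T] (gain tau)^\- by exact: measurable_funeneg.
pose a w := `|D|%:E + b%:E * (gain tau)^\+ w.
pose b' w := b%:E * (gain tau)^\- w.
have ma : measurable_fun [set: T] a.
  by apply: emeasurable_funD => //; exact: measurable_funeM.
have mb : measurable_fun [set: T] b' by exact: measurable_funeM.
have a0 w : 0 <= a w by rewrite adde_ge0 ?lee_fin // mule_ge0 // lee_fin ltW.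
have b'0 w : 0 <= b' w by rewrite mule_ge0 // lee_fin ltW.
have iaE : \int[P i]_w a w = `|D|%:E + b%:E * \int[P i]_w (gain tau)^\+ w.
  rewrite /a ge0_integralD //; last 2 first.
  - by move=> w _; rewrite mule_ge0 // lee_fin ltW.
  - exact: measurable_funeM.
  by rewrite integral_prob_cst ge0_integralZl // lee_fin ltW.
have ibE : \int[P i]_w b' w = b%:E * \int[P i]_w (gain tau)^\- w.
  by rewrite /b' ge0_integralZl // lee_fin ltW.
apply: (@le_trans _ _ (\int[P i]_w (a w - b' w))).
  apply: le_integral_parts => //; first exact: emeasurable_funB.
  move=> w _; apply: (le_trans (hD _ _)); rewrite /a /b' funeposE funenegE.
  rewrite /Defs.gain; move: (Num.max _ _ - _)%R => y.
  rewrite -!EFin_max -!EFinM -EFinB -EFinD lee_fin.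
  have : (D <= `|D|)%R by rewrite ler_norm.
  have : y = (Num.max y 0 - Num.max (- y) 0)%R.
    by case: (lerP y 0) => h1; case: (lerP (- y) 0) => h2; lra.
  by move: (Num.max y 0)%R (Num.max (- y) 0)%R => p n ->; lra.
have afin : \int[P i]_w a w < +oo.
  by rewrite iaE; apply: lte_add_pinfty; rewrite ?ltry // lte_mul_pinfty // lee_fin ltW.
rewrite integralB_ge0 // iaE ibE.
move: gs fin; rewrite integralE.
have := integral_ge0 (P i) (D := setT) (f := (gain tau)^\+) (fun x _ => funepos_ge0 _ x).
have := integral_ge0 (P i) (D := setT) (f := (gain tau)^\-) (fun x _ => funeneg_ge0 _ x).
case: (\int[P i]_w (gain tau)^\+ w) => [x| |] //;
case: (\int[P i]_w (gain tau)^\- w) => [y| |] // _ _; last first.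
  by move=> _ _; rewrite gt0_muley ?lte_fin //; rewrite -EFinM -EFinD addeNy leNye.
rewrite -EFinB lee_fin => h _; rewrite -!EFinM -EFinD lee_fin.
have : (b * (x - y) <= b * s)%R by rewrite ler_pM2l.
lra.
Qed.

End Bounds.

Lemma payoff_min_jump t (H : nat -> T -> \bar R) N w : (forall k w, 0 <= H k w) ->
  payoff t (fun w => Order.min (rule_time J H w) (J N w)%:E) w = pay X J stop_value t H N 0 w.
Proof. by move=> H0; rewrite -(pay_stopped hX _ _ _ _ H0). Qed.

(** The reward function for which pay computes gain. *)
Definition gain_value (t : R) (i : S) : \bar R := (Num.max (g i) 0 - c * t)%:E.

Lemma gain_min_jump (H : nat -> T -> \bar R) N w : (forall k w, 0 <= H k w) ->
  gain (fun w => Order.min (rule_time J H w) (J N w)%:E) w = pay X J gain_value 0 H N 0 w.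
Proof. by move=> H0; rewrite -(pay_stopped hX _ _ _ _ H0) /gain_value add0r. Qed.

Lemma measurable_gain_value i : measurable_fun [set: R] (gain_value ^~ i).
Proof.
apply/measurable_EFinP; apply: measurable_funB => //.
Qed.

Lemma pay_map (phi : \bar R -> \bar R) f t H n k w :
  phi (pay X J f t H n k w) = pay X J (fun t i => phi (f t i)) t H n k w.
Proof. by elim: n k => [|n IH] k //=; case: ifP. Qed.

Lemma eq_pay f t H H' n k w : (forall m, (m < k + n)%N -> H m w = H' m w) ->
  pay X J f t H n k w = pay X J f t H' n k w.
Proof.
elim: n k => [|n IH] k HH' //=.
have Hk : H k w = H' k w by apply: HH'; rewrite addnS ltnS leq_addr.
rewrite /stops Hk (IH k.+1) // => m mk; apply: HH'.
by rewrite addnS -addSn.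
Qed.

Lemma initial_state i (F : R -> S -> \bar R) :
  (forall j, measurable_fun [set: R] (F^~ j)) -> (forall t j, 0 <= F t j) ->
  \int[P i]_w F (J 0%N w) (Z 0 w) = F 0%R i.
Proof.
move=> mF F0.
have mZ : measurable (Z 0 @^-1` [set i]) by exact: (measurable_embedded1 hX).
have mFZ : measurable_fun [set: T] (fun w => F (J 0%N w) (Z 0 w)).
  apply: (@measurable_select _ _ _ _ (Z 0) (fun j w => F (J 0%N w) j)).
    exact: (measurable_embedded1 hX).
  by move=> j; apply: (measurableT_comp (mF j)); exact: (measurable_jump hX).
have PZ : P i (Z 0 @^-1` [set i]) = 1.
  rewrite -(chain_init hX i); congr (P i _); apply/seteqP.
  by split=> w /=; rewrite /embedded (jump0 hX).
have PC : P i (~` (Z 0 @^-1` [set i])) = 0.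
  by rewrite probability_setC // PZ subee.
rewrite (ge0_integral_setID _ measurableT mZ) // setTI setTD.
rewrite [X in _ + X]null_set_integral; last 3 first.
- exact: measurableC.
- by apply/measurable_funTS.
- exact: PC.
rewrite adde0 (eq_integral (cst (F 0%R i))); last first.
  by move=> w /set_mem /= Zi; rewrite Zi (jump0 hX).
rewrite integral_cst //.
by transitivity (F 0%R i * 1); [congr (_ * _); exact: PZ|rewrite mule1].
Qed.

Definition reward_pos := reward q (fun t i => epos (stop_value t i)).
Definition reward_neg := reward q (fun t i => eneg (stop_value t i)).
(** reward_pos and reward_neg are the expected positive and negative parts of
    the payoff; expected_payoff shows that their difference is the expected
    payoff. *)
Definition rule_value (h : nat -> R -> S -> \bar R) n k t i : \bar R :=
  reward_pos h n k t i - reward_neg h n k t i.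

Lemma reward_posE h n k :
  reward_pos h n k = reward q (fun t i => epos (stop_value t i)) h n k.
Proof. by []. Qed.

Lemma rule_valueE h n k t i : rule_value h n k t i =
  reward q (fun t i => epos (stop_value t i)) h n k t i -
  reward q (fun t i => eneg (stop_value t i)) h n k t i.
Proof. by []. Qed.

Let msp i : measurable_fun [set: R] (fun t => epos (stop_value t i)).
Proof. by apply: measurable_epos; exact: (measurable_stop_value hc hu). Qed.
Let msn i : measurable_fun [set: R] (fun t => eneg (stop_value t i)).
Proof. by apply: measurable_eneg; exact: (measurable_stop_value hc hu). Qed.
Let sp0 t i : 0 <= epos (stop_value t i). Proof. exact: epos_ge0. Qed.
Let sn0 t i : 0 <= eneg (stop_value t i). Proof. exact: eneg_ge0. Qed.

Lemma rule_of_ge0 h t k w : total_rule h -> 0 <= rule_of X J h t k w.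
Proof. by move=> [_ h0]; exact: h0. Qed.

Lemma expected_pay i f h t n : total_rule h ->
  (forall i, measurable_fun [set: R] (f^~ i)) -> (forall t i, 0 <= f t i) ->
  \int[P i]_w pay X J f t (rule_of X J h t) n 0 w = reward q f h n 0 t i.
Proof.
move=> hh mf f0.
rewrite (pay_reward hX hq mf f0 i t n (k := 0) hh); last first.
  exact: (@measurableT _ (g_sigma_algebraType (history_events X J 0))).
rewrite (@initial_state i (fun r j => reward q f h n 0 (t + r)%R j)) ?addr0 //.
- move=> j; apply: (measurableT_comp (measurable_reward hq mf f0 n 0 j hh)).
  exact: measurable_addr.
- by move=> *; exact: reward_ge0.
Qed.

Lemma expected_payoff i h t n : total_rule h ->
  \int[P i]_w payoff t (fun w => Order.min (rule_time J (rule_of X J h t) w) (J n w)%:E) w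
  = rule_value h n 0 t i.
Proof.
move=> hh; have H0 k w := rule_of_ge0 t k w hh.
rewrite integralE /rule_value /reward_pos /reward_neg -!expected_pay //.
congr (_ - _); apply: eq_integral => w _.
- by rewrite funeposE payoff_min_jump // -(pay_map epos).
- by rewrite funenegE payoff_min_jump // -(pay_map eneg).
Qed.

Lemma eq_reward f h h' n k k' t i :
  (forall m, (m < n)%N -> forall r j, h (k + m)%N r j = h' (k' + m)%N r j) ->
  reward q f h n k t i = reward q f h' n k' t i.
Proof.
elim: n k k' t i => [//|n IH] k k' t i hh'; rewrite [LHS]/= [RHS]/=.
have := hh' 0%N isT t i; rewrite !addn0 => ->.
suff -> : reward q f h n k.+1 = reward q f h' n k'.+1 by [].
apply/funext => r; apply/funext => j.
by apply: IH => m mn r' j'; rewrite !addSnnS; apply: hh'.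
Qed.

Lemma bounded_rule_stopping_time h t n : total_rule h -> (forall r j, h n r j = 0) ->
  stopping_time P X (rule_time J (rule_of X J h t)).
Proof.
move=> hh hn.
apply: (rule_stopping_time hX) => [k w|k|i].
- exact: rule_of_ge0.
- exact: (history_rule_of t hh (leqnn k)).
- rewrite (_ : [set w | _] = setT) ?probability_setT //.
  apply/seteqP; split => // w _ /=.
  rewrite -(rule_time_le_jump hX (N := n)) //; last by rewrite /rule_of hn.
    by rewrite gt_min ltry orbT.
  by move=> k w'; exact: rule_of_ge0.
Qed.

Section Bounded.
Variables (h : nat -> R -> S -> \bar R) (t : R) (n : nat).
Hypotheses (hh : total_rule h) (hn : forall r j, h n r j = 0).
Let tau := rule_time J (rule_of X J h t).

Lemma bounded_rule_time : tau = (fun w => Order.min (tau w) (J n w)%:E).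
Proof.
have H0 m w := rule_of_ge0 t m w hh.
by apply/funext => w; rewrite (rule_time_le_jump hX) // /rule_of hn.
Qed.

Lemma measurable_bounded_gain : measurable_fun [set: T] (gain tau).
Proof.
have H0 m w := rule_of_ge0 t m w hh.
rewrite bounded_rule_time (_ : gain _ = pay X J gain_value 0 (rule_of X J h t) n 0).
  apply: (measurable_pay hX) => [i|m]; first exact: measurable_gain_value.
  exact: (measurable_history_rule hX).
by apply/funext => w; exact: gain_min_jump.
Qed.

Lemma measurable_bounded_payoff : measurable_fun [set: T] (payoff t tau).
Proof.
have H0 m w := rule_of_ge0 t m w hh.
rewrite bounded_rule_time (_ : payoff t _ = pay X J stop_value t (rule_of X J h t) n 0).
  apply: (measurable_pay hX) => [i|m]; first exact: (measurable_stop_value hc hu).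
  exact: (measurable_history_rule hX).
by apply/funext => w; exact: payoff_min_jump.
Qed.

Lemma expected_bounded_payoff i : \int[P i]_w payoff t tau w = rule_value h n 0 t i.
Proof. by rewrite bounded_rule_time expected_payoff. Qed.

End Bounded.

(** Following the rule and stopping at the n-th jump at the latest is a
    stopping time, to which payoff_pos_finite applies. *)
Lemma reward_pos_finite h n k t i : total_rule h -> reward_pos h n k t i < +oo.
Proof.
move=> [mh h0]; pose h' m r j := if (m < n)%N then h (k + m)%N r j else 0.
have hh' : total_rule h'.
  split=> [m j|m r j]; rewrite /h'; case: (m < n)%N => //.
have hn r j : h' n r j = 0 by rewrite /h' ltnn.
rewrite reward_posE (@eq_reward _ h h' n k 0); last first.
  by move=> m mn r j; rewrite /h' add0n mn.
have H0 m w := rule_of_ge0 t m w hh'.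
rewrite -expected_pay //.
rewrite (eq_integral (fun w => epos (payoff t (rule_time J (rule_of X J h' t)) w))).
  apply: payoff_pos_finite.
  - exact: bounded_rule_stopping_time.
  - exact: measurable_bounded_gain.
  - exact: measurable_bounded_payoff.
by move=> w _; rewrite (bounded_rule_time t hh' hn) payoff_min_jump // (pay_map epos).
Qed.

End Payoffs.

(** * Optimality of the iterates among bounded rules *)

Section NStep.
Local Open Scope ereal_scope.
Context {R : realType} {S : countType} {d : measure_display}
  {T : measurableType d} (P : S -> probability T R) (X : R -> T -> S)
  (J : nat -> T -> R) (q : S -> S -> R) (g : S -> R) (c : R)
  (dom : set R) (u : R -> R).
Hypotheses (hq : intensity_matrix q) (hX : markov_chain P X J q) (hc : (0 < c)%R)
    (hu : is_utility g dom u) (hA1 : assumptionA1 P X g c).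
Local Notation stop_value := (stop_value g c dom u).
Local Notation bellman_rhs := (bellman_rhs q g c dom u).
Local Notation bellman_sup := (bellman_sup q g c dom u).
Local Notation iterate := (iterate q g c dom u).
Local Notation first_maximizer := (first_maximizer q g c dom u).
Local Notation utility_growth := (utility_growth c dom u).
Local Notation jump_int := (jump_int q).
Local Notation rule_value := (rule_value q g c dom u).
Local Notation reward_pos := (reward_pos q g c dom u).
Local Notation reward_neg := (reward_neg q g c dom u).

Let msp i : measurable_fun [set: R] (fun t => epos (stop_value t i)).
Proof. by apply: measurable_epos; exact: (measurable_stop_value hc hu). Qed.
Let msn i : measurable_fun [set: R] (fun t => eneg (stop_value t i)).
Proof. by apply: measurable_eneg; exact: (measurable_stop_value hc hu). Qed.
Let sp0 t i : 0 <= epos (stop_value t i). Proof. exact: epos_ge0. Qed.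
Let sn0 t i : 0 <= eneg (stop_value t i). Proof. exact: eneg_ge0. Qed.

Lemma measurable_reward_pos h n k i : total_rule h ->
  measurable_fun [set: R] (reward_pos h n k ^~ i).
Proof. by move=> hh; exact: (measurable_reward hq msp). Qed.

Lemma measurable_reward_neg h n k i : total_rule h ->
  measurable_fun [set: R] (reward_neg h n k ^~ i).
Proof. by move=> hh; exact: (measurable_reward hq msn). Qed.

Lemma reward_pos_ge0 h n k t i : 0 <= reward_pos h n k t i.
Proof. exact: (reward_ge0 hq sp0). Qed.

Lemma reward_neg_ge0 h n k t i : 0 <= reward_neg h n k t i.
Proof. exact: (reward_ge0 hq sn0). Qed.

Lemma measurable_rule_value h n k i : total_rule h ->
  measurable_fun [set: R] (rule_value h n k ^~ i).
Proof.
move=> hh; apply: emeasurable_funB.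
  exact: measurable_reward_pos.
exact: measurable_reward_neg.
Qed.

(** Waiting for one more jump before following h is a rule as well, to which
    reward_pos_finite applies. *)
Lemma jump_int_reward_pos_finite h n k t i : total_rule h ->
  jump_int i (reward_pos h n k) t `[0%R, +oo[%classic < +oo.
Proof.
move=> [mh h0].
pose h' m r j := if m is m'.+1 then h (k + m')%N r j else +oo.
have hh' : total_rule h'.
  split=> [m j|m r j]; case: m => [|m] //=.
have := reward_pos_finite hq hX hc hu hA1 n.+1 0 t i hh'.
rewrite reward_posE [X in X < _]/= add0e upto_oo.
suff -> : reward q (fun r j => epos (stop_value r j)) h' n 1 = reward_pos h n k by [].
apply/funext => r; apply/funext => j; apply: eq_reward => m mn r' j'.
by rewrite add1n.
Qed.

(** The value of the waiting time x if W is the value at the next jump. It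
    agrees with the right-hand side of the equation for finite x, but for x =
    +oo it is the value of waiting for the jump and not a limsup. *)
Definition wait_or_stop (W : R -> S -> \bar R) (t : R) (i : S) (x : \bar R) : \bar R :=
  stop_reward q stop_value i t x +
  (jump_int i (pos_part W) t (upto x) - jump_int i (neg_part W) t (upto x)).

Lemma sub_add_sub (x y a b : \bar R) : 0 <= x -> x < +oo -> 0 <= y -> 0 <= a -> a < +oo ->
  0 <= b -> x + a - (y + b) = (x - y) + (a - b).
Proof.
case: x => [x| |] // _ _; case: a => [a| |] //; case: y => [y| |] // _ _ _; case: b => [b| |] // _.
by rewrite -!EFinD; congr EFin; lra.
Qed.

Lemma rule_valueS h n k t i : total_rule h ->
  rule_value h n.+1 k t i = wait_or_stop (rule_value h n k.+1) t i (h k t i).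
Proof.
move=> hh; have [_ h0] := hh.
have mU := @measurable_upto R (h k t i).
have ma j := measurable_reward_pos n k.+1 j hh.
have mb j := measurable_reward_neg n k.+1 j hh.
have a0 r j := reward_pos_ge0 h n k.+1 r j.
have b0 r j := reward_neg_ge0 h n k.+1 r j.
have afin : jump_int i (reward_pos h n k.+1) t (upto (h k t i)) < +oo.
  apply: le_lt_trans (jump_int_reward_pos_finite n k.+1 t i hh).
  by apply: (subset_jump_int hq) => // x [x0 _] /=; rewrite in_itv /= x0.
rewrite /wait_or_stop (jump_int_sub hq ma mb a0 b0 mU afin).
rewrite rule_valueE [LHS]/=.
rewrite sub_add_sub //; last 5 first.
- exact: (stop_reward_ge0 _ sp0).
- rewrite /stop_reward; case: (h k t i) => [r| |] //.
  apply: lte_mul_pinfty => //; last by rewrite ltry.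
  by rewrite ge0_fin_numE // /epos gt_max ltry andbT; exact: stop_value_lty.
- exact: (stop_reward_ge0 _ sn0).
- exact: jump_int_ge0.
- exact: jump_int_ge0.
congr (_ + _).
rewrite /stop_reward; case: (h k t i) => [r| |] //; rewrite ?subee //.
rewrite [X in X - _]muleC [X in _ - X]muleC -eposM ?expR_ge0 // -enegM ?expR_ge0 //.
by rewrite eposBeneg muleC.
Qed.

Section OneStep.
Variable W : R -> S -> \bar R.
Hypothesis Wni : forall j x y, (x <= y)%R -> W y j <= W x j.
Hypothesis Wfin : forall t i, jump_int i (pos_part W) t `[0%R, +oo[%classic < +oo.

Let mW j : measurable_fun [set: R] (W^~ j).
Proof. by apply: nonincreasing_emeasurable => x y; exact: Wni. Qed.
Let mp j : measurable_fun [set: R] (fun t => pos_part W t j).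
Proof. exact: measurable_epos. Qed.
Let p0 s j : 0 <= pos_part W s j. Proof. exact: epos_ge0. Qed.

Lemma finite_horizon i t (b : R) : jump_int i (pos_part W) t `[0%R, b]%classic < +oo.
Proof.
apply: le_lt_trans (Wfin t i); apply: (subset_jump_int hq) => //.
by apply: subset_itvl; rewrite bnd_simp.
Qed.

Lemma wait_or_stopE t i (r : R) : wait_or_stop W t i r%:E = bellman_rhs W t i r.
Proof.
by rewrite bellmanE // ?finite_horizon // /wait_or_stop upto_fin.
Qed.

Lemma wait_or_stop_oo t i : wait_or_stop W t i +oo = wait_value q W t i.
Proof. by rewrite /wait_or_stop /= add0e upto_oo. Qed.

(** The infinite waiting time is the case covered by wait_le_sup. *)
Lemma wait_or_stop_le t i x : (forall j, utility_growth W t j) -> 0 <= x ->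
  wait_or_stop W t i x <= bellman_sup W t i.
Proof.
move=> growth; case: x => [r| |] // r0.
  by rewrite wait_or_stopE; exact: bellman_le_sup.
by rewrite wait_or_stop_oo; apply: wait_le_sup => // s; exact: Wfin.
Qed.

(** If the supremum is not attained, it is the limsup at infinity, and waiting
    for the jump is worth at least as much by limsup_le_wait. *)
Lemma wait_or_stop_first_maximizer t i : (forall j, utility_growth W t j) ->
  wait_or_stop W t i (first_maximizer W t i) = bellman_sup W t i.
Proof.
move=> growth; apply/eqP; rewrite eq_le wait_or_stop_le ?first_maximizer_ge0 //=.
have hfin j s r : (0 <= r)%R -> jump_int j (pos_part W) s `[0%R, r]%classic < +oo.
  by move=> _; exact: finite_horizon.
rewrite (bellman_ext_first_maximizer hq hc hu Wni hfin).
have := first_maximizer_ge0 q g c dom u W t i.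
case: (first_maximizer W t i) => [r| |] // _; first by rewrite wait_or_stopE.
rewrite wait_or_stop_oo /=; apply: limsup_le_wait => // s; exact: Wfin.
Qed.

End OneStep.

Lemma le_wait_or_stop W W' t i x :
  (forall j, measurable_fun [set: R] (W^~ j)) ->
  (forall j, measurable_fun [set: R] (W'^~ j)) ->
  (forall s j, W' s j <= W s j) -> wait_or_stop W' t i x <= wait_or_stop W t i x.
Proof.
move=> mW mW' le; have mU := @measurable_upto R x.
apply: leeD => //; apply: leeB; apply: (le_jump_int hq) => //; move=> *;
  by [exact: measurable_epos|exact: measurable_eneg|exact: epos_ge0|exact: eneg_ge0
     |apply: le_epos; exact: le|apply: le_eneg; exact: le].
Qed.

(** After the k-th jump N - k jumps are left, and the value at the next jump
    is that with N - k.+1 jumps left. *)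
Definition optimal_rule (N k : nat) : R -> S -> \bar R :=
  if (k < N)%N then first_maximizer (iterate (N - k.+1)) else fun _ _ => 0.

Let finite_iterate n := forall t i, jump_int i (pos_part (iterate n)) t `[0%R, +oo[%classic < +oo.

Let iterate_ni n j x y : (x <= y)%R -> iterate n y j <= iterate n x j.
Proof. by move=> xy; exact: iterate_nonincreasing. Qed.

Let total_optimal N : (forall m, (m < N)%N -> finite_iterate m) -> total_rule (optimal_rule N).
Proof.
move=> fin; split=> [k i|k t i]; rewrite /optimal_rule; case: ifP => // kN; last first.
  exact: first_maximizer_ge0.
apply: measurable_first_maximizer => //; first by move=> *; exact: iterate_ni.
move=> j s r r0; apply: finite_horizon => *; first exact: iterate_ni.
by apply: fin; rewrite subnS prednK ?subn_gt0 ?leq_subr.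
Qed.

Let rule_value_optimal_rec n :
  (forall m, (m < n)%N -> finite_iterate m /\ forall t j, utility_growth (iterate m) t j) ->
  forall t i, rule_value (optimal_rule n) n 0 t i = iterate n t i.
Proof.
elim: n => [|n IH] hn t i.
  by rewrite rule_valueE /= eposBeneg.
have htot : total_rule (optimal_rule n.+1) by apply: total_optimal => m /hn[].
have [finn grn] := hn n (ltnSn n).
rewrite rule_valueS // (_ : rule_value (optimal_rule n.+1) n 1 = iterate n).
  rewrite /optimal_rule /= subn1 /= wait_or_stop_first_maximizer // => *.
  exact: iterate_ni.
apply/funext => s; apply/funext => j; rewrite -IH; last first.
  by move=> m mn; apply: hn; exact: ltnW.
have H f : reward q f (optimal_rule n.+1) n 1 s j = reward q f (optimal_rule n) n 0 s j.
  by apply: eq_reward => m mn r l; rewrite /optimal_rule add1n add0n ltnS subSS.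
exact: (congr2 (fun x y => x - y) (H (fun t i => epos (stop_value t i)))
  (H (fun t i => eneg (stop_value t i)))).
Qed.

(** Integrability and growth are needed to make sense of the optimal rules,
    while integrability of an iterate follows from its being the value of such
    a rule; so all is proved in one induction. *)
Let iterate_props n : finite_iterate n /\ forall t j, utility_growth (iterate n) t j.
Proof.
elim/ltn_ind: n => n IH.
have htot : total_rule (optimal_rule n) by apply: total_optimal => m /IH[].
split=> [t i|t j].
  apply: le_lt_trans (jump_int_reward_pos_finite n 0 t i htot).
  rewrite (_ : iterate n = rule_value (optimal_rule n) n 0); last first.
    by apply/funext => s; apply/funext => j; rewrite rule_value_optimal_rec.
  apply: (jump_int_pos_le hq) => //.
  - by move=> j; exact: measurable_reward_pos.
  - by move=> j; exact: measurable_reward_neg.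
  - by move=> s j; exact: reward_pos_ge0.
  - by move=> s j; exact: reward_neg_ge0.
case: n IH {htot} => [|n] IH; first exact: growth_stop.
have [finn grn] := IH n (ltnSn n).
by apply: growth_step => // *; first [exact: iterate_ni|exact: finn].
Qed.

Lemma iterate_pos_finite n t i :
  jump_int i (pos_part (iterate n)) t `[0%R, +oo[%classic < +oo.
Proof. by have [] := iterate_props n. Qed.

Lemma total_optimal_rule N : total_rule (optimal_rule N).
Proof. by apply: total_optimal => m _; case: (iterate_props m). Qed.

Lemma rule_value_optimal n t i : rule_value (optimal_rule n) n 0 t i = iterate n t i.
Proof. by apply: rule_value_optimal_rec => m _; exact: iterate_props. Qed.

Lemma rule_value_le_iterate h n k t i : total_rule h ->
  rule_value h n k t i <= iterate n t i.
Proof.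
move=> hh; elim: n k t i => [|n IH] k t i.
  by rewrite rule_valueE /= eposBeneg.
rewrite rule_valueS //; have [finn grn] := iterate_props n.
apply: (@le_trans _ _ (wait_or_stop (iterate n) t i (h k t i))).
  apply: le_wait_or_stop => // j; first exact: measurable_iterate.
  exact: measurable_rule_value.
apply: wait_or_stop_le => //; first by move=> *; exact: iterate_ni.
by have [_ h0] := hh; exact: h0.
Qed.

(** The limit of the value iteration, identified with the value function by
    value_jump_value. *)
Definition jump_value (t : R) (i : S) : \bar R := ereal_sup [set iterate n t i | n in [set: nat]].

Lemma iterate_le_jump_value n t i : iterate n t i <= jump_value t i.
Proof. by apply: ereal_sup_ubound; exists n. Qed.

Lemma jump_value_nonincreasing j x y : (x <= y)%R -> jump_value y j <= jump_value x j.
Proof.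
move=> xy; apply: ge_ereal_sup => _ [n _ <-].
by apply: le_trans (iterate_le_jump_value n x j); exact: iterate_ni.
Qed.

Lemma jump_value_lty t i : jump_value t i < +oo.
Proof.
have [M hM] := expected_payoff_bounded hu hA1 i t.
apply: (@le_lt_trans _ _ M%:E); last by rewrite ltry.
apply: ge_ereal_sup => _ [n _ <-]; have hh := total_optimal_rule n.
have hn r j : optimal_rule n n r j = 0 by rewrite /optimal_rule ltnn.
rewrite -rule_value_optimal -(expected_bounded_payoff hq hX hc hu t hh hn).
apply: hM.
- exact: (bounded_rule_stopping_time hX t hh hn).
- exact: (measurable_bounded_gain g c hX t hh hn).
- exact: (measurable_bounded_payoff hX hc hu t hh hn).
Qed.

End NStep.

(** * Choosing the horizon at the first jump *)

Section Switch.
Local Open Scope ereal_scope.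
Context {R : realType} {S : countType} {d : measure_display}
  {T : measurableType d} (P : S -> probability T R) (X : R -> T -> S)
  (J : nat -> T -> R) (q : S -> S -> R) (g : S -> R) (c : R)
  (dom : set R) (u : R -> R).
Hypotheses (hq : intensity_matrix q) (hX : markov_chain P X J q) (hc : (0 < c)%R)
    (hu : is_utility g dom u) (hA1 : assumptionA1 P X g c).
Local Notation Z := (embedded X J).
Local Notation stop_value := (stop_value g c dom u).
Local Notation jump_int := (jump_int q).
Local Notation payoff := (payoff X g c dom u).
Local Notation gain := (gain X g c).
Local Notation rule_value := (rule_value q g c dom u).
Local Notation wait_or_stop := (wait_or_stop q g c dom u).
Local Notation history k := (g_sigma_algebraType (history_events X J k)).

Variables (h : nat -> nat -> R -> S -> \bar R) (N : R -> S -> nat) (K : nat -> nat).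
Variables (theta : R) (t : R).
Hypothesis hh : forall n, total_rule (h n).
Hypothesis h_first : forall n r j, h n 0 r j = theta%:E.
Hypothesis h_last : forall n r j, h n (K n).+1 r j = 0.
Hypothesis mN : forall j n, measurable [set r | N r j = n].

Let choice_at w := N (t + J 1 w)%R (Z 1 w).

(** The member of the family h is chosen from the date and the state at the
    first jump and kept from then on. All members agree before that jump, so
    that the choice does not anticipate it. *)
Definition switch (k : nat) (w : T) : \bar R := rule_of X J (h (choice_at w)) t k w.

Lemma history_choice_at k n : (0 < k)%N -> jump_history X J k [set w | choice_at w = n].
Proof.
move=> k0; rewrite (_ : [set w | _] = \bigcup_(j in [set: S])
    ((Z 1 @^-1` [set j]) `&` [set w | N (t + J 1 w)%R j = n])).
  apply: (@bigcup_countType _ (history k)) => j.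
  apply: (@measurableI _ (history k)).
    exact: (@history_embedded _ _ _ _ X J k 1 [set j] k0).
  have mJ : measurable_fun [set: history k] (fun w : history k => (t + J 1 w)%R).
    by apply: measurable_funD => //; exact: (history_jump k0).
  by have := mJ measurableT _ (mN j n); rewrite setTI.
by apply/seteqP; split=> w /=; [exists (Z 1 w)|move=> [j _ [/= <-]]].
Qed.

Lemma measurable_choice_at n : measurable [set w | choice_at w = n].
Proof. exact: (history_measurable hX (@history_choice_at 1 n isT)). Qed.

Lemma history_switch k :
  measurable_fun [set: history k] (switch k : history k -> \bar R).
Proof.
case: k => [|k].
  rewrite (_ : switch 0 = cst theta%:E); first exact: measurable_cst.
  by apply/funext => w; rewrite /switch /rule_of h_first.
apply: (@measurable_select _ _ _ (history k.+1) choice_at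
  (fun n => rule_of X J (h n) t k.+1)).
  by move=> n; exact: history_choice_at.
by move=> n; exact: (history_rule_of t (hh n) (leqnn k.+1)).
Qed.

Lemma switch_ge0 k w : 0 <= switch k w.
Proof. exact: rule_of_ge0. Qed.

Local Notation tau := (rule_time J switch).

Lemma switch_le_jump w : Order.min (tau w) (J (K (choice_at w)).+1 w)%:E = tau w.
Proof.
by apply: (rule_time_le_jump hX switch_ge0); rewrite /switch /rule_of h_last.
Qed.

Lemma switch_stopping_time : stopping_time P X tau.
Proof.
apply: (rule_stopping_time hX switch_ge0 history_switch) => i.
rewrite (_ : [set w | _] = setT) ?probability_setT //.
by apply/seteqP; split => // w _ /=; rewrite -switch_le_jump gt_min ltry orbT.
Qed.

Section SwitchPay.
Variable f : R -> S -> \bar R.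
Hypothesis mf : forall i, measurable_fun [set: R] (f^~ i).

Let switch_pay t' w :=
  pay X J f t' (rule_of X J (h (choice_at w)) t) (K (choice_at w)).+1 0 w.

Lemma measurable_switch_pay t' : measurable_fun [set: T] (switch_pay t').
Proof.
apply: (@measurable_select _ _ _ _ choice_at
  (fun n => pay X J f t' (rule_of X J (h n) t) (K n).+1 0)).
  exact: measurable_choice_at.
move=> n; apply: (measurable_pay hX mf) => k.
exact: (measurable_history_rule hX).
Qed.

Hypothesis f0 : forall t i, 0 <= f t i.

Definition switch_reward (r : R) (j : S) : \bar R :=
  reward q f (h (N r j)) (K (N r j)) 1 r j.

Lemma switch_reward_ge0 r j : 0 <= switch_reward r j.
Proof. exact: reward_ge0. Qed.

Lemma measurable_switch_reward j : measurable_fun [set: R] (switch_reward ^~ j).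
Proof.
apply: (@measurable_select _ _ _ _ (N ^~ j) (fun n r => reward q f (h n) (K n) 1 r j)).
  by move=> n; exact: mN.
by move=> n; exact: measurable_reward.
Qed.

(** On the event that the first jump precedes the deadline, the sets on which
    a given member is chosen belong to the history of the first jump, so that
    pay_reward applies on each; first_step then integrates over that jump. *)
Lemma expected_switch_pay i : \int[P i]_w switch_pay t w =
  stop_reward q f i t theta%:E + jump_int i switch_reward t `[0%R, theta]%classic.
Proof.
have msp := measurable_switch_pay t.
have sp0 w : 0 <= switch_pay t w by exact: pay_ge0.
pose fs := first_step_pay X J f switch_reward (h 0) t 0.
have mfs : measurable_fun [set: T] fs.
  by exact: (measurable_first_step_pay hX mf t 0 (hh 0) measurable_switch_reward).
have fs0 w : 0 <= fs w.
  by rewrite /fs /first_step_pay; case: ifP => // _; exact: switch_reward_ge0.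
transitivity (\int[P i]_w fs w); last first.
  rewrite (first_step hX hq mf f0 i t (hh 0) measurable_switch_reward); last 2 first.
  - by move=> *; exact: switch_reward_ge0.
  - exact: (@measurableT _ (history 0)).
  under eq_integral do rewrite h_first upto_fin.
  rewrite (initial_state hX i (F := fun r j => stop_reward q f j (t + r)%R theta%:E +
    jump_int j switch_reward (t + r)%R `[0%R, theta]%classic)) ?addr0 //.
  - move=> j; apply: emeasurable_funD.
      apply: (@measurableT_comp _ _ _ _ _ _ (fun r => stop_reward q f j r theta%:E)).
        apply: (measurable_stop_reward q mf j (h := fun=> theta%:E)) => // r.
        by rewrite -(h_first 0 r j); case: (hh 0).
      exact: measurable_addr.
    apply: (@measurableT_comp _ _ _ _ _ _
      (fun r => jump_int j switch_reward r `[0%R, theta]%classic)).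
      rewrite -upto_fin; apply: (measurable_jump_int hq) => //.
        exact: measurable_switch_reward.
      by move=> *; exact: switch_reward_ge0.
    exact: measurable_addr.
  - move=> r j; rewrite adde_ge0 ?stop_reward_ge0 //.
    by apply: (jump_int_ge0 hq) => *; exact: switch_reward_ge0.
have hC := @history_rule_stops _ _ _ _ X J (h 0) t 0 (hh 0).
have mC := history_measurable hX hC.
have stopsE w : stops J (rule_of X J (h (choice_at w)) t) w 0 =
    stops J (rule_of X J (h 0) t) w 0 by rewrite /stops /rule_of !h_first.
rewrite (ge0_integral_setID _ measurableT mC) // [RHS](ge0_integral_setID _ measurableT mC) //.
rewrite !setTI !setTD; congr (_ + _).
  apply: eq_integral => w /set_mem /= Cw.
  by rewrite /switch_pay /fs /first_step_pay /= stopsE Cw /rule_of !h_first.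
have mnC : measurable (~` [set w | stops J (rule_of X J (h 0) t) w 0]) by exact: measurableC.
rewrite (@integral_fibers _ _ _ _ _ _ choice_at) //; last exact: measurable_choice_at.
rewrite [RHS](@integral_fibers _ _ _ _ _ _ choice_at) //; last exact: measurable_choice_at.
apply: eq_esum => n _.
set A := _ `&` _.
have hA : jump_history X J 1 A.
  apply: (@measurableI _ (history 1)); last exact: history_choice_at.
  by apply: (@measurableC _ (history 1)).
transitivity (\int[P i]_(w in A) pay X J f t (rule_of X J (h n) t) (K n) 1 w).
  apply: eq_integral => w /set_mem [/= /negP/negbTE nCw cw].
  by rewrite /switch_pay /= stopsE nCw cw.
rewrite (pay_reward hX hq mf f0 i t (K n) (hh n) hA).
apply: eq_integral => w /set_mem [/= /negP/negbTE nCw cw].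
by rewrite /fs /first_step_pay nCw /switch_reward -/(choice_at w) cw.
Qed.

End SwitchPay.

Lemma switch_payE f t' w :
  f (t' + fine (tau w))%R (X (fine (tau w)) w) =
  pay X J f t' (rule_of X J (h (choice_at w)) t) (K (choice_at w)).+1 0 w.
Proof.
have := pay_stopped hX f t' (K (choice_at w)).+1 w switch_ge0.
by rewrite switch_le_jump => ->; apply: eq_pay.
Qed.

Lemma measurable_switch_gain : measurable_fun [set: T] (gain tau).
Proof.
have := measurable_switch_pay (measurable_gain_value g c) 0.
apply: eq_measurable_fun => w _; rewrite -switch_payE /gain_value add0r.
by [].
Qed.

Lemma measurable_switch_payoff : measurable_fun [set: T] (payoff t tau).
Proof.
have := measurable_switch_pay (measurable_stop_value hc hu) t.
by apply: eq_measurable_fun => w _; rewrite -switch_payE.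
Qed.

Definition switch_value (r : R) (j : S) : \bar R := rule_value (h (N r j)) (K (N r j)) 1 r j.

Let msp i : measurable_fun [set: R] (fun s => epos (stop_value s i)).
Proof. by apply: measurable_epos; exact: (measurable_stop_value hc hu). Qed.
Let msn i : measurable_fun [set: R] (fun s => eneg (stop_value s i)).
Proof. by apply: measurable_eneg; exact: (measurable_stop_value hc hu). Qed.
Let sp0 s i : 0 <= epos (stop_value s i). Proof. exact: epos_ge0. Qed.
Let sn0 s i : 0 <= eneg (stop_value s i). Proof. exact: eneg_ge0. Qed.

Let Dp := switch_reward (fun s j => epos (stop_value s j)).
Let Dn := switch_reward (fun s j => eneg (stop_value s j)).

Let mDp j : measurable_fun [set: R] (Dp^~ j). Proof. exact: measurable_switch_reward. Qed.
Let mDn j : measurable_fun [set: R] (Dn^~ j). Proof. exact: measurable_switch_reward. Qed.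
Let Dp0 r j : 0 <= Dp r j. Proof. exact: switch_reward_ge0. Qed.
Let Dn0 r j : 0 <= Dn r j. Proof. exact: switch_reward_ge0. Qed.

Lemma measurable_switch_value j : measurable_fun [set: R] (switch_value ^~ j).
Proof. by apply: emeasurable_funB; [exact: mDp|exact: mDn]. Qed.

Let pos_payE i : \int[P i]_w epos (payoff t tau w) =
  stop_reward q (fun s j => epos (stop_value s j)) i t theta%:E +
  jump_int i Dp t `[0%R, theta]%classic.
Proof.
rewrite -(expected_switch_pay msp sp0 i); apply: eq_integral => w _.
by rewrite -switch_payE.
Qed.

Let neg_payE i : \int[P i]_w eneg (payoff t tau w) =
  stop_reward q (fun s j => eneg (stop_value s j)) i t theta%:E +
  jump_int i Dn t `[0%R, theta]%classic.
Proof.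
rewrite -(expected_switch_pay msn sn0 i); apply: eq_integral => w _.
by rewrite -switch_payE.
Qed.

Let pos_finite i : \int[P i]_w epos (payoff t tau w) < +oo.
Proof.
apply: (payoff_pos_finite hu hA1); [exact: switch_stopping_time|exact: measurable_switch_gain|].
exact: measurable_switch_payoff.
Qed.

Let Dp_finite i : jump_int i Dp t `[0%R, theta]%classic < +oo.
Proof.
apply: le_lt_trans (pos_finite i); rewrite pos_payE leeDr //.
exact: stop_reward_ge0.
Qed.

Lemma switch_value_pos_finite i : jump_int i (pos_part switch_value) t `[0%R, theta]%classic < +oo.
Proof. by apply: le_lt_trans (Dp_finite i); apply: (jump_int_pos_le hq mDp mDn Dp0 Dn0). Qed.

Lemma expected_switch_payoff i :
  \int[P i]_w payoff t tau w = wait_or_stop switch_value t i theta%:E.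
Proof.
rewrite integralE.
under eq_integral do rewrite funeposE.
under [X in _ - X]eq_integral do rewrite funenegE.
rewrite [X in X - _]pos_payE [X in _ - X]neg_payE.
rewrite sub_add_sub //; last 5 first.
- exact: stop_reward_ge0.
- apply: le_lt_trans (pos_finite i); rewrite pos_payE leeDl //.
  exact: jump_int_ge0.
- exact: stop_reward_ge0.
- exact: jump_int_ge0.
- exact: jump_int_ge0.
rewrite /wait_or_stop upto_fin -(jump_int_sub hq mDp mDn Dp0 Dn0) //.
congr (_ + _); rewrite /stop_reward.
rewrite [X in X - _]muleC [X in _ - X]muleC -eposM ?expR_ge0 // -enegM ?expR_ge0 //.
by rewrite eposBeneg muleC.
Qed.

End Switch.

Lemma limn_einf_le {R : realType} (v : nat -> \bar R) (x : \bar R) :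
  (forall n, (v n.+1 <= x)%E) -> (limn_einf v <= x)%E.
Proof.
move=> h; rewrite /limn_einf leeNl; apply: le_ereal_inf_tmp => _ [A [n _ nA] <-].
apply: (@le_trans _ _ (- v n.+1)%E); first by rewrite leeN2.
by apply: ereal_sup_ubound; exists n.+1 => //; apply: nA => /=.
Qed.

(** * The value function *)

Section Comparison.
Local Open Scope ereal_scope.
Context {R : realType} {S : countType} (q : S -> S -> R) (g : S -> R) (c : R)
  (dom : set R) (u : R -> R).
Hypotheses (hq : intensity_matrix q).
Local Notation jump_int := (jump_int q).
Local Notation wait_or_stop := (wait_or_stop q g c dom u).

Variables (W W' : R -> S -> \bar R) (eps : R).
Hypotheses (mW : forall j, measurable_fun [set: R] (W^~ j))
  (mW' : forall j, measurable_fun [set: R] (W'^~ j)).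
Hypotheses (eps0 : (0 <= eps)%R) (WW' : forall s j, W s j <= W' s j + eps%:E).
Variables (i : S) (t theta : R).
Local Notation I := (`[0%R, theta]%classic).
Hypothesis W'fin : jump_int i (pos_part W') t I < +oo.

Let jump_int_eps : jump_int i (fun _ _ => eps%:E) t I <= eps%:E.
Proof.
rewrite -[leRHS](jump_int_cst hq i t eps0); apply: (subset_jump_int hq) => //.
by apply: subset_itvl; rewrite bnd_simp.
Qed.

Let mp j : measurable_fun [set: R] (fun t => pos_part W t j).
Proof. exact: measurable_epos. Qed.
Let mn j : measurable_fun [set: R] (fun t => neg_part W t j).
Proof. exact: measurable_eneg. Qed.
Let p0 s j : 0 <= pos_part W s j. Proof. exact: epos_ge0. Qed.
Let n0 s j : 0 <= neg_part W s j. Proof. exact: eneg_ge0. Qed.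
Let mp' j : measurable_fun [set: R] (fun t => pos_part W' t j).
Proof. exact: measurable_epos. Qed.
Let mn' j : measurable_fun [set: R] (fun t => neg_part W' t j).
Proof. exact: measurable_eneg. Qed.
Let p'0 s j : 0 <= pos_part W' s j. Proof. exact: epos_ge0. Qed.
Let n'0 s j : 0 <= neg_part W' s j. Proof. exact: eneg_ge0. Qed.
Let me (j : S) : measurable_fun [set: R] (fun _ : R => eps%:E).
Proof. exact: measurable_cst. Qed.
Let e0 (s : R) (j : S) : 0 <= eps%:E. Proof. by rewrite lee_fin. Qed.

Let le_pos s j : pos_part W s j <= pos_part W' s j + eps%:E.
Proof.
rewrite /pos_part /epos ge_max; apply/andP; split.
  by apply: le_trans (WW' s j) _; rewrite leeD2r // le_max lexx.
by rewrite adde_ge0 ?lee_fin // le_max lexx orbT.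
Qed.

Let le_parts s j : pos_part W s j + neg_part W' s j <=
  pos_part W' s j + (neg_part W s j + eps%:E).
Proof.
rewrite /pos_part /neg_part /epos /eneg; move: (WW' s j).
move: (W s j) (W' s j) => [x| |] [y| |] //=;
  rewrite ?maxye ?maxNye -?EFin_max /= ?leey // -!EFinD !lee_fin => xy.
have xE : (x = Num.max x 0 - Num.max (- x) 0)%R.
  by case: (lerP x 0) => h1; case: (lerP (- x) 0) => h2; lra.
have yE : (y = Num.max y 0 - Num.max (- y) 0)%R.
  by case: (lerP y 0) => h1; case: (lerP (- y) 0) => h2; lra.
by lra.
Qed.

Lemma jump_int_pos_finite : jump_int i (pos_part W) t I < +oo.
Proof.
apply: (@le_lt_trans _ _ (jump_int i (fun s j => (pos_part W' s j + eps%:E)%E) t I)).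
  apply: (le_jump_int hq) => // [j|s j].
    by apply: emeasurable_funD.
  by rewrite adde_ge0.
rewrite (@jump_intD _ _ q hq i _ _ t I (measurable_itv _) mp' me p'0 e0).
by apply: lte_add_pinfty => //; apply: le_lt_trans jump_int_eps _; rewrite ltry.
Qed.

(** The law of the next jump has total mass 1, so that a change by eps of the
    value there is worth at most eps. Positive and negative parts are compared
    crosswise, because their integrals may be infinite. *)
Lemma wait_or_stop_le_eps : wait_or_stop W t i theta%:E <= wait_or_stop W' t i theta%:E + eps%:E.
Proof.
have mne j : measurable_fun [set: R] (fun t => neg_part W t j + eps%:E).
  exact: emeasurable_funD.
have ne0 s j : 0 <= neg_part W s j + eps%:E by rewrite adde_ge0.
have : jump_int i (pos_part W) t I + jump_int i (neg_part W') t I <=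
    jump_int i (pos_part W') t I + (jump_int i (neg_part W) t I + eps%:E).
  rewrite -(@jump_intD _ _ q hq i _ _ t I (measurable_itv _) mp mn' p0 n'0).
  apply: (@le_trans _ _ (jump_int i (fun s j => (pos_part W' s j + (neg_part W s j + eps%:E))%E) t I)).
    apply: (le_jump_int hq) => // [j|j|s j|s j].
    - exact: emeasurable_funD.
    - exact: emeasurable_funD.
    - by rewrite adde_ge0.
    - by rewrite adde_ge0.
  rewrite (@jump_intD _ _ q hq i _ _ t I (measurable_itv _) mp' mne p'0 ne0).
  rewrite (@jump_intD _ _ q hq i _ _ t I (measurable_itv _) mn me n0 e0).
  by apply: leeD => //; apply: leeD.
rewrite /wait_or_stop upto_fin.
have := jump_int_pos_finite; have := W'fin.
have := jump_int_ge0 hq i p0 t I; have := jump_int_ge0 hq i p'0 t I.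
have := jump_int_ge0 hq i n0 t I; have := jump_int_ge0 hq i n'0 t I.
have := stop_term_lty q g c dom u t i theta.
rewrite /stop_reward.
case: (_ * _) => [x| |] // _;
case: (jump_int i (pos_part W) t I) => [p| |] //;
case: (jump_int i (pos_part W') t I) => [p'| |] //;
case: (jump_int i (neg_part W) t I) => [n| |] //;
case: (jump_int i (neg_part W') t I) => [n'| |] // _ _ _ _ _ _;
rewrite -?EFinD ?lee_fin ?leNye ?leye_eq // => *; lra.
Qed.

End Comparison.

Section Verification.
Local Open Scope ereal_scope.
Context {R : realType} {S : countType} {d : measure_display}
  {T : measurableType d} (P : S -> probability T R) (X : R -> T -> S)
  (J : nat -> T -> R) (q : S -> S -> R) (g : S -> R) (c : R)
  (dom : set R) (u : R -> R).
Hypotheses (hq : intensity_matrix q) (hX : markov_chain P X J q) (hc : (0 < c)%R)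
    (hu : is_utility g dom u) (hA1 : assumptionA1 P X g c)
    (hA2 : assumptionA2 P X J g c dom u).
Local Notation Z := (embedded X J).
Local Notation stop_value := (stop_value g c dom u).
Local Notation bellman_rhs := (bellman_rhs q g c dom u).
Local Notation bellman_sup := (bellman_sup q g c dom u).
Local Notation iterate := (iterate q g c dom u).
Local Notation jump_int := (jump_int q).
Local Notation payoff := (payoff X g c dom u).
Local Notation rule_value := (rule_value q g c dom u).
Local Notation wait_or_stop := (wait_or_stop q g c dom u).
Local Notation optimal_rule := (optimal_rule q g c dom u).
Local Notation jump_value := (jump_value q g c dom u).
Local Notation first_maximizer := (first_maximizer q g c dom u).
Local Notation value := (value P X J g c dom u).

Let jump_value_ni j x y : (x <= y)%R -> jump_value y j <= jump_value x j.
Proof. by move=> xy; exact: jump_value_nonincreasing. Qed.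

Lemma measurable_jump_value j : measurable_fun [set: R] (jump_value ^~ j).
Proof. by apply: nonincreasing_emeasurable => x y; exact: jump_value_ni. Qed.

Section NearOptimal.
Variable (eps : R).
Hypothesis eps0 : (0 < eps)%R.

Lemma near_optimal_exists r j : exists n, jump_value r j - eps%:E <= iterate n r j.
Proof.
have [vfin|] := boolP (jump_value r j \is a fin_num).
  have [_ [n _ <-] h] := ub_ereal_sup_adherent eps0 vfin.
  by exists n; exact: ltW.
move=> nfin; exists 0%N.
have := jump_value_lty hq hX hc hu hA1 r j.
by move: nfin; case: (jump_value r j) => [x| |] //= _ _; rewrite leNye.
Qed.

Definition near_optimal (r : R) (j : S) : nat := ex_minn (near_optimal_exists r j).

Lemma near_optimalP r j : jump_value r j - eps%:E <= iterate (near_optimal r j) r j.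
Proof. by rewrite /near_optimal; case: ex_minnP. Qed.

Lemma near_optimal_le r j n :
  (near_optimal r j <= n)%N = (jump_value r j - eps%:E <= iterate n r j).
Proof.
apply/idP/idP => [le|]; last by rewrite /near_optimal; case: ex_minnP => m _; apply.
by apply: le_trans (near_optimalP r j) _; exact: iterate_le.
Qed.

(** The iterates increase with n, so that the horizons up to n are sufficient
    exactly where one inequality between measurable functions holds. *)
Lemma measurable_near_optimal j n : measurable [set r | near_optimal r j = n].
Proof.
have mle m : measurable [set r | (near_optimal r j <= m)%N].
  rewrite (_ : [set r | _] = [set r | jump_value r j - eps%:E <= iterate m r j]).
    apply: measurable_lee_fun; last exact: measurable_iterate.
    by apply: emeasurable_funB => //; exact: measurable_jump_value.
  by apply/seteqP; split=> r /=; rewrite near_optimal_le.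
case: n => [|n].
  rewrite (_ : [set r | _] = [set r | (near_optimal r j <= 0)%N]) //.
  by apply/seteqP; split=> r /=; rewrite leqn0 => /eqP.
rewrite (_ : [set r | _] =
    [set r | (near_optimal r j <= n.+1)%N] `\` [set r | (near_optimal r j <= n)%N]).
  exact: measurableD.
apply/seteqP; split=> r /=; first by move=> ->; rewrite leqnn ltnn.
by move=> [le /negP]; rewrite -ltnNge => lt; apply/eqP; rewrite eqn_leq le.
Qed.

Variables (t theta : R).
Hypothesis theta0 : (0 <= theta)%R.

(** Waits for theta at first, and then follows the optimal rule of horizon
    n. *)
Definition delayed_rule (n k : nat) : R -> S -> \bar R :=
  if k is k'.+1 then optimal_rule n k' else fun _ _ => theta%:E.

(** The same rule stopped after m + 1 jumps at the latest. *)
Definition truncated_rule (m n k : nat) : R -> S -> \bar R :=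
  if (k <= m)%N then delayed_rule n k else fun _ _ => 0.

Lemma total_delayed_rule n : total_rule (delayed_rule n).
Proof.
have [mo o0] := total_optimal_rule hq hX hc hu hA1 n.
by split=> [k i|k r i]; case: k => [|k] //=; rewrite ?lee_fin.
Qed.

Lemma total_truncated_rule m n : total_rule (truncated_rule m n).
Proof.
have [mo o0] := total_delayed_rule n.
by split=> [k i|k r i]; rewrite /truncated_rule; case: ifP.
Qed.

Let delayed_first n r j : delayed_rule n 0 r j = theta%:E. Proof. by []. Qed.
Let delayed_last n r j : delayed_rule n n.+1 r j = 0.
Proof. by rewrite /delayed_rule /optimal_rule ltnn. Qed.
Let truncated_first m n r j : truncated_rule m n 0 r j = theta%:E. Proof. by []. Qed.
Let truncated_last m n r j : truncated_rule m n m.+1 r j = 0.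
Proof. by rewrite /truncated_rule ltnn. Qed.

Let delayed_switch := switch X J delayed_rule near_optimal t.
Let truncated_switch m := switch X J (truncated_rule m) near_optimal t.

Let optimal_near r j := iterate (near_optimal r j) r j.

Let delayed_value : switch_value q g c dom u delayed_rule near_optimal id = optimal_near.
Proof.
apply/funext => r; apply/funext => j; rewrite /optimal_near -(rule_value_optimal hq hX hc hu hA1).
set n := near_optimal r j.
have H f : reward q f (delayed_rule n) n 1 r j = reward q f (optimal_rule n) n 0 r j.
  by apply: eq_reward => m mn s l; rewrite add1n add0n.
exact: (congr2 (fun x y => x - y) (H (fun t i => epos (stop_value t i)))
  (H (fun t i => eneg (stop_value t i)))).
Qed.

Let measurable_optimal_near j : measurable_fun [set: R] (optimal_near ^~ j).
Proof.
rewrite -delayed_value.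
exact: (measurable_switch_value hq hc hu id total_delayed_rule measurable_near_optimal).
Qed.

Lemma jump_value_le_near r j : jump_value r j <= optimal_near r j + eps%:E.
Proof. by rewrite -leeBlDr //; exact: near_optimalP. Qed.

Lemma jump_value_pos_finite i :
  jump_int i (pos_part jump_value) t `[0%R, theta]%classic < +oo.
Proof.
apply: (jump_int_pos_finite hq (W' := optimal_near) (eps := eps)) => //.
- exact: measurable_jump_value.
- exact: ltW.
- exact: jump_value_le_near.
rewrite -delayed_value.
exact: (switch_value_pos_finite hq hX hc hu hA1 t total_delayed_rule delayed_first
  delayed_last measurable_near_optimal).
Qed.

Let truncated_payoff m w :
  payoff t (fun w => Order.min (rule_time J delayed_switch w) (J m.+1 w)%:E) w =
  payoff t (rule_time J (truncated_switch m)) w.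
Proof.
rewrite (payoff_min_jump g c dom u hX t m.+1 w); last first.
  by move=> k w'; apply: switch_ge0 => n; exact: total_delayed_rule.
have trunc0 n := total_truncated_rule m n.
rewrite /Defs.payoff -/(stop_value (t + fine _)%R (X _ w)).
rewrite (switch_payE hX near_optimal (K := fun=> m) t trunc0 (truncated_last m)).
apply: eq_pay => k km; rewrite /delayed_switch /switch /rule_of /truncated_rule.
by move: km; rewrite add0n ltnS => ->.
Qed.

Let truncated_le m i :
  \int[P i]_w payoff t (fun w => Order.min (rule_time J delayed_switch w) (J m.+1 w)%:E) w
  <= jump_value t i.
Proof.
have tot n := total_truncated_rule m n.
under eq_integral do rewrite truncated_payoff.
have mN j n := measurable_near_optimal j n.
rewrite (expected_switch_payoff hq hX hc hu hA1 t tot (truncated_first m) (truncated_last m) mN).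
apply: (@le_trans _ _ (wait_or_stop (iterate m) t i theta%:E)).
  apply: (le_wait_or_stop g c dom u hq).
  - by move=> j; exact: measurable_iterate.
  - exact: (measurable_switch_value hq hc hu (fun=> m) tot mN).
  - move=> s j; exact: (rule_value_le_iterate hq hX hc hu hA1).
rewrite wait_or_stopE //; last first.
- by move=> *; exact: (iterate_pos_finite hq hX hc hu hA1).
- by move=> *; exact: iterate_nonincreasing.
apply: (@le_trans _ _ (iterate m.+1 t i)); last exact: iterate_le_jump_value.
exact: bellman_le_sup.
Qed.

(** Waiting for theta and then choosing an eps-optimal horizon at the first
    jump is worth at least the right-hand side of the equation minus eps. The
    horizon depends on the state reached and is unbounded; but by assumptionA2
    the expected payoff is at most the limit inferior of those of the
    truncations at the m-th jumps, and these are at most iterates. *)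
Lemma bellman_le_eps i : (0 <= t)%R -> bellman_rhs jump_value t i theta <= jump_value t i + eps%:E.
Proof.
move=> t0.
have tot n := total_delayed_rule n.
have mN j n := measurable_near_optimal j n.
have st : stopping_time P X (rule_time J delayed_switch).
  exact: (switch_stopping_time hX t tot delayed_first delayed_last mN).
have := hA2 i t0 st.
rewrite (expected_switch_payoff hq hX hc hu hA1 t tot delayed_first delayed_last mN) => h.
have -> : bellman_rhs jump_value t i theta = wait_or_stop jump_value t i theta%:E.
  rewrite bellmanE ?jump_value_pos_finite //; last exact: measurable_jump_value.
  by rewrite /wait_or_stop upto_fin.
apply: (@le_trans _ _ (wait_or_stop optimal_near t i theta%:E + eps%:E)).
  apply: wait_or_stop_le_eps => //.
  - exact: measurable_jump_value.
  - exact: ltW.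
  - exact: jump_value_le_near.
  rewrite -delayed_value.
  exact: (switch_value_pos_finite hq hX hc hu hA1 t tot delayed_first delayed_last mN).
apply: leeD => //; rewrite -delayed_value; apply: (le_trans h).
by apply: limn_einf_le => m; exact: truncated_le.
Qed.

End NearOptimal.

Lemma bellman_le_jump_value t i theta : (0 <= t)%R -> (0 <= theta)%R ->
  bellman_rhs jump_value t i theta <= jump_value t i.
Proof.
move=> t0 th0; apply/lee_addgt0Pr => e e0.
exact: bellman_le_eps.
Qed.

Lemma jump_valueE t i : (0 <= t)%R -> jump_value t i = bellman_sup jump_value t i.
Proof.
move=> t0; apply/eqP; rewrite eq_le; apply/andP; split; last first.
  by apply: ge_ereal_sup => _ [th th0 <-]; exact: bellman_le_jump_value.
apply: ge_ereal_sup => _ [[|n] _ <-]; first exact: stop_le_bellman_sup.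
apply: le_bellman_sup => //.
- by move=> j; exact: measurable_iterate.
- exact: measurable_jump_value.
- by move=> s j _; exact: iterate_le_jump_value.
Qed.

(** Markovian rules are only prescribed at nonnegative dates. *)
Let rule_extension (h : nat -> R -> S -> \bar R) k (r : R) j := h k (Num.max 0 r)%R j.

Let total_rule_extension h : markovian P X J h -> total_rule (rule_extension h).
Proof.
move=> [mh _]; split=> [k i|k r i]; have [mhk h0] := mh k i; last first.
  by apply: h0; rewrite le_max lexx.
have mmax : measurable_fun [set: R] (fun r : R => Num.max 0 r)%R.
  by apply: measurable_maxr; [exact: measurable_cst|exact: measurable_id].
have sub : [set (Num.max 0 r)%R | r in [set: R]] `<=` (`[0%R, +oo[%classic : set R).
  by move=> _ [r _ <-] /=; rewrite in_itv /= andbT le_max lexx.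
exact: (measurable_comp (measurable_itv _) sub mhk mmax).
Qed.

Let markov_time_extension h t w : (0 <= t)%R ->
  markov_time X J h t w = rule_time J (rule_of X J (rule_extension h) t) w.
Proof.
move=> t0; rewrite markov_time_rule; apply: eq_rule_time => k.
rewrite /rule_of /rule_extension max_r // addr_ge0 //.
exact: (jump_ge0 hX).
Qed.

(** By assumptionA2 the expected payoff of a Markovian rule is at most the
    limit inferior of those of its truncations at the jumps, none of which
    beats an iterate. *)
Lemma value_le_jump_value t i : (0 <= t)%R -> value t i <= jump_value t i.
Proof.
move=> t0; rewrite /value; case: ifP => // _; last by rewrite leNye.
apply: ge_ereal_sup => _ [h hh <-].
have tot := total_rule_extension hh.
have -> : markov_time X J h t = rule_time J (rule_of X J (rule_extension h) t).
  by apply/funext => w; exact: markov_time_extension.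
have st : stopping_time P X (rule_time J (rule_of X J (rule_extension h) t)).
  apply: (rule_stopping_time hX) => [k w|k|j].
  - exact: rule_of_ge0.
  - exact: (history_rule_of t tot (leqnn k)).
  - rewrite -(markovian_finite hh j t0); congr (P j _).
    by apply/seteqP; split=> w /=; rewrite markov_time_extension.
apply: le_trans (hA2 i t0 st) _; apply: limn_einf_le => n.
rewrite (expected_payoff hq hX hc hu i t n.+1 tot).
apply: (@le_trans _ _ (iterate n.+1 t i)); last exact: iterate_le_jump_value.
exact: (rule_value_le_iterate hq hX hc hu hA1).
Qed.

(** Each iterate is the expected payoff of optimal_rule, which is
    Markovian. *)
Lemma jump_value_le_value t i : value_dom g c dom t i -> jump_value t i <= value t i.
Proof.
move=> vd; rewrite /value asboolT //; apply: ge_ereal_sup => _ [n _ <-].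
have tot := total_optimal_rule hq hX hc hu hA1 n.
have hn r j : optimal_rule n n r j = 0 by rewrite /optimal_rule ltnn.
rewrite -(rule_value_optimal hq hX hc hu hA1) -(expected_bounded_payoff hq hX hc hu t tot hn).
apply: ereal_sup_ubound; exists (optimal_rule n) => //; split => [k i'|j s s0].
  have [mo o0] := tot; split => [|r _]; last exact: o0.
  by apply: measurable_funTS; exact: mo.
exact: (stopping_finite (bounded_rule_stopping_time hX s tot hn)).
Qed.

(** The stop term is -oo there, and stays so under addition because of the
    convention -oo + oo = -oo. *)
Lemma bellman_off_domain W t i theta : (0 <= t)%R -> (0 <= theta)%R ->
  ~ value_dom g c dom t i -> bellman_rhs W t i theta = -oo.
Proof.
move=> t0 th0 nvd; rewrite /bellman_rhs (_ : utility _ _ _ = -oo).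
  by rewrite gt0_mulNye ?addNye // lte_fin expR_gt0.
apply/eqP; rewrite -leeNy_eq.
rewrite -(utility_out u (dom := dom) (x := (g i - c * t)%R)); last first.
  by move=> h; apply: nvd.
apply: (utility_nondecreasing hu).
have : (0 <= c * theta)%R by rewrite mulr_ge0 // ltW.
by lra.
Qed.

Lemma value_jump_value t i : (0 <= t)%R -> value t i = jump_value t i.
Proof.
move=> t0; have [vd|nvd] := pselect (value_dom g c dom t i).
  by apply/eqP; rewrite eq_le value_le_jump_value //= jump_value_le_value.
rewrite /value asboolF // jump_valueE //; apply/esym/eqP; rewrite -leeNy_eq.
by apply: ge_ereal_sup => _ [th th0 <-]; rewrite bellman_off_domain.
Qed.

Lemma bellman_rhs_value t i : (0 <= t)%R ->
  bellman_rhs value t i = bellman_rhs jump_value t i.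
Proof.
move=> t0; apply/funext => th; rewrite /bellman_rhs; congr (_ + _).
apply: eq_integral => s /set_mem /=; rewrite in_itv /= => /andP[s0 _].
congr (_ * signed_esum _ _); apply/funext => j.
by rewrite value_jump_value // addr_ge0.
Qed.

Lemma value_bellman t i : (0 <= t)%R -> value t i = bellman_sup value t i.
Proof.
move=> t0; have -> : bellman_sup value t i = bellman_sup jump_value t i.
  by rewrite /bellman_sup bellman_rhs_value.
exact: etrans (value_jump_value i t0) (jump_valueE i t0).
Qed.

Lemma value_maximizer : bellman_maximizer q g c dom u value (first_maximizer jump_value).
Proof.
have fin i t th : (0 <= th)%R -> jump_int i (pos_part jump_value) t `[0%R, th]%classic < +oo.
  by move=> th0; exact: (jump_value_pos_finite ltr01 t th0).
split => [i|t i [t0 _]].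
  split => [|t t0]; last exact: first_maximizer_ge0.
  apply: measurable_funTS.
  exact: (measurable_first_maximizer hq hc hu jump_value_ni fin).
rewrite value_jump_value // jump_valueE //.
rewrite (bellman_ext_first_maximizer hq hc hu jump_value_ni fin).
by rewrite /bellman_rhs_ext bellman_rhs_value.
Qed.

End Verification.
Theorem theorem5p1 (R : realType) (S : countType) (d : measure_display)
    (T : measurableType d) (P : S -> probability T R) (X : R -> T -> S)
    (J : nat -> T -> R) (q : S -> S -> R) (g : S -> R) (c : R)
    (dom : set R) (u : R -> R)
    (hq : intensity_matrix q) (hX : markov_chain P X J q) (hc : 0 < c)
    (hu : is_utility g dom u) (hA1 : assumptionA1 P X g c)
    (hA2 : assumptionA2 P X J g c dom u) :
  let V := value P X J g c dom u in
  (forall (t : R) i, 0 <= t ->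
     V t i = ereal_sup [set bellman_rhs q g c dom u V t i theta |
                        theta in [set theta : R | 0 <= theta]]) /\
  (exists hstar : R -> S -> \bar R, bellman_maximizer q g c dom u V hstar).
Proof.
split; first by move=> t i t0; exact: (value_bellman hq hX hc hu hA1 hA2).
exists (first_maximizer q g c dom u (jump_value q g c dom u)).
exact: (value_maximizer hq hX hc hu hA1 hA2).
Qed.
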